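(* Let $m>1$, $0<\kappa\le1$, $0<\alpha\le 1$, let $\mu$ be an $\alpha$-dimensional measure on $\mathbb R$ and let $\gamma\in\Gamma(\kappa)$. If $s>\max\left\{\frac14,\frac{1-\alpha}{2},\frac{1-m\alpha\kappa}{2}\right\}$, then $$\lim_{t\to0}S_tf(\gamma(x,t))=f(x)\quad\text{for }\mu\text{-a.e. }x$$ for all $f\in H^s(\mathbb R)$.
   Context: For $0<\alpha\le1$, a positive Borel measure $\mu$ on $\mathbb R$ is called $\alpha$-dimensional if there is a constant $c$ such that $\mu(\mathbb B(x,r))\le c\,r^\alpha$ for all $x\in\mathbb R$ and $r>0$, where $\mathbb B(x,r)$ is the ball (interval) centered at $x$ with radius $r$. For $0<\kappa\le1$, $\Gamma(\kappa)$ is the collection of continuous functions $\gamma:\mathbb R\times[-1,1]\to\mathbb R$ with $\gamma(x,0)=x$ for which there are constants $C_1,C_2>0$ such that $|\gamma(x,t)-\gamma(x,t')|\le C_1|t-t'|^\kappa$ for all $x\in\mathbb R$, $t,t'\in[-1,1]$, and $\frac1{C_2}|x-x'|\le|\gamma(x,t)-\gamma(x',t)|\le C_2|x-x'|$ for all $t\in[-1,1]$, $x,x'\in\mathbb R$. $H^s(\mathbb R)$ is the Sobolev space of order $s$ with norm $\|f\|_{H^s}=\|(1-\Delta)^{s/2}f\|_{L^2(\mathbb R)}$, and $\widehat f(\xi)=\int_{\mathbb R}e^{-ix\xi}f(x)\,dx$. The evolution operator $S_t$ (giving the formal solution of the fractional Schrödinger equation $i\partial_tu+(-\Delta)^{m/2}u=0$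 with $u(\cdot,0)=f$) is defined on appropriate input functions by $$S_tf(x)=\frac1{2\pi}\int_{\mathbb R}e^{i(x\xi+t|\xi|^m)}\widehat f(\xi)\,d\xi .$$ *)

(* Defs.v *)
From mathcomp Require Export all_boot all_order all_algebra.
From mathcomp Require Export complex.
From mathcomp Require Export all_classical all_reals all_analysis.
Export Order.TTheory GRing.Theory Num.Theory.
Export numFieldNormedType.Exports.

Set Implicit Arguments.
Unset Strict Implicit.
Unset Printing Implicit Defensive.

Local Open Scope classical_set_scope.
Local Open Scope ring_scope.
Local Open Scope complex_scope.

(** Functions in H^s are complex valued, [R -> R[i]];
    [R[i]^o] is [R[i]] with the topology of its norm. *)

Section Defs.
Context {R : realType}.

Definition alpha_dimensional (alpha : R)
    (mu : {measure set (measurableTypeR R) -> \bar R}) : Prop :=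
  exists c : R, forall x r : R, 0 < r ->
    (mu (ball x r) <= (c * r `^ alpha)%:E)%E.

Definition Gamma (kappa : R) (gamma : R -> R -> R) : Prop :=
  [/\ {within [set: R] `*` `[(-1 : R), 1],
         continuous (fun p : R * R => gamma p.1 p.2)},
      forall x, gamma x 0 = x,
      exists2 C1 : R, 0 < C1 &
        forall x t t', t \in `[-1, 1] -> t' \in `[-1, 1] ->
          `|gamma x t - gamma x t'| <= C1 * `|t - t'| `^ kappa &
      exists2 C2 : R, 0 < C2 &
        forall t x x', t \in `[-1, 1] ->
          C2^-1 * `|x - x'| <= `|gamma x t - gamma x' t| <= C2 * `|x - x'|].

Definition cintegral (D : set R) (f : R -> R[i]) : R[i] :=
  (\int[lebesgue_measure]_(x in D) complex.Re (f x)) +i*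
  (\int[lebesgue_measure]_(x in D) complex.Im (f x)).

Definition expi (theta : R) : R[i] := cos theta +i* sin theta.

Definition L2norm (f : R -> R[i]) : \bar R :=
  ('N[lebesgue_measure]_2[EFin \o (@Normc.normc R \o f)])%E.

Definition inL2 (f : R -> R[i]) : Prop :=
  [/\ measurable_fun [set: R] (fun x => complex.Re (f x)),
      measurable_fun [set: R] (fun x => complex.Im (f x)) &
      (L2norm f < +oo)%E].

(** The Fourier transform on L^2: [g] is the L^2 limit, as [A] tends to
    infinity, of the Fourier integrals of [f] restricted to [-A, A] (these
    restrictions are integrable). *)
Definition is_fourier (f g : R -> R[i]) : Prop :=
  [/\ inL2 f, inL2 g &
      L2norm (fun xi =>
        cintegral `[- A, A] (fun x => expi (- (x * xi)) * f x) - g xi)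
        @[A --> +oo] --> 0%E].

(** [is_fourier f] determines its second argument up to a Lebesgue-null set,
    on which nothing below depends. *)
Definition fourier (f : R -> R[i]) : R -> R[i] :=
  xget (fun=> 0) [set g | is_fourier f g].

(** [h = (1 - Delta)^(s/2) f]. *)
Definition is_bessel (s : R) (f h : R -> R[i]) : Prop :=
  is_fourier f (fourier f) /\
  is_fourier h (fun xi => ((1 + xi ^+ 2) `^ (s / 2))%:C * fourier f xi).

(** For [0 <= s], where H^s is contained in L^2: the [f] in L^2 such that
    [(1 - Delta)^(s/2) f] is in L^2 (the latter is part of [is_bessel]). *)
Definition sobolev (s : R) (f : R -> R[i]) : Prop :=
  inL2 f /\ exists h, is_bessel s f h.

(** The Fourier transform of an element of H^s need not be integrable when
    [s <= 1/2], so the integral defining [S_t f (x)] is read as the limit of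
    its truncations to [|xi| <= N].  As [lim] is total, assertions about
    [evolution] come with [evolution_defined]. *)
Definition evolution_trunc (m : R) (f : R -> R[i]) (t x N : R) : R[i] :=
  ((2 * pi)^-1)%:C *
  cintegral `[- N, N] (fun xi =>
    expi (x * xi + t * `|xi| `^ m) * fourier f xi).

Definition evolution_defined (m : R) (f : R -> R[i]) (t x : R) : Prop :=
  cvg ((evolution_trunc m f t x N : R[i]^o) @[N --> +oo]).

Definition evolution (m : R) (f : R -> R[i]) (t x : R) : R[i] :=
  lim ((evolution_trunc m f t x N : R[i]^o) @[N --> +oo]).

(** [l] is the value at [x] of the precise representative of the Lebesgue
    class of [f].  The measure [mu] may be singular, so "f(x) for mu-a.e. x"
    has no meaning for an arbitrary representative. *)
Definition has_value (f : R -> R[i]) (x : R) (l : R[i]) : Prop :=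
  (((2 * r)^-1)%:C * cintegral (ball x r) f : R[i]^o) @[r --> 0^'+]
    --> (l : R[i]^o).

End Defs.

(* Main.v *)
Require Import Defs.
From mathcomp Require Import ring lra measurable_realfun.

Set Implicit Arguments.
Unset Strict Implicit.
Unset Printing Implicit Defensive.

Local Open Scope classical_set_scope.
Local Open Scope ring_scope.

(** Let [F] be the Fourier transform of [f].  Both [S_t f (gamma x t)] and the
    averages of [f] over intervals around [x] are limits of integrals of [F]
    over [|xi| <= N], against [exp (i (gamma x t xi + t |xi|^m))] and against
    [exp (i x xi) sin (r xi) / (r xi)] respectively.  It suffices that for
    mu-almost every [x] the parts [M <= |xi| <= N] of these integrals are small
    uniformly in [N] and in [t] (respectively [r]): then the truncated integrals
    converge uniformly, the limits are continuous at [t = 0] and [r = 0], and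
    both limits equal [lim_N (2 pi)^-1 int_(-N)^N exp (i x xi) F xi].

    For a measurable choice of the parameters, a TT* argument bounds the measure
    of the [x] at which such a part exceeds [eps] by a constant times
    [eps^-2 int_(|xi| >= M) |F|^2 |xi|^(2 s)], provided that the kernel
    [int_M^N cos (phase x - phase y) xi^(- 2 s)] is at most
    [K |x - y|^(- b)] with [b < alpha], since an alpha-dimensional measure has
    bounded Riesz potentials of such orders.  Van der Corput's lemma
    interpolated with the trivial bound gives this for every [be <= 1/2] with
    [2 s + be > 1] and [b = max be (be / (kappa m))]; the hypothesis on [s] says
    that some such [be] has [b < alpha].

    The integral formula for the averages is Fourier inversion on intervals,
    proved by Abel summation. *)

(** * Oscillatory integrals *)

(** All analysis is done with real integrals over the half line. Real and imaginary parts, and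
    positive and negative frequencies, become separate integrals of cosines whose phase contains a
    free constant. A shift of that constant by pi / 2 turns cosines into sines, and a shift by pi
    changes the sign, so one-sided bounds suffice. The van der Corput bounds, and the passage from
    unweighted to weighted integrals, are then proved by exhibiting a function whose derivative
    dominates the integrand, without cutting the interval at stationary points.

    The suprema over [t], [r] and [N] are first taken over rational parameters, so that a measurable
    choice among finitely many of them is explicit. They are recovered for all parameters because an
    integral over a bounded band of frequencies depends continuously on them.

    The measure of the exceptional set occurs on both sides of the TT* inequality and has to be
    absorbed, hence has to be finite. For this [mu] is restricted to balls of radius 1 / 2, which
    also keeps all distances below 1. *)

Lemma norm_cos_le1 (R : realType) (x : R) : `|cos x| <= 1.
Proof. by rewrite ler_norml cos_geN1 cos_le1. Qed.

Lemma norm_sin_le1 (R : realType) (x : R) : `|sin x| <= 1.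
Proof. by rewrite ler_norml sin_geN1 sin_le1. Qed.

Section Oscillatory.
Context {R : realType}.
Local Notation leb := (@lebesgue_measure R).
Implicit Types (u D : R -> R) (a b p q x y : R).

Lemma continuous_itv_integrable u a b :
  {within `[a, b], continuous u} -> leb.-integrable `[a, b] (EFin \o u).
Proof.
move=> cu; apply: continuous_compact_integrable => //; exact: segment_compact.
Qed.

(** Comparison in place of integration by parts: [D] minus the primitive of [u] is nondecreasing
    when [u <= D'], so the increment of [D] bounds the integral. The estimates that follow amount to
    finding a suitable [D]. *)
Lemma le_Rintegral_primitive u D (D' : R -> R) (w : R) a b : a <= b ->
  (forall x, x \in `]a, b[ -> is_derive x 1 D (D' x)) ->
  {within `[a, b], continuous u} -> {within `[a, b], continuous D} ->
  (forall x, x \in `]a, b[ -> u x <= D' x) ->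
  D b - D a <= w ->
  \int[leb]_(x in `[a, b]) u x <= w.
Proof.
move=> ab dD cu cD uD Dw; apply: le_trans Dw.
move: ab dD cu cD uD; rewrite le_eqVlt => /predU1P[<- _ _ _ _|ab dD cu cD uD].
  by rewrite set_itv1 Rintegral_set1 subrr.
have iu := continuous_itv_integrable cu.
pose G (x : R) : R := \int[leb]_(t in `[a, x]) u t.
have dG x : x \in `]a, b[ -> is_derive x 1 G (u x).
  move=> xab; have /andP[ax xb] : (a < x) && (x < b) by rewrite in_itv in xab.
  have [|dG G'] := continuous_FTC1_closed xb iu ax.
    by move/(continuous_within_itvP _ ab) : cu => [cu _ _]; exact: cu.
  by rewrite -{}G' derive1E; exact/derivableP.
have dH x : x \in `]a, b[ -> is_derive x 1 (D - G) (D' x - u x).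
  by move=> xab; apply: is_deriveB; [exact: dD|exact: dG].
have cH : {within `[a, b], continuous (D - G)}.
  have cG : {within `[a, b], continuous G}.
    exact: parameterized_integral_continuous (ltW ab) iu.
  by move=> x; apply: cvgB; [exact: cD|exact: cG].
have [c cab] := MVT ab dH cH.
have -> : (D - G) b - (D - G) a = (D b - D a) - (G b - G a).
  by rewrite -[(D - G) b]/(D b - G b) -[(D - G) a]/(D a - G a); ring.
rewrite {2}/G set_itv1 Rintegral_set1 subr0 => DG.
by rewrite -subr_ge0 -/(G b) DG mulr_ge0// subr_ge0 ?(ltW ab)// uD.
Qed.

(** For [D] equal to (sin f - 1) / f1 the derivative is cos f + (1 - sin f) f2 / f1^2. Subtracting 1
    from the sine gives the error term the sign of [f2], so convexity of [f] lets it be dropped and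
    the variation of 1 / f1 is never estimated. *)
Lemma le_cos_vdC1 (f f1 f2 : R -> R) (p q d : R) : p <= q -> 0 < d ->
  (forall x, x \in `[p, q] -> is_derive x 1 f (f1 x)) ->
  (forall x, x \in `[p, q] -> is_derive x 1 f1 (f2 x)) ->
  (forall x, x \in `[p, q] -> 0 <= f2 x) ->
  (forall x, x \in `[p, q] -> d <= f1 x) \/
    (forall x, x \in `[p, q] -> f1 x <= - d) ->
  \int[leb]_(x in `[p, q]) cos (f x) <= 2 / d.
Proof.
move=> pq d0 df df1 f2ge0 f1d.
have f1n0 x : x \in `[p, q] -> f1 x != 0.
  by case: f1d => + xpq => /(_ _ xpq) h; rewrite neq_lt; apply/orP; [right|left]; lra.
have ccos : {within `[p, q], continuous (cos \o f)}.
  apply: derivable_within_continuous => x xpq.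
  have := df _ xpq => h. exact: ex_derive.
pose D (x : R) : R := sin (f x) * (f1 x)^-1 - (f1 x)^-1.
pose D' (x : R) : R := cos (f x) + (1 - sin (f x)) * (f1 x ^- 2 * f2 x).
have dD x : x \in `[p, q] -> is_derive x 1 D (D' x).
  move=> xpq; have h1 := df _ xpq; have h2 := df1 _ xpq.
  have hV : is_derive x 1 (fun x => (f1 x)^-1) (- f1 x ^- 2 *: f2 x).
    by apply: is_deriveV => //; exact: f1n0.
  have hs : is_derive x 1 (sin \o f) (cos (f x) * f1 x).
    by apply: is_derive1_comp.
  apply: (is_derive_eq (is_deriveB (is_deriveM hs hV) hV)).
  rewrite /D' /GRing.scale /=.
  by have := f1n0 _ xpq; set w := f1 x => w0; field.
have dDoo x : x \in `]p, q[ -> is_derive x 1 D (D' x).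
  by move=> xpq; apply: dD; exact: subset_itv_oo_cc.
apply: (le_Rintegral_primitive pq dDoo ccos).
  - apply: derivable_within_continuous => x xpq.
    by have h := dD _ xpq; exact: ex_derive.
  - move=> x /subset_itv_oo_cc xpq; rewrite /D' lerDl mulr_ge0//.
    by rewrite mulr_ge0 ?f2ge0// invr_ge0 exprn_even_ge0.
have Dle x : D x = (sin (f x) - 1) * (f1 x)^-1 by rewrite mulrBl mul1r.
have pin : p \in `[p, q] by rewrite in_itv /= lexx.
have qin : q \in `[p, q] by rewrite in_itv /= lexx andbT.
rewrite !Dle.
(* [D] keeps one sign and has absolute value at most 2 / d, so its increment is at most 2 / d and
   not twice that. *)
have bnd y w : d <= w -> - (2 / d) <= (sin y - 1) * w^-1 <= 0.
  move=> dw; have w0 : 0 < w by lra.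
  have s1 := sin_le1 y; have s2 := sin_geN1 y.
  have : 0 < w^-1 by rewrite invr_gt0.
  have : w^-1 <= d^-1 by rewrite lef_pV2 ?posrE.
  move: (w^-1) => W Wd W0; apply/andP; split; last by nra.
  have : 0 <= (sin y + 1) * W by rewrite mulr_ge0//; lra.
  lra.
case: f1d => h.
  have /andP[h1 h2] := bnd (f p) _ (h _ pin).
  have /andP[h3 h4] := bnd (f q) _ (h _ qin).
  lra.
have dN z : z <= - d -> d <= - z by lra.
have /andP[h1 h2] := bnd (f p) _ (dN _ (h _ pin)).
have /andP[h3 h4] := bnd (f q) _ (dN _ (h _ qin)).
move: h1 h2 h3 h4; rewrite !invrN !mulrN; lra.
Qed.

(** The quotient sin f / f1, singular at a stationary point, is replaced by sin f * f1 / (f1^2 +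
    r^2). The error of its derivative is at most 2 f2 / (f1^2 + r^2), because r^2 <= f2, and this is
    exactly the derivative of (2 / r) atan (f1 / r), a bounded function. *)
Lemma le_cos_vdC2 (f f1 f2 : R -> R) (p q r : R) : p <= q -> 0 < r ->
  (forall x, x \in `[p, q] -> is_derive x 1 f (f1 x)) ->
  (forall x, x \in `[p, q] -> is_derive x 1 f1 (f2 x)) ->
  (forall x, x \in `[p, q] -> r ^+ 2 <= f2 x) ->
  \int[leb]_(x in `[p, q]) cos (f x) <= (1 + 2 * pi) / r.
Proof.
move=> pq r0 df df1 rf2.
have ccos : {within `[p, q], continuous (cos \o f)}.
  apply: derivable_within_continuous => x xpq.
  have := df _ xpq => h. exact: ex_derive.
pose N x : R := f1 x * f1 x + r ^+ 2.
have r20 : 0 < r ^+ 2 by rewrite exprn_gt0.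
have N0 x : 0 < N x by rewrite ltr_wpDl// -expr2 sqr_ge0.
pose D (x : R) : R := sin (f x) * (f1 x * (N x)^-1) + 2 / r * atan (r^-1 * f1 x).
pose D' (x : R) : R := cos (f x) * f1 x ^+ 2 / N x +
  sin (f x) * (f2 x * (r ^+ 2 - f1 x ^+ 2) / N x ^+ 2) + 2 * f2 x / N x.
have dD x : x \in `[p, q] -> is_derive x 1 D (D' x).
  move=> xpq; have h1 := df _ xpq; have h2 := df1 _ xpq.
  have hN : is_derive x 1 N (2 * f1 x * f2 x).
    apply: (is_derive_eq (is_deriveD (is_deriveM h2 h2) (is_derive_cst (r ^+ 2) x 1))).
    by rewrite /GRing.scale /=; ring.
  have hV : is_derive x 1 (fun x => (N x)^-1) (- N x ^- 2 *: (2 * f1 x * f2 x)).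
    by apply: is_deriveV => //; rewrite gt_eqF.
  have hs : is_derive x 1 (sin \o f) (cos (f x) * f1 x).
    by apply: is_derive1_comp.
  have hr : is_derive x 1 (fun x => r^-1 * f1 x) (r^-1 * f2 x).
    by apply: (is_derive_eq (is_deriveZ r^-1 h2)).
  have ha : is_derive x 1 (atan \o (fun x => r^-1 * f1 x))
     ((1 + (r^-1 * f1 x) ^+ 2)^-1 * (r^-1 * f2 x)).
    by apply: is_derive1_comp.
  apply: (is_derive_eq (is_deriveD (is_deriveM hs (is_deriveM h2 hV))
    (is_deriveZ (2 / r) ha))).
  rewrite /D' /GRing.scale /= !fctE.
  have := N0 x; rewrite /N; have rn0 : r != 0 by rewrite gt_eqF.
  move: (f1 x) (f2 x) (cos _) (sin _) => y z c s n0.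
  have n1 : y * y + r ^+ 2 != 0 by rewrite gt_eqF.
  by field; rewrite n1 rn0.
have dDoo x : x \in `]p, q[ -> is_derive x 1 D (D' x).
  by move=> xpq; apply: dD; exact: subset_itv_oo_cc.
apply: (le_Rintegral_primitive pq dDoo ccos).
- apply: derivable_within_continuous => x xpq.
  by have h := dD _ xpq; exact: ex_derive.
- move=> x /subset_itv_oo_cc xpq; rewrite -subr_ge0.
  (* Of the term 2 f2, one half pays for - cos f * r^2 by r^2 <= f2, the other for the last term,
     since (r^2 - f1^2) / (r^2 + f1^2) is at most 1 in absolute value. *)
  have -> : D' x - (cos \o f) x = (N x)^-1 *
      (2 * f2 x - cos (f x) * r ^+ 2
        + f2 x * (sin (f x) * ((r ^+ 2 - f1 x ^+ 2) / N x))).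
    have := N0 x; rewrite /D' /N /=; move: (f1 x) (f2 x) (cos _) (sin _) => y z c s n0.
    by field; rewrite gt_eqF.
  apply: mulr_ge0; first by rewrite invr_ge0 ltW.
  have := rf2 _ xpq; move: (cos_le1 (f x)) (sin_le1 (f x)) (sin_geN1 (f x)).
  have : `|(r ^+ 2 - f1 x ^+ 2) / N x| <= 1.
    rewrite normrM normfV (gtr0_norm (N0 x)) ler_pdivrMr// mul1r /N ler_norml.
    by have := sqr_ge0 (f1 x); rewrite expr2 => ?; apply/andP; split; lra.
  rewrite ler_norml => /andP[]; move: ((_ - _) / _) => Q Q1 Q2.
  move: (f2 x) (cos _) (sin _) => z c s c1 s1 s2 rz.
  have c2 : c * r ^+ 2 <= z by nra.
  have : `|s * Q| <= 1.
    rewrite normrM; have /ler_pM : `|s| <= 1 by rewrite ler_norml s1 s2.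
    by move=> /(_ `|Q| 1 (normr_ge0 _) (normr_ge0 _)); rewrite mulr1 ler_norml; apply; apply/andP.
  rewrite ler_norml => /andP[]; move: (s * Q) => w w1 w2.
  by nra.
(* Each end contributes at most 1 / (2 r) through |y| / (y^2 + r^2) <= 1 / (2 r), and pi / r through
   the arctangent. *)
- have sb y : `|sin y| <= 1 by rewrite ler_norml sin_le1 sin_geN1.
  have hb x : `|f1 x * (N x)^-1| <= (2 * r)^-1.
    rewrite normrM normfV (gtr0_norm (N0 x)) ler_pdivrMr// /N.
    rewrite mulrC ler_pdivlMr ?mulr_gt0//; move: (f1 x) => y.
    by have [y0|y0] := ger0P y; [have := sqr_ge0 (y - r)|have := sqr_ge0 (y + r)];
      rewrite expr2; lra.
  have shb x : `|sin (f x) * (f1 x * (N x)^-1)| <= (2 * r)^-1.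
    by rewrite normrM -[leRHS]mul1r ler_pM.
  have ab x : `|2 / r * atan (r^-1 * f1 x)| <= pi / r.
    rewrite normrM gtr0_norm ?divr_gt0// mulrAC ler_pM2r ?invr_gt0// -ler_pdivlMl//.
    by rewrite ler_norml mulrC ltW ?atan_gtNpi2//= ltW ?atan_ltpi2.
  rewrite /D; move: (shb p) (shb q) (ab p) (ab q); rewrite !ler_norml invfM.
  move=> /andP[? ?] /andP[? ?] /andP[? ?] /andP[? ?].
  by rewrite mulrDl; lra.
Qed.

Lemma gt0_powRD (x r t : R) : 0 < x -> x `^ (r + t) = x `^ r * x `^ t.
Proof.
move=> x0; have xn0 : x != 0 by rewrite gt_eqF.
by rewrite powRD// xn0 implybT.
Qed.

Lemma powR_ge1 (x r : R) : 1 <= x -> 0 <= r -> 1 <= x `^ r.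
Proof. by move=> x1 r0; rewrite -(powRr0 x) ler_powR. Qed.

Lemma gt0_powRB (x r t : R) : 0 < x -> x `^ (r - t) = x `^ r / x `^ t.
Proof. by move=> x0; rewrite gt0_powRD// powRN. Qed.

Lemma powRB1 (x r : R) : 0 < x -> x `^ (r - 1) = x `^ r / x.
Proof. by move=> x0; rewrite gt0_powRB// powRr1// ltW. Qed.

Lemma is_derive_phase (m A b c x : R) : 0 < x ->
  is_derive x 1 (fun y => A * y + b * y `^ m + c) (A + b * m * (x `^ m / x)).
Proof.
move=> x0; have h := is_derive1_powR m x0.
apply: (is_derive_eq (is_deriveD (is_deriveD (is_deriveZ A (is_derive_id x 1))
  (is_deriveZ b h)) (is_derive_cst c x 1))).
by rewrite /GRing.scale /= powRB1//; ring.
Qed.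

Lemma is_derive_phase1 (m A b x : R) : 0 < x ->
  is_derive x 1 (fun y => A + b * m * (y `^ m / y))
    (b * m * (m - 1) * (x `^ m / x ^+ 2)).
Proof.
move=> x0; have h := is_derive1_powR m x0.
have hV : is_derive x 1 (fun y : R => y^-1) (- x ^- 2 *: 1).
  by apply: is_deriveV; rewrite gt_eqF.
apply: (is_derive_eq (is_deriveD (is_derive_cst A x 1)
  (is_deriveZ (b * m) (is_deriveM h hV)))).
by rewrite /GRing.scale /= powRB1//; field; rewrite gt_eqF.
Qed.

Lemma Rintegral_le_length u p q : p <= q -> {within `[p, q], continuous u} ->
  (forall x, x \in `[p, q] -> u x <= 1) -> \int[leb]_(x in `[p, q]) u x <= q - p.
Proof.
move=> pq cu u1.
have d1 x : x \in `]p, q[ -> is_derive x 1 (@id R) 1 by move=> _; exact: is_derive_id.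
apply: (le_Rintegral_primitive pq d1 cu) => //.
  by apply: continuous_subspaceT => x; exact: cvg_id.
by move=> x /subset_itv_oo_cc /u1.
Qed.

Lemma le_sqrt_of_sqr (x y : R) : 0 <= y -> x ^+ 2 <= y -> x <= Num.sqrt y.
Proof.
move=> y0 xy; rewrite (le_trans (ler_norm x))// -sqrtr_sqr ler_sqrt//.
Qed.

(** The summand 2 serves the trivial and the first-derivative bounds. The other is the constant of
    [le_cos_vdC2] for a second derivative at least (m - 1) / 2^(m + 1) / (q Y); the power of 2 is
    the price of freezing x^(m - 2) on a dyadic interval. *)
Definition osc_cst (m : R) : R :=
  2 + (1 + 2 * pi) / Num.sqrt ((m - 1) / 2 `^ (m + 1)).

Lemma osc_cst_ge0 (m : R) : 0 <= osc_cst m.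
Proof.
rewrite addr_ge0// divr_ge0// ?sqrtr_ge0// addr_ge0// mulr_ge0//; exact: pi_ge0.
Qed.

(** [Y] is the length scale at which the linear part or the power part of the phase becomes of order
    1. The first derivative is large, and the integral of order [Y], unless the power part is strong
    enough to cancel [A]; the second derivative is then of order at least 1 / (q Y), which gives the
    same bound. *)
Lemma le_osc_dyadic (m A b c p q Y : R) : 1 < m -> 0 <= b -> 0 < p -> p <= q ->
  q <= 2 * p -> 0 < Y -> 1 <= Y * `|A| \/ 1 <= Y `^ m * b ->
  \int[leb]_(x in `[p, q]) cos (A * x + b * x `^ m + c) <=
  osc_cst m * Num.sqrt (q * Y).
Proof.
move=> m1 b0 p0 pq q2p Y0 hY.
have q0 : 0 < q := lt_le_trans p0 pq.
have xp x : x \in `[p, q] -> 0 < x.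
  by rewrite in_itv /= => /andP[px _]; exact: lt_le_trans px.
pose f (x : R) : R := A * x + b * x `^ m + c.
pose f1 (x : R) : R := A + b * m * (x `^ m / x).
pose f2 (x : R) : R := b * m * (m - 1) * (x `^ m / x ^+ 2).
have df x : x \in `[p, q] -> is_derive x 1 f (f1 x).
  by move=> /xp x0; exact: is_derive_phase.
have df1 x : x \in `[p, q] -> is_derive x 1 f1 (f2 x).
  by move=> /xp x0; exact: is_derive_phase1.
have f20 x : x \in `[p, q] -> 0 <= f2 x.
  move=> /xp x0; rewrite !mulr_ge0// ?powR_ge0 ?invr_ge0 ?sqr_ge0//; lra.
set I := Rintegral _ _ _.
have ccos : {within `[p, q], continuous (cos \o f)}.
  apply: derivable_within_continuous => x xpq.
  by have := df _ xpq => h; exact: ex_derive.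
have Iq : I <= q.
  apply: (@le_trans _ _ (q - p)); last by lra.
  by apply: Rintegral_le_length pq ccos _ => x _; exact: cos_le1.
have qY0 : 0 < q * Y by rewrite mulr_gt0.
(* A bound of order [Y] and the trivial bound [I <= q] combine to their geometric mean. *)
have C1 d : d <= 4 * Y -> I <= d -> I <= osc_cst m * Num.sqrt (q * Y).
  move=> dY Id.
  have h : I <= 2 * Num.sqrt (q * Y).
    have [I0|I0] := leP I 0; first by rewrite (le_trans I0)// mulr_ge0// sqrtr_ge0.
    rewrite -(ger0_norm (_ : 0 <= 2 :> R))// -sqrtr_sqr -sqrtrM ?sqr_ge0//.
    by apply: le_sqrt_of_sqr; [rewrite !mulr_ge0// ltW|nra].
  apply: (le_trans h); rewrite ler_wpM2r ?sqrtr_ge0// /osc_cst lerDl.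
  rewrite divr_ge0 ?sqrtr_ge0// addr_ge0// mulr_ge0//; exact: pi_ge0.
pose k := (m - 1) / 2 `^ (m + 1).
have k0 : 0 < k by rewrite divr_gt0 ?powR_gt0//; lra.
have C2 : (forall x, x \in `[p, q] -> k / (q * Y) <= f2 x) ->
    I <= osc_cst m * Num.sqrt (q * Y).
  move=> kf2; pose r := Num.sqrt (k / (q * Y)).
  have r0 : 0 < r by rewrite sqrtr_gt0 divr_gt0.
  have rf2 x : x \in `[p, q] -> r ^+ 2 <= f2 x.
    by move=> /kf2; rewrite /r sqr_sqrtr// ltW// divr_gt0.
  apply: (le_trans (le_cos_vdC2 pq r0 df df1 rf2)).
  rewrite /r sqrtrM ?(ltW k0)// sqrtrV ?(ltW qY0)// invfM invrK mulrA.
  by rewrite ler_wpM2r ?sqrtr_ge0// /osc_cst lerDr.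
have low x : x \in `[p, q] -> q `^ m / q ^+ 2 / 2 `^ m <= x `^ m / x ^+ 2.
  move=> xpq; have x0 := xp _ xpq.
  have /andP[px xq] : (p <= x) && (x <= q) by rewrite in_itv in xpq.
  rewrite mulrAC ler_pM ?invr_ge0 ?sqr_ge0 ?divr_ge0 ?powR_ge0//.
    rewrite ler_pdivrMr ?powR_gt0// -powRM ?(ltW x0)//.
    by rewrite ge0_ler_powR ?nnegrE; lra.
  by rewrite lef_pV2 ?posrE ?exprn_gt0// lerXn2r ?nnegrE ?(ltW x0) ?(ltW q0).
have pow2 : 2 `^ (m + 1) = 2 * 2 `^ m.
  by rewrite gt0_powRD// powRr1// mulrC.
have p2 : 0 < (2 : R) `^ m by rewrite powR_gt0.
have P0 : 0 < q `^ m by rewrite powR_gt0.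
case: hY => hY.
  have [A0|A0|A0] := ltgtP A 0; last by move: hY; rewrite A0 normr0 mulr0 ler10.
    (* As [f1] increases, its value at [q] decides. If that is at most A / 2, the first-derivative
       bound applies on the whole interval. Otherwise b m q^(m - 1) exceeds |A| / 2, and [f2]
       inherits a lower bound from it. *)
    have [h|h] := leP (f1 q) (A / 2).
      apply: (C1 (2 / (- A / 2))).
        rewrite ltr0_norm// in hY.
        by rewrite ler_pdivrMr; [lra|lra].
      apply: (@le_cos_vdC1 f f1 f2) => //; first by lra.
      right=> x xpq; have x0 := xp _ xpq.
      suff : f1 x <= f1 q by lra.
      have /andP[px xq] : (p <= x) && (x <= q) by rewrite in_itv in xpq.
      rewrite /f1 lerD2l ler_wpM2l ?mulr_ge0//; first lra.
      by rewrite -!powRB1// ge0_ler_powR ?nnegrE; lra.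
    apply: C2 => x xpq; have := low _ xpq => l.
    have h' : - A / 2 <= b * m * (q `^ m / q) by move: h; rewrite /f1; lra.
    rewrite ltr0_norm// in hY.
    have m10 : 0 < m - 1 by lra.
    apply: (@le_trans _ _ ((m - 1) * (b * m) * (q `^ m / q ^+ 2 / 2 `^ m))).
      have -> : (m - 1) * (b * m) * (q `^ m / q ^+ 2 / 2 `^ m) =
         (b * m * (q `^ m / q)) * Y * ((m - 1) / (2 `^ m * (q * Y))).
        by field; rewrite !gt_eqF.
      have -> : k / (q * Y) = 2^-1 * ((m - 1) / (2 `^ m * (q * Y))).
        by rewrite /k pow2; field; rewrite !gt_eqF.
      have : 0 <= (m - 1) / (2 `^ m * (q * Y)) by rewrite divr_ge0 ?mulr_ge0 ?ltW.
      by move=> h0; apply: ler_wpM2r => //; nra.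
    rewrite /f2 [X in _ <= X * _]mulrC ler_wpM2l// !mulr_ge0//; lra.
  apply: (C1 (2 / A)).
    rewrite gtr0_norm// in hY; by rewrite ler_pdivrMr//; lra.
  apply: (@le_cos_vdC1 f f1 f2) => //.
  left=> x xpq; have x0 := xp _ xpq.
  rewrite /f1 lerDl !mulr_ge0 ?powR_ge0 ?invr_ge0 ?(ltW x0)//; lra.
have [qY|Yq] := leP q Y.
  by apply: (C1 q); [lra|].
apply: C2 => x xpq; have := low _ xpq => l.
have m10 : 0 < m - 1 by lra.
(* For Y < q the ratio q / Y exceeds 1 and may be raised to the power [m], where the hypothesis Y^m
   b >= 1 applies. *)
have hb : q * Y^-1 <= b * q `^ m.
  apply: (@le_trans _ _ ((q * Y^-1) `^ m)).
    have q1 : 1 <= q * Y^-1 by rewrite ler_pdivlMr// mul1r ltW.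
    by rewrite -{1}(powRr1 (le_trans ler01 q1)) (ler_powR q1 (ltW m1)).
  rewrite powRM ?invr_ge0 ?(ltW q0) ?(ltW Y0)// mulrC ler_wpM2r// ?(ltW P0)//.
  rewrite -(powR_inv1 (ltW Y0)) -powRrM mulN1r powRN.
  by rewrite -[leLHS]mul1r ler_pdivrMr ?powR_gt0// mulrC.
apply: (@le_trans _ _ ((m - 1) * (b * m) * (q `^ m / q ^+ 2 / 2 `^ m))).
  have -> : (m - 1) * (b * m) * (q `^ m / q ^+ 2 / 2 `^ m) =
     m * (b * q `^ m) * ((m - 1) / (2 `^ m * q ^+ 2)).
    by field; rewrite !gt_eqF.
  have -> : k / (q * Y) = 2^-1 * (q * Y^-1) * ((m - 1) / (2 `^ m * q ^+ 2)).
    by rewrite /k pow2; field; rewrite !gt_eqF.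
  have h0 : 0 <= (m - 1) / (2 `^ m * q ^+ 2).
    by rewrite divr_ge0 ?mulr_ge0 ?sqr_ge0 ?ltW.
  have : 0 < q * Y^-1 by rewrite divr_gt0.
  by move=> h1; apply: ler_wpM2r => //; nra.
rewrite /f2 [X in _ <= X * _]mulrC ler_wpM2l// !mulr_ge0//; lra.
Qed.

Lemma Rintegral_itv_split u p z q : leb.-integrable `[p, q] (EFin \o u) ->
  p <= z -> z <= q ->
  \int[leb]_(x in `[p, q]) u x =
  \int[leb]_(x in `[p, z]) u x + \int[leb]_(x in `[z, q]) u x.
Proof.
move=> iu pz zq.
have := @Rintegral_itvB R u (BLeft p) (BRight q) z iu.
rewrite !bnd_simp => /(_ pz zq) /eqP; rewrite subr_eq addrC => /eqP ->.
congr (_ + _); apply: Rintegral_itv_obnd_cbnd.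
by apply: integrableS iu => //; apply: subset_itv; rewrite bnd_simp.
Qed.

Lemma continuous_phase_cos (m A b c p q : R) : 0 < p ->
  {within `[p, q], continuous (fun x => cos (A * x + b * x `^ m + c))}.
Proof.
move=> p0; apply: derivable_within_continuous => x.
rewrite in_itv /= => /andP[px _].
have h := is_derive_phase m A b c (lt_le_trans p0 px).
have h2 : is_derive x 1 (cos \o (fun x => A * x + b * x `^ m + c)) _ :=
  is_derive1_comp (is_derive_cos _) h.
exact: (@ex_derive _ _ _ _ _ _ _ h2).
Qed.

Lemma RintegralN_itv u p q : leb.-integrable `[p, q] (EFin \o u) ->
  \int[leb]_(x in `[p, q]) - u x = - \int[leb]_(x in `[p, q]) u x.
Proof.
move=> iu; rewrite -mulN1r -RintegralZl//.
by apply: eq_Rintegral => x _; rewrite mulN1r.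
Qed.

(** Evenness of the cosine makes [b] nonnegative, and adding pi to [c] changes the sign of the
    integrand: the constant phase is carried along so that an upper bound yields a two-sided one. *)
Lemma osc_dyadic (m A b c p q Y : R) : 1 < m -> 0 < p -> p <= q ->
  q <= 2 * p -> 0 < Y -> 1 <= Y * `|A| \/ 1 <= Y `^ m * `|b| ->
  `|\int[leb]_(x in `[p, q]) cos (A * x + b * x `^ m + c)| <=
  osc_cst m * Num.sqrt (q * Y).
Proof.
move=> m1 p0 pq q2p Y0 hY.
have le A' b' c' : 1 <= Y * `|A'| \/ 1 <= Y `^ m * `|b'| ->
    \int[leb]_(x in `[p, q]) cos (A' * x + b' * x `^ m + c') <=
    osc_cst m * Num.sqrt (q * Y).
  move=> h; have [b0|b0] := leP 0 b'.
    by apply: le_osc_dyadic => //; case: h => h; [left|right; rewrite -(ger0_norm b0)].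
  under eq_Rintegral => x _.
    rewrite -cosN !opprD -!mulNr; over.
  rewrite /=; apply: le_osc_dyadic => //; first lra.
  by rewrite normrN; case: h => h; [left|right; rewrite -(ltr0_norm b0)].
rewrite ler_norml le// andbT lerNl -RintegralN_itv; last first.
  exact/continuous_itv_integrable/continuous_phase_cos.
under eq_Rintegral => x _.
  rewrite -cosDpi -addrA; over.
exact: le.
Qed.

(** Halving [q] multiplies the bound by sqrt (1 / 2) <= 3 / 4, so the dyadic pieces form a geometric
    series of sum 1 / (1 - 3 / 4) = 4. *)
Lemma osc_sqrt (m A b c p q Y : R) : 1 < m -> 0 < p -> p <= q ->
  0 < Y -> 1 <= Y * `|A| \/ 1 <= Y `^ m * `|b| ->
  `|\int[leb]_(x in `[p, q]) cos (A * x + b * x `^ m + c)| <=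
  4 * osc_cst m * Num.sqrt (q * Y).
Proof.
move=> m1 p0 pq Y0 hY.
have [n qn] : exists n : nat, q <= 2 ^+ n * p.
  have [n _ hn] := near_infty_natSinv_lt (PosNum (divr_gt0 p0 (lt_le_trans p0 pq))).
  exists n.+1; have {hn} := hn _ (leqnn _).
  rewrite /= ltr_pdivlMr ?(lt_le_trans p0)//.
  rewrite mulrC ltr_pdivrMr// => /ltW /le_trans; apply.
  by rewrite mulrC ler_wpM2r ?(ltW p0)// -natrX ler_nat ltnW// ltn_expl.
have C0 := osc_cst_ge0 m.
elim: n q qn pq => [|n IH] q qn pq.
  have E : q = p by apply/eqP; rewrite eq_le pq andbT; rewrite expr0 mul1r in qn.
  by rewrite E set_itv1 Rintegral_set1 normr0 !mulr_ge0// sqrtr_ge0.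
have q0 := lt_le_trans p0 pq.
have hd p' : 0 < p' -> p' <= q -> q <= 2 * p' ->
   `|\int[leb]_(x in `[p', q]) cos (A * x + b * x `^ m + c)| <=
   osc_cst m * Num.sqrt (q * Y) by move=> *; exact: osc_dyadic.
have s0 : 0 <= Num.sqrt (q * Y) by rewrite sqrtr_ge0.
have cs0 := mulr_ge0 C0 s0.
have [q2p|pq2] := leP q (2 * p).
  by apply: le_trans (hd _ p0 pq q2p) _; lra.
have z0 : 0 < q / 2 by lra.
rewrite (@Rintegral_itv_split _ _ (q / 2)); [|..|lra|lra]; last first.
  exact/continuous_itv_integrable/continuous_phase_cos.
apply: le_trans (ler_normD _ _) _.
have h1 : `|\int[leb]_(x in `[p, q / 2]) cos (A * x + b * x `^ m + c)| <=
    4 * osc_cst m * Num.sqrt (q / 2 * Y).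
  by apply: IH; [rewrite exprS in qn; lra|lra].
have h2 := hd (q / 2) z0 ltac:(lra) ltac:(lra).
have h3 : Num.sqrt (q / 2 * Y) <= 3 / 4 * Num.sqrt (q * Y).
  rewrite -(ger0_norm (_ : 0 <= 3 / 4 :> R)) ?divr_ge0// -sqrtr_sqr -sqrtrM ?sqr_ge0//.
  have : 0 < q * Y by rewrite mulr_gt0.
  by move=> qY; rewrite ler_sqrt ?mulr_ge0 ?sqr_ge0 ?(ltW qY)//; nra.
have : osc_cst m * Num.sqrt (q / 2 * Y) <= osc_cst m * (3 / 4 * Num.sqrt (q * Y)).
  by rewrite ler_wpM2l.
by lra.
Qed.

(** Interpolation of sqrt (q Y) with the length [q]. For q <= Y the length is the better bound; for
    Y <= q one has (Y / q)^(1 / 2) <= (Y / q)^be because be <= 1 / 2. This limit on [be] is the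
    origin of the 1 / 4 in the theorem. *)
Lemma osc_powR (m A b c p q Y be : R) : 1 < m -> 0 < p -> p <= q ->
  0 < Y -> 0 <= be -> be <= 1 / 2 ->
  1 <= Y * `|A| \/ 1 <= Y `^ m * `|b| ->
  `|\int[leb]_(x in `[p, q]) cos (A * x + b * x `^ m + c)| <=
  (1 + 4 * osc_cst m) * Y `^ be * q `^ (1 - be).
Proof.
move=> m1 p0 pq Y0 be0 be2 hY; have q0 := lt_le_trans p0 pq.
have C0 := osc_cst_ge0 m.
have I2 := osc_sqrt c m1 p0 pq Y0 hY.
have I1 : `|\int[leb]_(x in `[p, q]) cos (A * x + b * x `^ m + c)| <= q.
  have icos := continuous_itv_integrable (@continuous_phase_cos m A b c p q p0).
  apply: le_trans (le_normr_Rintegral _ icos) _ => //.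
  apply: le_trans (_ : q - p <= _); last by lra.
  apply: Rintegral_le_length => // [x|x _]; last exact: norm_cos_le1.
  by apply: cvg_norm; exact: continuous_phase_cos.
have W0 : 0 <= Y `^ be * q `^ (1 - be) by rewrite mulr_ge0 ?powR_ge0.
have qE : q = q `^ be * q `^ (1 - be).
  by rewrite -gt0_powRD// addrC subrK powRr1// ltW.
rewrite -mulrA mulrDl mul1r.
have [qY|/ltW Yq] := leP q Y.
  apply: le_trans I1 _; apply: (@le_trans _ _ (Y `^ be * q `^ (1 - be))).
    rewrite {1}qE ler_wpM2r ?powR_ge0// ge0_ler_powR ?nnegrE ?(ltW q0)//.
    exact: ltW.
  by rewrite lerDl !mulr_ge0 ?powR_ge0.
apply: le_trans I2 _; rewrite -[leLHS]add0r lerD// ler_wpM2l ?mulr_ge0//.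
have -> : Num.sqrt (q * Y) = q * (Y / q) `^ (1 / 2).
  rewrite mul1r powR12_sqrt ?divr_ge0 ?(ltW q0) ?(ltW Y0)//.
  rewrite -{2}(ger0_norm (ltW q0)) -sqrtr_sqr -sqrtrM ?sqr_ge0//.
  by congr Num.sqrt; field; rewrite gt_eqF.
have -> : Y `^ be * q `^ (1 - be) = q * (Y / q) `^ be.
  rewrite powRM ?invr_ge0 ?(ltW q0) ?(ltW Y0)// -(powR_inv1 (ltW q0)) -powRrM mulN1r.
  by rewrite gt0_powRB// powRr1 ?(ltW q0)// powRN; ring.
rewrite ler_wpM2l ?(ltW q0)// ger_powR// divr_gt0//= ler_pdivrMr// mul1r//.
Qed.

(** Integration by parts as a comparison: with [E] the primitive of [u], the derivative of E x^(- s)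
    misses the integrand by - s E x^(- s - 1), and the bound on [E] lets the second term of [D]
    compensate for it. Since s + be > 1 that term is a decaying power, so the result does not depend
    on [N]. *)
Lemma le_weighted (u : R -> R) (s be K M N : R) : 1 <= M -> M <= N ->
  0 < s -> 0 < s + be - 1 -> 0 <= K ->
  {within `[M, N], continuous u} ->
  (forall x, x \in `[M, N] -> \int[leb]_(y in `[M, x]) u y <= K * x `^ (1 - be)) ->
  \int[leb]_(x in `[M, N]) (u x * x `^ (- s)) <= K * (1 + s / (s + be - 1)).
Proof.
move=> M1 MN s0 eta0 K0 cu hK; pose eta : R := s + be - 1.
have M0 : 0 < M by lra.
have xp x : x \in `[M, N] -> 0 < x.
  by rewrite in_itv /= => /andP[px _]; exact: lt_le_trans px.
have [MeqN|MN'] := eqVneq M N.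
  by rewrite -MeqN set_itv1 Rintegral_set1 mulr_ge0// addr_ge0// divr_ge0// ltW.
have {}MN' : M < N by rewrite lt_neqAle MN'.
have iu := continuous_itv_integrable cu.
pose E (x : R) : R := \int[leb]_(t in `[M, x]) u t.
have cE : {within `[M, N], continuous E}.
  exact: parameterized_integral_continuous MN iu.
have cp r : {within `[M, N], continuous (fun x : R => x `^ r)}.
  apply: derivable_within_continuous => x /xp x0.
  have h := is_derive1_powR r x0; exact: (@ex_derive _ _ _ _ _ _ _ h).
have dE x : x \in `]M, N[ -> is_derive x 1 E (u x).
  move=> xab; have /andP[ax xb] : (M < x) && (x < N) by rewrite in_itv in xab.
  have [|dG G'] := continuous_FTC1_closed xb iu ax.
    by move/(continuous_within_itvP _ MN') : cu => [cu _ _]; exact: cu.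
  by rewrite -{}G' derive1E; exact/derivableP.
pose D (x : R) : R := E x * x `^ (- s) - (K * s / eta) * x `^ (- eta).
pose D' (x : R) : R := u x * x `^ (- s) + s * (K * x `^ (- eta) - E x * x `^ (- s)) / x.
have dD x : x \in `]M, N[ -> is_derive x 1 D (D' x).
  move=> xMN; have h := dE _ xMN; have x0 := xp _ (subset_itv_oo_cc xMN).
  have h1 := is_derive1_powR (- s) x0; have h2 := is_derive1_powR (- eta) x0.
  apply: (is_derive_eq (is_deriveB (is_deriveM h h1) (is_deriveZ (K * s / eta) h2))).
  rewrite /D' /GRing.scale /= !powRB1//.
  by field; rewrite !gt_eqF.
apply: (le_Rintegral_primitive MN dD).
- by move=> x; apply: cvgM; [exact: cu|exact: cp].
- move=> x; apply: cvgB; first by apply: cvgM; [exact: cE|exact: cp].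
  by apply: cvgM; [exact: cvg_cst|exact: cp].
- move=> x /subset_itv_oo_cc xMN; have x0 := xp _ xMN.
  rewrite /D' lerDl divr_ge0 ?(ltW x0)// mulr_ge0 ?(ltW s0)// subr_ge0.
  have -> : - eta = (1 - be) + - s by rewrite /eta; ring.
  by rewrite gt0_powRD// mulrA ler_wpM2r ?powR_ge0// hK.
have E0 : E M = 0 by rewrite /E set_itv1 Rintegral_set1.
have Nin : N \in `[M, N] by rewrite in_itv /= MN lexx.
rewrite /D E0 mul0r.
have N0 := xp _ Nin.
have e1 : E N * N `^ (- s) <= K.
  apply: (@le_trans _ _ (K * N `^ (- eta))).
    have -> : - eta = (1 - be) + - s by rewrite /eta; ring.
    by rewrite gt0_powRD// mulrA ler_wpM2r ?powR_ge0// hK.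
  rewrite -[leRHS]mulr1 ler_wpM2l// powRN invf_le1 ?powR_gt0//.
  by rewrite powR_ge1 ?(ltW eta0)//; lra.
have q0 : 0 <= K * s / eta by rewrite divr_ge0 ?mulr_ge0 ?(ltW s0) ?(ltW eta0).
have e2 : K * s / eta * M `^ (- eta) <= K * s / eta.
  rewrite -[leRHS]mulr1 ler_wpM2l// powRN invf_le1 ?powR_gt0//.
  by rewrite powR_ge1 ?(ltW eta0)//; lra.
have e3 : 0 <= K * s / eta * N `^ (- eta) by rewrite mulr_ge0 ?powR_ge0.
rewrite mulrDr mulr1 mulrA -/eta.
lra.
Qed.

Definition ker_cst (m s be : R) : R :=
  (1 + 4 * osc_cst m) * (1 + s / (s + be - 1)).

(** Used with twice the Sobolev order in the place of [s]. The parameter [Y] separates the size of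
    the oscillation from its cause: a caller picks the [Y] for which one of the two alternatives
    holds. *)
Lemma kernel_bound (m s be A b c M N Y : R) : 1 < m -> 1 <= M -> M <= N ->
  0 < s -> 0 < s + be - 1 -> 0 <= be -> be <= 1 / 2 -> 0 < Y ->
  1 <= Y * `|A| \/ 1 <= Y `^ m * `|b| ->
  `|\int[leb]_(x in `[M, N]) (cos (A * x + b * x `^ m + c) * x `^ (- s))| <=
  ker_cst m s be * Y `^ be.
Proof.
move=> m1 M1 MN s0 eta0 be0 be2 Y0 hY; have M0 : 0 < M by lra.
have le A' b' c' : 1 <= Y * `|A'| \/ 1 <= Y `^ m * `|b'| ->
    \int[leb]_(x in `[M, N]) (cos (A' * x + b' * x `^ m + c') * x `^ (- s)) <=
    ker_cst m s be * Y `^ be.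
  move=> h; rewrite /ker_cst mulrAC; apply: le_weighted => //.
  - by rewrite mulr_ge0 ?powR_ge0// addr_ge0// mulr_ge0// osc_cst_ge0.
  - exact: continuous_phase_cos.
  - move=> x; rewrite in_itv /= => /andP[Mx _].
    by apply: le_trans (ler_norm _) _; exact: osc_powR.
rewrite ler_norml le// andbT lerNl -RintegralN_itv; last first.
  apply: continuous_itv_integrable => x; apply: cvgM; first exact: continuous_phase_cos.
  move: x; apply: derivable_within_continuous => x; rewrite in_itv /= => /andP[px _].
  have h := is_derive1_powR (- s) (lt_le_trans M0 px).
  exact: (@ex_derive _ _ _ _ _ _ _ h).
under eq_Rintegral => x _.
  rewrite -mulNr -cosDpi -addrA; over.
exact: le.
Qed.

End Oscillatory.

(** * Oscillatory integrals with a factor sin (r x) / (r x) *)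

Section Sinc.
Context {R : realType}.
Local Notation leb := (@lebesgue_measure R).

Lemma is_derive_sin_Rintegral (D : set R) (h : R -> R) (z : R) :
  measurable D ->
  (forall w, leb.-integrable D (EFin \o (fun x => sin (w * x) * h x))) ->
  leb.-integrable D (EFin \o (fun x => x * h x)) ->
  is_derive z 1 (fun w => \int[leb]_(x in D) (sin (w * x) * h x))
    (\int[leb]_(x in D) (cos (z * x) * (x * h x))).
Proof.
move=> mD ih ixh.
pose f (w x : R) : R := sin (w * x) * h x.
have df (w x : R) : is_derive w 1 (f ^~ x) (cos (w * x) * (x * h x)).
  have h1 : is_derive w 1 (fun w => x * w) x.
    by apply: (is_derive_eq (is_deriveZ x (is_derive_id w 1))); rewrite /GRing.scale /= mulr1.
  have h2 := is_derive1_comp (is_derive_sin (x * w)) h1.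
  have -> : f ^~ x = (fun w => h x * (sin \o (fun w => x * w)) w).
    by apply/funext => y; rewrite /f /= mulrC (mulrC x).
  apply: (is_derive_eq (is_deriveZ (h x) h2)).
  by rewrite /GRing.scale /= (mulrC x w); ring.
have pE (w x : R) : partial1of2 f w x = cos (w * x) * (x * h x).
  by rewrite partial1of2E; have := df w x => -[_ ->].
have Iz : `]z - 1, z + 1[%classic z by rewrite /= in_itv /=; apply/andP; split; lra.
have derf (w x : R) : `]z - 1, z + 1[%classic w -> D x -> derivable (f ^~ x) w 1.
  by move=> _ _; have := df w x => -[].
have iG : leb.-integrable D (EFin \o (fun x => `|x * h x|)) by exact: integrable_norm.
have Gub (w x : R) : `]z - 1, z + 1[%classic w -> D x ->
    `|partial1of2 f w x| <= `|x * h x|.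
  by move=> _ _; rewrite pE normrM ler_piMl// ler_norml cos_geN1 cos_le1.
have G0 (x : R) : 0 <= `|x * h x| by [].
have intf (w : R) : `]z - 1, z + 1[%classic w -> leb.-integrable D (EFin \o f w).
  by move=> _; exact: ih.
have d1 := @derivable_under_integral _ _ _ leb f D mD z _ _ Iz intf derf _ G0 iG Gub.
have d2 := @differentiation_under_integral _ _ _ leb f D mD z _ _ Iz intf derf _ G0 iG Gub.
apply: DeriveDef; first exact: d1.
rewrite -derive1E d2; apply: eq_Rintegral => x _; exact: pE.
Qed.

Lemma is_derive_continuous (f : R -> R) (x d : R) :
  is_derive x 1 f d -> {for x, continuous f}.
Proof.
by move=> -[df _]; apply: differentiable_continuous; exact/derivable1_diffP.
Qed.

(** The bound on the derivative blows up at 0 but is integrable there, since be < 1. The comparison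
    function is continuous at 0, which is all the mean value theorem asks of an end point. *)
Lemma le_primitive_powR (g dg : R -> R) (K be w : R) : 0 < be -> be < 1 -> 0 <= K ->
  (forall x : R, is_derive x 1 g (dg x)) -> g 0 = 0 ->
  (forall x, 0 < x -> dg x <= K * x `^ (- be)) -> 0 <= w ->
  g w <= K / (1 - be) * w `^ (1 - be).
Proof.
move=> be0 be1 K0 dg_ g0 dgK; rewrite le_eqVlt => /predU1P[<-|w0].
  by rewrite g0 mulr_ge0 ?powR_ge0// divr_ge0// subr_ge0 ltW.
have b1 : 0 < 1 - be by rewrite subr_gt0.
pose D (x : R) : R := K / (1 - be) * x `^ (1 - be) - g x.
have dD (x : R) : x \in `]0, w[ -> is_derive x 1 D (K * x `^ (- be) - dg x).
  rewrite in_itv /= => /andP[x0 _].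
  apply: (is_derive_eq (is_deriveB (is_deriveZ (K / (1 - be))
     (is_derive1_powR (1 - be) x0)) (dg_ x))).
  rewrite /GRing.scale /= (_ : 1 - be - 1 = - be); last by ring.
  by field; rewrite gt_eqF.
have cg : continuous g.
  by move=> x; exact: is_derive_continuous (dg_ x).
have cD (x : R) : 0 < x -> {for x, continuous D}.
  move=> x0; apply: cvgB; last exact: cg.
  apply: cvgM; first exact: cvg_cst.
  exact: is_derive_continuous (is_derive1_powR (1 - be) x0).
have cD0 : {within `[0, w], continuous D}.
  apply/continuous_within_itvP => //; split.
  - by move=> x; rewrite in_itv /= => /andP[x0 _]; exact: cD.
  - apply: cvgB; last exact: cvg_at_right_filter (cg 0).
    apply: cvgM; first exact: cvg_cst.
    by rewrite powR0 ?gt_eqF//; exact: powR_cvg0.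
  - apply: cvg_at_left_filter; exact: cD.
have [c] := MVT w0 dD cD0.
rewrite in_itv /= => /andP[c0 cw].
rewrite /D powR0 ?gt_eqF// g0 mulr0 subrr !subr0 => E.
by rewrite -subr_ge0 E mulr_ge0 ?(ltW w0)// subr_ge0 dgK.
Qed.

(* [cos (z x) sin (r x) / (r x)] is the mean of [cos (w x)] over [|w - z| <= r]. *)
Lemma sinc_kernel_pos (om : R -> R) (M N K be z r : R) : 0 < M ->
  {within `[M, N], continuous om} -> 0 < be -> be <= 1 / 2 -> 0 <= K ->
  (forall w, w != 0 ->
    `|\int[leb]_(x in `[M, N]) (cos (w * x) * om x)| <= K * `|w| `^ (- be)) ->
  0 < z -> 0 < r ->
  `|\int[leb]_(x in `[M, N]) (cos (z * x) * (sin (r * x) / (r * x) * om x))| <=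
    12 * K * z `^ (- be).
Proof.
move=> M0 com be0 be2 K0 hK z0 r0.
have xn0 x : x \in `[M, N] -> x != 0.
  by rewrite in_itv /= => /andP[Mx _]; rewrite gt_eqF// (lt_le_trans M0).
have cV : {within `[M, N], continuous (fun x : R => x^-1)}.
  apply: derivable_within_continuous => x /xn0 x0.
  by have h := is_deriveV x0 (is_derive_id x 1); exact: (@ex_derive _ _ _ _ _ _ _ h).
have csin (w : R) : {within `[M, N], continuous (fun x : R => sin (w * x))}.
  apply: continuous_subspaceT => x.
  apply: (@continuous_comp _ _ _ (fun x => w * x) sin); last exact: continuous_sin.
  by apply: cvgM; [exact: cvg_cst|exact: cvg_id].
pose h (x : R) : R := x^-1 * om x.
have ch : {within `[M, N], continuous h}.
  by move=> x; apply: cvgM; [exact: cV|exact: com].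
have ih w : leb.-integrable `[M, N] (EFin \o (fun x => sin (w * x) * h x)).
  by apply: continuous_itv_integrable => x; apply: cvgM; [exact: csin|exact: ch].
have ixh : leb.-integrable `[M, N] (EFin \o (fun x => x * h x)).
  apply: continuous_itv_integrable => x; apply: cvgM; last exact: ch.
  by apply: (continuous_subspaceT (fun x => _)) => y; exact: cvg_id.
(* An odd primitive, in the frequency [w], of the integral without the factor; its increment over
   [z - r, z + r] gives the mean. *)
pose k (w : R) : R := \int[leb]_(x in `[M, N]) (sin (w * x) * h x).
pose dk (w : R) : R := \int[leb]_(x in `[M, N]) (cos (w * x) * (x * h x)).
have dkk (w : R) : is_derive w 1 k (dk w) by exact: is_derive_sin_Rintegral.
have dkE w : dk w = \int[leb]_(x in `[M, N]) (cos (w * x) * om x).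
  by apply: eq_Rintegral => x /set_mem /xn0 x0; rewrite /h mulVKf.
have dkK w : w != 0 -> `|dk w| <= K * `|w| `^ (- be) by rewrite dkE; exact: hK.
have k0 : k 0 = 0.
  rewrite /k (_ : (fun x => _) = (fun=> 0)) ?Rintegral_cst ?mul0r//.
  by apply/funext => x; rewrite mul0r sin0 mul0r.
have kN w : k (- w) = - k w.
  by rewrite /k -RintegralN_itv//; apply: eq_Rintegral => x _; rewrite mulNr sinN mulNr.
have kb w : 0 <= w -> `|k w| <= 2 * K * w `^ (1 - be).
  move=> w0.
  have be1 : be < 1 by lra.
  have le2 : K / (1 - be) * w `^ (1 - be) <= 2 * K * w `^ (1 - be).
    rewrite ler_wpM2r ?powR_ge0// mulrC ler_wpM2r//.
    by rewrite -(invrK (2 : R)) lef_pV2 ?posrE; lra.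
  rewrite ler_norml; apply/andP; split.
    rewrite lerNl; apply: le_trans le2.
    apply: (@le_primitive_powR (fun w => - k w) (fun w => - dk w)) => //.
    - by rewrite k0 oppr0.
    - move=> x x0; rewrite -[X in _ * X `^ _](gtr0_norm x0).
      by apply: le_trans (dkK _ _); [rewrite -normrN ler_norm|rewrite gt_eqF].
  apply: le_trans le2.
  apply: (@le_primitive_powR k dk) => //.
  move=> x x0; rewrite -[X in _ * X `^ _](gtr0_norm x0).
  by apply: le_trans (dkK _ _); [rewrite ler_norm|rewrite gt_eqF].
have kb' w : `|w| <= 3 * r -> `|k w| <= 2 * K * (3 * r) `^ (1 - be).
  move=> w3; have -> : `|k w| = `|k `|w| |.
    by have [_|_] := ger0P w; rewrite ?kN ?normrN.
  apply: le_trans (kb _ (normr_ge0 _)) _.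
  rewrite ler_wpM2l ?mulr_ge0// ge0_ler_powR ?nnegrE//; lra.
have -> : \int[leb]_(x in `[M, N]) (cos (z * x) * (sin (r * x) / (r * x) * om x)) =
    (k (z + r) - k (z - r)) / (2 * r).
  rewrite /k -RintegralB// mulrC -RintegralZl//; last first.
    apply: (continuous_itv_integrable (u := fun x => _)) => x; apply: cvgB;
      (apply: cvgM; [exact: csin|exact: ch]).
  apply: eq_Rintegral => x /set_mem /xn0 x0.
  rewrite /h (mulrDl z r) (mulrBl x z r) sinD sinB.
  by field; rewrite x0 gt_eqF.
have z2 : (z / 2) `^ (- be) <= 2 * z `^ (- be).
  rewrite powRM ?invr_ge0 ?(ltW z0)// mulrC ler_wpM2r ?powR_ge0//.
  rewrite -(powR_inv1 (_ : 0 <= 2 :> R))// -powRrM mulrNN mul1r.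
  by rewrite -[leRHS]powRr1// ler_powR//; lra.
(* For r <= z / 2 the whole range of frequencies has size [z], and the mean is the derivative at one
   of them. For larger [r] the cancellation between the two ends is given up: |k| is at most 2 K (3
   r)^(1 - be) at both, and dividing by 2 r yields the constant 12. *)
have [rz|zr] := leP r (z / 2).
  have zr : z - r < z + r by lra.
  have ck : {within `[z - r, z + r], continuous k}.
    apply: continuous_subspaceT => x.
    exact: is_derive_continuous (dkk x).
  have [c] := MVT zr (fun x _ => dkk x) ck.
  rewrite in_itv /= => /andP[c1 c2] ->.
  rewrite (_ : _ / _ = dk c); last by field; rewrite gt_eqF.
  have c0 : 0 < c by lra.
  apply: le_trans (dkK _ _) _; first by rewrite gt_eqF.
  rewrite (gtr0_norm c0).
  have : c `^ (- be) <= (z / 2) `^ (- be).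
    rewrite !powRN lef_pV2 ?posrE ?powR_gt0//; last lra.
    by rewrite ge0_ler_powR ?nnegrE; lra.
  have := powR_ge0 z (- be).
  move: (c `^ _) (z `^ _) ((z / 2) `^ _) z2 => C Z Z2 *; nra.
rewrite normrM normfV (gtr0_norm (_ : 0 < 2 * r)) ?mulr_gt0//.
rewrite ler_pdivrMr ?mulr_gt0//.
have h1 := kb' (z + r); have h2 := kb' (z - r).
apply: le_trans (ler_normB _ _) _.
have {}h1 : `|k (z + r)| <= 2 * K * (3 * r) `^ (1 - be).
  by apply: h1; rewrite gtr0_norm; lra.
have {}h2 : `|k (z - r)| <= 2 * K * (3 * r) `^ (1 - be).
  by apply: h2; rewrite ler_norml; apply/andP; split; lra.
have h3 : (3 * r) `^ (1 - be) <= 3 * (r * (2 * z `^ (- be))).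
  rewrite powRM ?(ltW r0)// ler_pM ?powR_ge0//.
    by rewrite -[leRHS]powRr1// ler_powR//; lra.
  rewrite gt0_powRD// powRr1 ?(ltW r0)// ler_wpM2l ?(ltW r0)//.
  apply: le_trans z2; rewrite !powRN lef_pV2 ?posrE ?powR_gt0//; last lra.
  by rewrite ge0_ler_powR ?nnegrE; lra.
move: h3; move: (z `^ _) ((3 * r) `^ _) h1 h2 => Z T h1 h2 h3.
have : K * T <= K * (3 * (r * (2 * Z))) by rewrite ler_wpM2l.
lra.
Qed.

Lemma sinc_kernel (om : R -> R) (M N K be z r : R) : 0 < M ->
  {within `[M, N], continuous om} -> 0 < be -> be <= 1 / 2 -> 0 <= K ->
  (forall w, w != 0 ->
    `|\int[leb]_(x in `[M, N]) (cos (w * x) * om x)| <= K * `|w| `^ (- be)) ->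
  z != 0 -> 0 < r ->
  `|\int[leb]_(x in `[M, N]) (cos (z * x) * (sin (r * x) / (r * x) * om x))| <=
    12 * K * `|z| `^ (- be).
Proof.
move=> M0 com be0 be2 K0 hK z0 r0.
have -> : \int[leb]_(x in `[M, N]) (cos (z * x) * (sin (r * x) / (r * x) * om x)) =
  \int[leb]_(x in `[M, N]) (cos (`|z| * x) * (sin (r * x) / (r * x) * om x)).
  apply: eq_Rintegral => x _; congr (_ * _).
  by have [_|_] := ger0P z; rewrite ?mulNr ?cosN.
by apply: sinc_kernel_pos => //; rewrite normr_gt0.
Qed.

End Sinc.

(** * The weak-type bound *)

Section TTstar.
Context {R : realType} d (X : measurableType d).
Variable nu : {finite_measure set X -> \bar R}.
Local Notation leb := (@lebesgue_measure R).
Local Notation RT := (measurableTypeR R).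

Lemma le_integrable_bounded (D : set R) (h g : R -> R) : measurable D ->
  leb.-integrable D (EFin \o h) -> measurable_fun D g ->
  (forall x, `|g x| <= 1) -> leb.-integrable D (EFin \o (fun x => g x * h x)).
Proof.
move=> mD ih mg g1; have /integrableP[/measurable_EFinP mh _] := ih.
apply: (le_integrable _ _ _ ih) => //.
  by apply/measurable_EFinP; exact: measurable_funM.
by move=> x _ /=; rewrite lee_fin normrM ler_piMl.
Qed.

Variables (D : set RT) (h : R -> R) (g : X -> R -> R).
Hypothesis mD : measurable D.
Hypothesis ih : leb.-integrable D (EFin \o h).
Hypothesis mg : measurable_fun setT (fun p : X * RT => g p.1 p.2).
Hypothesis g1 : forall x y, `|g x y| <= 1.

Lemma measurable_slice x : measurable_fun D (g x).
Proof.
apply: measurable_funTS.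
exact: (measurableT_comp mg (measurable_pair1 x)).
Qed.

Let f (p : X * RT) : \bar R := (g p.1 p.2 * (h \_ D) p.2)%:E.

Let ihD : leb.-integrable setT (EFin \o (h \_ D)).
Proof. by move: ih; rewrite integrable_mkcond// restrict_EFin. Qed.

Let mhD : measurable_fun setT (h \_ D : RT -> R).
Proof. by have /integrableP[/measurable_EFinP] := ihD. Qed.

Let mf : measurable_fun setT f.
Proof.
apply/measurable_EFinP; apply: measurable_funM => //.
exact: measurableT_comp.
Qed.

(** With |g| <= 1 the double integral is at most the mass of [nu] times the integral of |h|;
    finiteness of [nu] is what licenses Fubini. *)
Let intf : (nu \x leb)%E.-integrable setT f.
Proof.
apply/integrable12ltyP => //.
have Cfin : (\int[leb]_y `|(h \_ D) y|%:E < +oo)%E.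
  by have /integrableP[] := ihD.
apply: (@le_lt_trans _ _ (\int[nu]_(x in setT) (\int[leb]_y `|(h \_ D) y|%:E))%E).
  apply: ge0_le_integral => //.
  - by move=> x _; exact: integral_ge0.
  - apply: (measurable_fun_fubini_tonelli_F (abse \o f)) => //=.
    exact: measurableT_comp.
  - move=> x _; apply: ge0_le_integral => //.
    + apply: measurableT_comp => //.
      exact: (measurableT_comp mf (measurable_pair1 x)).
    + by apply/measurable_EFinP; exact: measurableT_comp.
    + by move=> y _; rewrite /f /= lee_fin normrM ler_piMl.
rewrite integral_cst//= -ge0_fin_numE ?mule_ge0 ?integral_ge0//.
by rewrite fin_numM ?ge0_fin_numE ?integral_ge0// fin_num_fun_lty.
Qed.

Let FE x : fubini_F leb f x = (\int[leb]_(y in D) (g x y * h y)%:E)%E.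
Proof.
rewrite /fubini_F [RHS]integral_mkcond; apply: eq_integral => y _.
by rewrite /f /= !patchE; case: ifPn; rewrite ?mulr0.
Qed.

Let Ffin x : (\int[leb]_(y in D) (g x y * h y)%:E)%E \is a fin_num.
Proof.
apply: integrable_fin_num => //; apply: le_integrable_bounded => //.
exact: measurable_slice.
Qed.

Lemma integrable_Rintegral_slice :
  nu.-integrable setT (EFin \o (fun x => \int[leb]_(y in D) (g x y * h y))).
Proof.
have := integrable_fubini_F intf; congr (_.-integrable _ _).
by apply/funext => x; rewrite FE /= fineK.
Qed.

Let mgy y : measurable_fun setT (g ^~ y).
Proof. exact: (measurableT_comp mg (measurable_pair2 y)). Qed.

Lemma integrable_slice2 y : nu.-integrable setT (EFin \o (g ^~ y)).
Proof.
apply: (@le_integrable _ _ _ nu setT measurableT _ (EFin \o cst 1)) => //.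
- exact/measurable_EFinP.
- by move=> x _; rewrite /= lee_fin normr1.
- exact: finite_measure_integrable_cst.
Qed.

Let GE y : fubini_G nu f y = ((\int[nu]_x g x y) * (h \_ D) y)%:E.
Proof.
rewrite /fubini_G /f /=.
under eq_integral do rewrite mulrC EFinM.
rewrite integralZl//; last exact: integrable_slice2.
by rewrite mulrC EFinM /Rintegral fineK// integrable_fin_num// integrable_slice2.
Qed.

Lemma integrable_Rintegral_slice2 :
  leb.-integrable D (EFin \o (fun y => (\int[nu]_x g x y) * h y)).
Proof.
have mG : measurable_fun setT (EFin \o ((fun y : RT => (\int[nu]_x g x y) * h y) \_ D)).
  have := measurable_fubini_G intf; congr (measurable_fun _ _).
  apply/funext => y; rewrite GE /= !patchE.
  by case: ifPn; rewrite ?mulr0.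
pose C := fine (nu setT).
have iC : leb.-integrable D (EFin \o (fun y => C * h y)).
  exact: (integrableZl mD C ih).
apply: (le_integrable _ _ _ iC) => //.
  by rewrite (measurable_restrictT _ mD) restrict_EFin.
move=> y _; rewrite /= lee_fin !normrM ler_wpM2r//.
apply: le_trans (le_normr_Rintegral _ (integrable_slice2 y)) _ => //.
apply: le_trans (le_Rintegral (f2 := fun=> 1) _ _ _ _) _ => //.
- by apply: integrable_norm; exact: integrable_slice2.
- exact: finite_measure_integrable_cst.
- by rewrite Rintegral_cst// mul1r ler_norm.
Qed.

Lemma Rintegral_Fubini :
  \int[nu]_x (\int[leb]_(y in D) (g x y * h y)) =
  \int[leb]_(y in D) ((\int[nu]_x g x y) * h y).
Proof.
have E := Fubini intf; rewrite /Rintegral; congr fine.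
transitivity (\int[nu]_x fubini_F leb f x)%E.
  by apply: eq_integral => x _; rewrite FE fineK.
rewrite [LHS]E [RHS]integral_mkcond; apply: eq_integral => y _.
rewrite [LHS]GE patchE; case: ifPn => yD; first by rewrite patchE yD.
by rewrite patchE (negbTE yD) mulr0.
Qed.

End TTstar.

Section RealIntegrable.
Context {R : realType} d (T : measurableType d).
Variable mu : {measure set T -> \bar R}.
Variable D : set T.
Hypothesis mD : measurable D.

Lemma integrable_EFinD (f g : T -> R) : mu.-integrable D (EFin \o f) ->
  mu.-integrable D (EFin \o g) -> mu.-integrable D (EFin \o (fun x => f x + g x)).
Proof. by move=> fi gi; exact: (integrableD mD fi gi). Qed.

Lemma integrable_EFinB (f g : T -> R) : mu.-integrable D (EFin \o f) ->
  mu.-integrable D (EFin \o g) -> mu.-integrable D (EFin \o (fun x => f x - g x)).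
Proof. by move=> fi gi; exact: (integrableB mD fi gi). Qed.

Lemma integrable_EFinZl (c : R) (f : T -> R) : mu.-integrable D (EFin \o f) ->
  mu.-integrable D (EFin \o (fun x => c * f x)).
Proof. by move=> fi; exact: (integrableZl mD c fi). Qed.

End RealIntegrable.

Section TTstar_bound.
Context {R : realType} d (X : measurableType d).
Variable nu : {finite_measure set X -> \bar R}.
Local Notation leb := (@lebesgue_measure R).
Local Notation RT := (measurableTypeR R).

(* [eps * nu E <= int_D F Phi] for [Phi y = int gc x y dnu(x)], and by
   Cauchy-Schwarz it remains to bound [int_D Phi^2 w], a double integral of the
   kernel. *)
Lemma TTstar_bound (gc gs : X -> R -> R) (E : set X) (k : X -> X -> \bar R)
    (w F : R -> R) (D : set RT) (C S eps : R) :
  measurable D -> measurable E ->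
  measurable_fun setT (fun p : X * RT => gc p.1 p.2) ->
  measurable_fun setT (fun p : X * RT => gs p.1 p.2) ->
  (forall x y, `|gc x y| <= 1) -> (forall x y, `|gs x y| <= 1) ->
  (forall x y, ~ E x -> gc x y = 0 /\ gs x y = 0) ->
  leb.-integrable D (EFin \o F) -> leb.-integrable D (EFin \o w) ->
  (forall y, D y -> 0 < w y) ->
  leb.-integrable D (EFin \o (fun y => F y ^+ 2 / w y)) ->
  \int[leb]_(y in D) (F y ^+ 2 / w y) <= S ->
  (forall x, E x -> measurable_fun setT (k x)) ->
  (forall x y, (0 <= k x y)%E) ->
  (forall x, E x -> (\int[nu]_y k x y <= C%:E)%E) ->
  (forall x y, E x -> E y ->
    (`|\int[leb]_(z in D) ((gc x z * gc y z + gs x z * gs y z) * w z)|%:E <= k x y)%E) ->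
  0 < eps -> 0 < C ->
  (forall x, E x -> eps <= \int[leb]_(y in D) (gc x y * F y)) ->
  eps ^+ 2 * fine (nu E) <= C * S.
Proof.
move=> mD mE mgc mgs gc1 gs1 g0 iF iw w0 iFw FwS mk k0 kC gk eps0 C0 Pge.
pose V : R := fine (nu E).
have iV : (\int[nu]_x \1_E x = V :> R).
  by rewrite /Rintegral integral_indic// setIT.
have iE1 : nu.-integrable setT (EFin \o (\1_E : X -> R)) by exact: integrable_indic.
pose Pc (x : X) : R := \int[leb]_(y in D) (gc x y * F y).
have h1 : eps * V <= \int[nu]_x Pc x.
  rewrite -iV -RintegralZl//; apply: le_Rintegral => //.
  - exact: integrable_EFinZl.
  - exact: integrable_Rintegral_slice.
  - move=> x _; rewrite indicE; have [xE|xE] := pselect (E x).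
      by rewrite mem_set// mulr1; exact: Pge.
    rewrite memNset// mulr0 /Pc (_ : (fun y => _) = (fun=> 0)) ?Rintegral_cst ?mul0r//.
    by apply/funext => y; rewrite (g0 x y xE).1 mul0r.
rewrite (Rintegral_Fubini nu mD iF mgc gc1) in h1.
pose Phi (g : X -> R -> R) (y : R) : R := \int[nu]_x g x y.
(* The integral of Phi^2 w is opened into a double integral against [nu] by applying Fubini twice,
   each time with one bounded factor and one integrable function. *)
have key (g : X -> R -> R) : measurable_fun setT (fun p : X * RT => g p.1 p.2) ->
    (forall x y, `|g x y| <= 1) ->
  [/\ leb.-integrable D (EFin \o (fun y => Phi g y * (Phi g y * w y))),
     nu.-integrable setT (EFin \o (fun x => \int[nu]_y
        \int[leb]_(z in D) (g y z * (g x z * w z)))),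
     (forall x, nu.-integrable setT (EFin \o (fun y =>
        \int[leb]_(z in D) (g y z * (g x z * w z))))) &
     \int[leb]_(y in D) (Phi g y * (Phi g y * w y)) =
     \int[nu]_x (\int[nu]_y \int[leb]_(z in D) (g y z * (g x z * w z)))].
  move=> mg g1.
  have i1 : leb.-integrable D (EFin \o (fun y => Phi g y * w y)).
    exact: integrable_Rintegral_slice2.
  have i2 x : leb.-integrable D (EFin \o (fun y => g x y * w y)).
    by apply: le_integrable_bounded => //; exact: measurable_slice.
  have E2 x : \int[leb]_(z in D) (g x z * (Phi g z * w z)) =
      \int[nu]_y \int[leb]_(z in D) (g y z * (g x z * w z)).
    rewrite (Rintegral_Fubini nu mD (i2 x) mg g1).
    by apply: eq_Rintegral => z _; rewrite mulrCA.
  split.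
  - exact: integrable_Rintegral_slice2.
  - have := integrable_Rintegral_slice nu mD i1 mg g1.
    by congr (_.-integrable _ _); apply/funext => x /=; rewrite E2.
  - by move=> x; exact: integrable_Rintegral_slice.
  - rewrite -(Rintegral_Fubini nu mD i1 mg g1).
    by apply: eq_Rintegral => x _; exact: E2.
have [ic1 ic2 ic3 Ec] := key gc mgc gc1.
have [is1 is2 is3 Es] := key gs mgs gs1.
(* This is why [gs] accompanies [gc]. For a cosine and a sine of the same phase the products add up
   to the cosine of a difference of phases, which the kernel bound controls; a single product also
   contains the cosine of their sum. *)
have ub : \int[leb]_(y in D) (Phi gc y * (Phi gc y * w y)) +
    \int[leb]_(y in D) (Phi gs y * (Phi gs y * w y)) <= C * V.
  rewrite Ec Es -RintegralD; [|exact: measurableT|exact: ic2|exact: is2].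
  rewrite -iV -RintegralZl//; apply: le_Rintegral => //.
  - exact: (integrable_EFinD measurableT ic2 is2).
  - exact: integrable_EFinZl.
  move=> x _; rewrite -RintegralD; [|exact: measurableT|exact: ic3|exact: is3].
  have iwg (g : X -> R -> R) x' y' : measurable_fun setT (fun p : X * RT => g p.1 p.2) ->
      (forall x y, `|g x y| <= 1) ->
      leb.-integrable D (EFin \o (fun z => g y' z * (g x' z * w z))).
    move=> mg g1; apply: le_integrable_bounded => //; last exact: measurable_slice.
    by apply: le_integrable_bounded => //; exact: measurable_slice.
  have KE y : \int[leb]_(z in D) (gc y z * (gc x z * w z)) +
      \int[leb]_(z in D) (gs y z * (gs x z * w z)) =
      \int[leb]_(z in D) ((gc x z * gc y z + gs x z * gs y z) * w z).
    rewrite -RintegralD//; [|exact: iwg|exact: iwg].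
    by apply: eq_Rintegral => z _; ring.
  under eq_Rintegral => y _ do rewrite KE.
  have z0 x' y' : ~ E x' \/ ~ E y' ->
      \int[leb]_(z in D) ((gc x' z * gc y' z + gs x' z * gs y' z) * w z) = 0.
    move=> h; rewrite (_ : (fun y => _) = (fun=> 0)) ?Rintegral_cst ?mul0r//.
    by apply/funext => z; case: h => /(g0 _ z)[-> ->]; ring.
  rewrite indicE; have [xE|xE] := pselect (E x); last first.
    rewrite memNset// mulr0 (_ : (fun y => _) = (fun=> 0)) ?Rintegral_cst ?mul0r//.
    by apply/funext => y; rewrite z0//; left.
  rewrite mem_set// mulr1.
  pose Kx (y : X) : R :=
    \int[leb]_(z in D) ((gc x z * gc y z + gs x z * gs y z) * w z).
  rewrite -/Kx.
  have iK : nu.-integrable setT (EFin \o Kx).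
    have := integrable_EFinD measurableT (ic3 x) (is3 x).
    by congr (_.-integrable _ _); apply/funext => y /=; rewrite KE.
  have KV : (\int[nu]_y Kx y)%:E = (\int[nu]_y (Kx y)%:E)%E.
    by rewrite /Rintegral fineK//; exact: integrable_fin_num iK.
  rewrite -lee_fin KV; apply: le_trans (kC x xE).
  apply: (@le_trans _ _ (\int[nu]_y (`|Kx y|)%:E)%E).
    apply: le_integral => //; first exact: (integrable_norm iK).
    by move=> y _; rewrite lee_fin ler_norm.
  apply: ge0_le_integral => //.
  - by have /integrableP[] := integrable_norm iK.
  - exact: mk.
  - move=> y _; have [yE|yE] := pselect (E y); first exact: gk.
    by rewrite /Kx z0 ?normr0//; right.
have V0 : 0 <= V by rewrite fine_ge0.
have lam0 : 0 < C / eps by rewrite divr_gt0.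
(* Cauchy-Schwarz as a weighted arithmetic-geometric mean inequality. The weight turns the kernel
   term into eps V / 2, half of the left-hand side, to be absorbed there. The square of [Phi gs] is
   added on the right because the bound concerns the sum of both squares. *)
have h2 : \int[leb]_(y in D) (Phi gc y * F y) <=
    C / eps / 2 * S + eps / C / 2 * (C * V).
  apply: (@le_trans _ _ (\int[leb]_(y in D) (C / eps / 2 * (F y ^+ 2 / w y) +
      eps / C / 2 * (Phi gc y * (Phi gc y * w y) + Phi gs y * (Phi gs y * w y))))).
    apply: le_Rintegral => //.
    - exact: integrable_Rintegral_slice2.
    - apply: integrable_EFinD => //; apply: integrable_EFinZl => //.
      exact: integrable_EFinD.
    move=> y Dy; have wy := w0 y Dy; rewrite -subr_ge0.
    have -> : C / eps / 2 * (F y ^+ 2 / w y) + eps / C / 2 *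
        (Phi gc y * (Phi gc y * w y) + Phi gs y * (Phi gs y * w y)) - Phi gc y * F y =
      C / eps / 2 / w y * (F y - eps / C * (Phi gc y * w y)) ^+ 2 +
      eps / C / 2 * (Phi gs y ^+ 2 * w y).
      by field; rewrite !gt_eqF.
    have a1 : 0 <= C / eps / 2 / w y by rewrite !divr_ge0 ?ltW.
    have a2 : 0 <= eps / C / 2 by rewrite !divr_ge0 ?ltW.
    apply: addr_ge0; first exact: mulr_ge0 a1 (sqr_ge0 _).
    exact: mulr_ge0 a2 (mulr_ge0 (sqr_ge0 _) (ltW wy)).
  rewrite RintegralD//; last 2 first.
  - exact: integrable_EFinZl.
  - by apply: integrable_EFinZl => //; exact: integrable_EFinD.
  rewrite !RintegralZl// ?RintegralD//; last exact: integrable_EFinD.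
  by rewrite lerD// ler_wpM2l// !mulr_ge0 ?invr_ge0 ?(ltW C0) ?(ltW eps0).
have h3 := le_trans h1 h2.
have e1 : eps / C / 2 * (C * V) = eps * V / 2 by field; rewrite gt_eqF.
rewrite e1 in h3.
have h4 : eps * V <= C / eps * S.
  have -> : C / eps * S = 2 * (C / eps / 2 * S) by field; rewrite gt_eqF.
  by move: h3; move: (eps * V) (_ / _ * S) => a b; clear; lra.
have -> : eps ^+ 2 * fine (nu E) = eps * (eps * V) by rewrite /V; ring.
have -> : C * S = eps * (C / eps * S) by field; rewrite gt_eqF.
by rewrite ler_wpM2l// ltW.
Qed.

End TTstar_bound.

(** * Riesz potentials of alpha-dimensional measures *)

Section Energy.
Context {R : realType}.
Local Notation leb := (@lebesgue_measure R).
Local Notation RT := (measurableTypeR R).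

(* A dyadic majorant of [K * |x - y| `^ (- b)] for [|x - y| < 1], infinite at [x = y]. *)
Definition riesz (K b x y : R) : \bar R :=
  (\sum_(0 <= j <oo) (K * (2 ^+ j.+1) `^ b * \1_(ball x (2 ^- j)) y)%:E)%E.

Lemma riesz_term_ge0 (K b x y : R) j : 0 <= K ->
  (0 <= (K * (2 ^+ j.+1) `^ b * \1_(ball x (2 ^- j)) y)%:E)%E.
Proof. by move=> K0; rewrite lee_fin !mulr_ge0 ?powR_ge0// indicE. Qed.

Lemma riesz_ge0 (K b x y : R) : 0 <= K -> (0 <= riesz K b x y)%E.
Proof. by move=> K0; apply: nneseries_ge0 => j _ _; exact: riesz_term_ge0. Qed.

Lemma measurable_riesz (K b x : R) : 0 <= K ->
  measurable_fun setT (riesz K b x : RT -> \bar R).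
Proof.
move=> K0; apply: ge0_emeasurable_sum => [j y _ _|j _].
  exact: riesz_term_ge0.
apply/measurable_EFinP; apply: measurable_funM => //.
by apply: measurable_indic; exact: measurable_ball.
Qed.

(** With 2^(- k - 1) <= |x - y| < 2^(- k), the term of index [k] alone is at least K |x - y|^(- b);
    this is why its coefficient has the exponent [j.+1]. *)
Lemma le_riesz (K b x y : R) : 0 <= K -> 0 < b -> x != y -> `|x - y| < 1 ->
  ((K * `|x - y| `^ (- b))%:E <= riesz K b x y)%E.
Proof.
move=> K0 b0 xy d1; set d := `|x - y|.
have d0 : 0 < d by rewrite normr_gt0 subr_eq0.
have [j dj] : exists j : nat, 2 ^- j <= d.
  have [n _ hn] := near_infty_natSinv_lt (PosNum d0).
  exists n.+1; apply/ltW/(le_lt_trans _ (hn n (leqnn n))).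
  rewrite lef_pV2 ?posrE ?exprn_gt0//.
  by rewrite -natrX ler_nat ltnW// ltn_expl.
have [k [k1 k2]] : exists k : nat, 2 ^- k.+1 <= d /\ d < 2 ^- k.
  elim: j dj => [|j IH] dj; first by move: dj; rewrite expr0 invr1 leNgt d1.
  by have [/IH//|h] := leP (2 ^- j) d; exists j.
apply: le_trans (nneseries_lim_ge k.+1 (fun n _ _ => riesz_term_ge0 b x y n K0)).
rewrite big_nat_recr//= -[leLHS]add0e leeD//.
  by apply: sume_ge0 => i _; exact: riesz_term_ge0.
rewrite lee_fin indicE mem_set// mulr1 ler_wpM2l// powRN.
rewrite -[leRHS]invrK lef_pV2 ?posrE ?powR_gt0 ?invr_gt0 ?powR_gt0 ?exprn_gt0//.
rewrite -powR_inv1 ?powR_ge0// powRAC powR_inv1 ?exprn_ge0//.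
by rewrite ge0_ler_powR ?nnegrE ?invr_ge0 ?exprn_ge0 ?(ltW b0) ?(ltW d0).
Qed.

Lemma geometric_partial_le (a q : R) n : 0 <= a -> 0 <= q -> q < 1 ->
  \sum_(0 <= i < n) a * q ^+ i <= a / (1 - q).
Proof.
move=> a0 q0 q1.
have -> : \sum_(0 <= i < n) a * q ^+ i = a / (1 - q) * (1 - q ^+ n).
  elim: n => [|n IH]; first by rewrite big_geq// expr0 subrr mulr0.
  rewrite big_nat_recr//= IH exprS; field.
  by rewrite subr_eq0 eq_sym lt_eqF.
rewrite ler_piMr ?divr_ge0 ?subr_ge0 ?(ltW q1)//.
by rewrite lerBlDr lerDl exprn_ge0.
Qed.

(** A ball of radius 2^(- j) has mass at most c 2^(- j al) and carries a coefficient of order 2^(j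
    b), so the terms are geometric of ratio 2^(b - al) < 1. [C] is fixed before [nu], so it serves
    every restriction of the given measure. *)
Lemma riesz_energy (c al b K : R) : 0 < b -> b < al -> 0 <= K ->
  exists2 C : R, 0 < C & forall nu : {measure set RT -> \bar R},
    (forall x r : R, 0 < r -> (nu (ball x r) <= (c * r `^ al)%:E)%E) ->
    forall x : R, (\int[nu]_y riesz K b x y <= C%:E)%E.
Proof.
move=> b0 bal K0; pose q : R := 2 `^ (b - al).
have q0 : 0 < q by rewrite powR_gt0.
have q1 : q < 1.
  rewrite /q -opprB powRN invf_lt1 ?powR_gt0//.
  have ba : 0 < al - b by rewrite subr_gt0.
  have := @gt0_ltr_powR R _ ba 1 2; rewrite powR1; apply; rewrite ?nnegrE//.
  by rewrite ltr1n.
pose a : R := K * 2 `^ b * `|c|.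
have a0 : 0 <= a by rewrite !mulr_ge0 ?powR_ge0.
exists (1 + a / (1 - q)).
  by rewrite ltr_pwDl// divr_ge0// subr_ge0 ltW.
move=> nu hnu x; rewrite /riesz integral_nneseries//; last 2 first.
- by move=> j; apply/measurable_EFinP; apply: measurable_funM => //;
    apply: measurable_indic; exact: measurable_ball.
- by move=> j y _; exact: riesz_term_ge0.
have termE j : (\int[nu]_y (K * (2 ^+ j.+1) `^ b * \1_(ball x (2 ^- j)) y)%:E =
    (K * (2 ^+ j.+1) `^ b)%:E * nu (ball x (2 ^- j)))%E.
  under eq_integral do rewrite EFinM.
  rewrite ge0_integralZl//; last 2 first.
  - by apply/measurable_EFinP; apply: measurable_indic; exact: measurable_ball.
  - by rewrite lee_fin mulr_ge0 ?powR_ge0.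
  - by rewrite integral_indic ?setIT//; exact: measurable_ball.
apply: (@le_trans _ _ (\sum_(0 <= j <oo) (a * q ^+ j)%:E)%E).
  apply: lee_nneseries => [j _ _|j _].
    by apply: integral_ge0 => y _; exact: riesz_term_ge0.
  rewrite termE; apply: (@le_trans _ _ ((K * (2 ^+ j.+1) `^ b)%:E *
      (c * (2 ^- j) `^ al)%:E)%E).
    by rewrite lee_wpmul2l ?lee_fin ?mulr_ge0 ?powR_ge0// hnu// invr_gt0 exprn_gt0.
  rewrite -EFinM lee_fin.
  have -> : a * q ^+ j = K * (2 ^+ j.+1) `^ b * (`|c| * (2 ^- j) `^ al).
    have e1 : (2 ^+ j.+1 : R) `^ b = 2 `^ b * 2 `^ (b * j%:R).
      by rewrite -powR_mulrn// -powRrM -gt0_powRD// -natr1; congr powR; ring.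
    have e2 : (2 ^- j : R) `^ al = 2 `^ (- (al * j%:R)).
      by rewrite -powR_invn// -powRrM; congr powR; ring.
    have e3 : q ^+ j = 2 `^ (b * j%:R) * 2 `^ (- (al * j%:R)).
      by rewrite -powR_mulrn ?ltW// /q -powRrM -gt0_powRD//; congr powR; ring.
    by rewrite e1 e2 e3 /a; ring.
  by rewrite ler_wpM2l ?mulr_ge0 ?powR_ge0// ler_wpM2r ?powR_ge0// ler_norm.
apply: lime_le.
  by apply: is_cvg_nneseries => j _ _; rewrite lee_fin mulr_ge0// exprn_ge0// ltW.
apply: nearW => n; rewrite sumEFin lee_fin.
apply: le_trans (geometric_partial_le n a0 (ltW q0) q1) _.
by rewrite lerDr.
Qed.

End Energy.

(** * Linearized maximal functions *)

Section WeakType.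
Context {R : realType}.
Local Notation leb := (@lebesgue_measure R).
Local Notation RT := (measurableTypeR R).

(** Every term of the series is at least [K] at the centre. As the majorant is infinite on the
    diagonal, it dominates whatever value the kernel takes there, and oscillation is estimated for
    distinct points. *)
Lemma riesz_diag (K b x r : R) : 0 < K -> 0 <= b -> (r%:E <= riesz K b x x)%E.
Proof.
move=> K0 b0; pose n := Num.truncn (`|r| / K).
have nr : r <= K * n.+1%:R.
  rewrite (le_trans (ler_norm r))// mulrC -ler_pdivrMr// ltW//.
  by apply: truncnS_gt.
apply: le_trans (nneseries_lim_ge n.+1 (fun i _ _ => riesz_term_ge0 b x x i (ltW K0))).
rewrite sumEFin lee_fin (le_trans nr)//.
have -> : K * n.+1%:R = \sum_(0 <= i < n.+1) K.
  by rewrite sumr_const_nat subn0 mulr_natr.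
apply: ler_sum => i _; rewrite indicE mem_set ?mulr1; last first.
  by apply: ballxx; rewrite invr_gt0 exprn_gt0.
by rewrite ler_peMr ?(ltW K0)// powR_ge1// exprn_ege1// ler1n.
Qed.

(** Moves the upper limit of integration into the integrand, so that integrals with different upper
    limits, selected at different points, live on one interval. *)
Definition trunc (p : R) (g : R -> R -> R) (x z : R) : R := (z < p)%R%:R * g x z.

(* [select g A n x] is [g k x] for the last [k < n] with [A k x], and 0 if there
   is none: it linearizes the maximum over [k]. *)
Fixpoint select (g : nat -> R -> R -> R) (A : nat -> set R) n (x z : R) : R :=
  if n is n'.+1 then \1_(A n') x * g n' x z + (1 - \1_(A n') x) * select g A n' x z
  else 0.

(** One index serves every [g]: the cosine and the sine families are linearized by the same choice,
    so their products recombine into the kernel. *)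
Lemma select_case (A : nat -> set R) n x : (\big[setU/set0]_(k < n) A k) x ->
  exists2 k, (k < n)%N & A k x /\ forall g, select g A n x = g k x.
Proof.
elim: n => [|n IH]; first by rewrite big_ord0.
rewrite big_ord_recr /= => h.
have [Anx|Anx] := pselect (A n x).
  exists n => //; split => // g; apply/funext => z /=.
  by rewrite indicE mem_set// subrr mul0r addr0 mul1r.
case: h => // /IH[k kn [Akx sk]]; exists k; first exact: ltnW.
split => // g; apply/funext => z /=.
by rewrite sk indicE memNset// subr0 mul0r add0r mul1r.
Qed.

Lemma select_out g (A : nat -> set R) n x z : ~ (\big[setU/set0]_(k < n) A k) x ->
  select g A n x z = 0.
Proof.
elim: n => [//|n IH]; rewrite big_ord_recr /= => /not_orP[h Anx].
by rewrite IH// indicE memNset// mul0r mulr0 addr0.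
Qed.

Lemma select_le1 g (A : nat -> set R) n x z : (forall k x z, `|g k x z| <= 1) ->
  `|select g A n x z| <= 1.
Proof.
move=> g1; elim: n => [|n IH] /=; first by rewrite normr0.
rewrite indicE; case: (_ \in _); first by rewrite subrr mul0r addr0 mul1r.
by rewrite subr0 mul0r add0r mul1r.
Qed.

Lemma measurable_select g (A : nat -> set RT) n : (forall k, measurable (A k)) ->
  (forall k, measurable_fun setT (fun p : RT * RT => g k p.1 p.2)) ->
  measurable_fun setT (fun p : RT * RT => select g A n p.1 p.2).
Proof.
move=> mA mg; elim: n => [|n IH] /=; first exact: measurable_cst.
have mi : measurable_fun setT (fun p : RT * RT => \1_(A n) p.1 : R).
  by apply: measurableT_comp => //; exact: measurable_indic.
by apply: measurable_funD; apply: measurable_funM => //; exact: measurable_funB.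
Qed.

Lemma measurable_trunc (p : R) (g : R -> R -> R) :
  measurable_fun setT (fun q : RT * RT => g q.1 q.2) ->
  measurable_fun setT (fun q : RT * RT => trunc p g q.1 q.2).
Proof.
move=> mg; apply: measurable_funM => //.
have -> : (fun q : RT * RT => (q.2 < p)%R%:R : R) =
    (fun q : RT * RT => \1_(`]-oo, p[%classic : set RT) q.2).
  apply/funext => q; rewrite indicE; congr (_%:R).
  by rewrite mem_setE in_itv.
by apply: measurableT_comp => //; exact: measurable_indic.
Qed.

Lemma trunc_le1 (p : R) (g : R -> R -> R) x z : `|g x z| <= 1 -> `|trunc p g x z| <= 1.
Proof.
by move=> g1; rewrite /trunc; case: (z < p); rewrite ?mul1r// mul0r normr0.
Qed.

Lemma Rintegral_trunc (u : R -> R) (M p N : R) : M <= p -> p <= N ->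
  leb.-integrable `[M, p] (EFin \o u) ->
  \int[leb]_(z in `[M, N]) ((z < p)%R%:R * u z) = \int[leb]_(z in `[M, p]) u z.
Proof.
move=> Mp pN iu.
transitivity (\int[leb]_(z in `[M, N]) ((u \_ `]-oo, p[) z)).
  apply: eq_Rintegral => z _; rewrite patchE.
  have -> : (z \in `]-oo, p[%classic) = (z < p) by rewrite mem_setE in_itv.
  by case: (z < p); rewrite ?mul1r ?mul0r.
rewrite -Rintegral_mkcondr.
have -> : `[M, N] `&` `]-oo, p[ = `[M, p[%classic.
  apply/seteqP; split => z /=; rewrite !in_itv /=.
    by move=> [/andP[-> _] ->].
  by move=> /andP[-> zp]; split => //; rewrite (ltW (lt_le_trans zp pN)).
apply: Rintegral_itv_bndo_bndc.
by apply: integrableS iu => //; apply: subset_itvl; rewrite bnd_simp.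
Qed.

Lemma integrable_powR (M N r : R) : 0 < M ->
  leb.-integrable `[M, N] (EFin \o (fun z => z `^ r)).
Proof.
move=> M0; apply: continuous_itv_integrable; apply: derivable_within_continuous => x.
rewrite in_itv /= => /andP[Mx _]; have h := is_derive1_powR r (lt_le_trans M0 Mx).
exact: (@ex_derive _ _ _ _ _ _ _ h).
Qed.

Variables (nu : {finite_measure set RT -> \bar R}) (B : set RT).
Variables (gc gs : nat -> R -> R -> R) (N : nat -> R) (M sg : R) (F : R -> R).
Variables (K b C S eps : R).
Hypothesis mB : measurable B.
Hypothesis M1 : 1 <= M.
Hypothesis MN : forall k, M <= N k.
Hypothesis mgc : forall k, measurable_fun setT (fun p : RT * RT => gc k p.1 p.2).
Hypothesis mgs : forall k, measurable_fun setT (fun p : RT * RT => gs k p.1 p.2).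
Hypothesis gc1 : forall k x z, `|gc k x z| <= 1.
Hypothesis gs1 : forall k x z, `|gs k x z| <= 1.
Hypothesis iF : forall q, leb.-integrable `[M, q] (EFin \o F).
Hypothesis iFw : forall q, leb.-integrable `[M, q] (EFin \o (fun z => F z ^+ 2 * z `^ sg)).
Hypothesis FwS : forall q, \int[leb]_(z in `[M, q]) (F z ^+ 2 * z `^ sg) <= S.
Hypothesis kerK : forall k l q x y, B x -> B y -> x != y -> M <= q ->
  `|\int[leb]_(z in `[M, q]) ((gc k x z * gc l y z + gs k x z * gs l y z) * z `^ (- sg))|
  <= K * `|x - y| `^ (- b).
Hypothesis Bd : forall x y, B x -> B y -> `|x - y| < 1.
Hypothesis K0 : 0 < K.
Hypothesis b0 : 0 < b.
Hypothesis C0 : 0 < C.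
Hypothesis eps0 : 0 < eps.
Hypothesis enC : forall x, (\int[nu]_y riesz K b x y <= C%:E)%E.

Definition level_set k : set RT :=
  B `&` [set x | eps <= \int[leb]_(z in `[M, N k]) (gc k x z * F z)].

Lemma measurable_level_set k : measurable (level_set k).
Proof.
have := integrable_Rintegral_slice nu (measurable_itv `[M, N k]) (iF (N k)) (mgc k) (gc1 k).
move=> /integrableP[/measurable_EFinP mV _].
apply: measurableI => //.
rewrite -[X in measurable X]setTI.
have -> : [set x : R | eps <= \int[leb]_(z in `[M, N k]) (gc k x z * F z)] =
   (fun x => \int[leb]_(z in `[M, N k]) (gc k x z * F z)) @^-1` `[eps, +oo[.
  by apply/seteqP; split => x /=; rewrite in_itv /= andbT.
exact: mV.
Qed.

(** Finitely many indices at a time, because TT* runs on one bounded interval [M, q] that contains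
    all intervals of integration. The bound is independent of [n], so it passes to the union over
    all indices. *)
Lemma weak_type n :
  eps ^+ 2 * fine (nu (\big[setU/set0]_(k < n) level_set k)) <= C * S.
Proof.
have [q Mq Nq] : exists2 q, M <= q & forall k, (k < n)%N -> N k <= q.
  elim: n => [|n [q Mq Nq]]; first by exists M.
  exists (Num.max q (N n)) => [|k]; first by rewrite le_max Mq.
  rewrite ltnS leq_eqVlt => /predU1P[->|/Nq kq]; rewrite le_max ?lexx ?orbT// kq//.
have M0 : 0 < M by rewrite (lt_le_trans ltr01).
pose tc k := trunc (N k) (gc k); pose ts k := trunc (N k) (gs k).
have tc1 k x z : `|tc k x z| <= 1 by exact: trunc_le1.
have ts1 k x z : `|ts k x z| <= 1 by exact: trunc_le1.
have mtc k : measurable_fun setT (fun p : RT * RT => tc k p.1 p.2) by exact: measurable_trunc.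
have mts k : measurable_fun setT (fun p : RT * RT => ts k p.1 p.2) by exact: measurable_trunc.
have mA := measurable_level_set.
have wE z : `[M, q]%classic z -> F z ^+ 2 / z `^ (- sg) = F z ^+ 2 * z `^ sg.
  by rewrite powRN invrK.
apply: (@TTstar_bound R _ RT nu (select tc level_set n) (select ts level_set n) _
   (fun x y => riesz K b x y) (fun z => z `^ (- sg)) F `[M, q] C S eps) => //.
- by apply: bigsetU_measurable => i _; exact: mA.
- exact: measurable_select.
- exact: measurable_select.
- by move=> x z; exact: select_le1.
- by move=> x z; exact: select_le1.
- by move=> x y h; split; exact: select_out.
- exact: integrable_powR.
- by move=> z /=; rewrite in_itv /= => /andP[Mz _]; rewrite powR_gt0// (lt_le_trans M0).
- have := iFw q; congr (_.-integrable _ _); apply/funext => z /=.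
  by rewrite powRN invrK.
- by under eq_Rintegral => z _ do rewrite powRN invrK; exact: FwS.
- by move=> x _; exact: (measurable_riesz _ _ (ltW K0)).
- by move=> x y; exact: riesz_ge0 (ltW K0).
- move=> x y /select_case[k kn [[Bx _] sk]] /select_case[l ln [[By _] sl]].
  (* The product of truncations at [N k] and [N l] is the truncation at the smaller one, which
     brings the kernel into the form bounded by [kerK]. *)
  have -> : \int[leb]_(z in `[M, q]) ((select tc level_set n x z * select tc level_set n y z +
      select ts level_set n x z * select ts level_set n y z) * z `^ (- sg)) =
    \int[leb]_(z in `[M, q]) ((z < Num.min (N k) (N l))%R%:R *
      ((gc k x z * gc l y z + gs k x z * gs l y z) * z `^ (- sg))).
    apply: eq_Rintegral => z _; rewrite !sk !sl /tc /ts /trunc lt_min.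
    by case: (z < N k) => /=; case: (z < N l) => /=; ring.
  have iK : leb.-integrable `[M, Num.min (N k) (N l)]
      (EFin \o (fun z => (gc k x z * gc l y z + gs k x z * gs l y z) * z `^ (- sg))).
    have ig (g : nat -> R -> R -> R) :
        (forall k, measurable_fun setT (fun p : RT * RT => g k p.1 p.2)) ->
        (forall (k : nat) (x z : R), `|g k x z| <= 1) ->
        leb.-integrable `[M, Num.min (N k) (N l)]
        (EFin \o (fun z => g k x z * (g l y z * z `^ (- sg)))).
      move=> mg g1; apply: le_integrable_bounded => //; last exact: measurable_slice.
      apply: le_integrable_bounded => //; last exact: measurable_slice.
      exact: integrable_powR.
    have := @integrable_EFinD _ _ _ leb _ (measurable_itv _) _ _
      (ig gc mgc gc1) (ig gs mgs gs1).
    by congr (_.-integrable _ _); apply/funext => z /=; congr EFin; ring.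
  rewrite Rintegral_trunc//; last 2 first.
  - by rewrite le_min !MN.
  - by rewrite ge_min (Nq k kn).
  have [->|xy] := eqVneq x y; first exact: riesz_diag (ltW b0).
  apply: le_trans (le_riesz (ltW K0) b0 xy (Bd Bx By)).
  by rewrite lee_fin kerK// le_min !MN.
- move=> x /select_case[k kn [[Bx ex] sk]].
  rewrite sk; move: ex => /= /le_trans; apply.
  rewrite (_ : \int[leb]_(y in `[M, q]) (tc k x y * F y) =
    \int[leb]_(y in `[M, q]) ((y < N k)%R%:R * (gc k x y * F y))); last first.
    by apply: eq_Rintegral => z _; rewrite mulrA.
  rewrite Rintegral_trunc ?Nq//.
  apply: le_integrable_bounded => //; exact: measurable_slice.
Qed.

End WeakType.

(** * From the weak-type bound to almost every point *)

Section AeTail.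
Context {R : realType}.
Local Notation leb := (@lebesgue_measure R).
Local Notation RT := (measurableTypeR R).

Lemma Rintegral_itv_mono (G : R -> R) (a b a' b' : R) : (forall x, 0 <= G x) ->
  a' <= a -> b <= b' -> leb.-integrable `[a', b'] (EFin \o G) ->
  \int[leb]_(x in `[a, b]) G x <= \int[leb]_(x in `[a', b']) G x.
Proof.
move=> G0 aa bb iG.
have sub : `[a, b]%classic `<=` `[a', b']%classic.
  by apply: subset_itv; rewrite bnd_simp.
have iG' : leb.-integrable `[a, b] (EFin \o G) by exact: integrableS iG.
rewrite -lee_fin /Rintegral !fineK ?integrable_fin_num//.
apply: ge0_subset_integral => //; first by have /integrableP[] := iG.
by move=> x _; rewrite lee_fin.
Qed.

(** The integrals over [1, n + 1] have a finite supremum; a value within [d] of it leaves at most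
    [d] for everything beyond. *)
Lemma Rintegral_tail_small (G : R -> R) (S : R) : (forall x, 0 <= G x) ->
  (forall q, leb.-integrable `[1, q] (EFin \o G)) ->
  (forall q, \int[leb]_(x in `[1, q]) G x <= S) ->
  forall d, 0 < d -> exists M : nat, forall q, \int[leb]_(x in `[M.+1%:R, q]) G x <= d.
Proof.
move=> G0 iG GS d d0.
pose a (n : nat) : R := \int[leb]_(x in `[1, n.+1%:R]) G x.
have ha : has_sup (range a).
  split; first by exists (a 0%N), 0%N.
  by exists S => _ [n _ <-]; exact: GS.
have [_ [M _ <-] hM] := sup_adherent d0 ha; exists M => q.
have [qM|Mq] := ltP q M.+1%:R.
  by rewrite set_itv_ge ?Rintegral_set0 ?(ltW d0)// bnd_simp -ltNge.
pose n := Num.truncn q.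
have qn : q <= n.+1%:R by exact/ltW/truncnS_gt.
have an : a n <= sup (range a) by apply: ub_le_sup; [case: ha|exists n].
have : \int[leb]_(x in `[1, q]) G x <= a n by exact: Rintegral_itv_mono.
have M1 : 1 <= M.+1%:R :> R by rewrite ler1n.
by rewrite (Rintegral_itv_split (iG q) M1 Mq) -/(a M); lra.
Qed.

Variables (mu : {measure set RT -> \bar R}) (c al sg b K : R) (F : R -> R).
Variables (gc gs : nat -> nat -> R -> R -> R) (N : nat -> nat -> R).
Hypothesis hmu : forall x r : R, 0 < r -> (mu (ball x r) <= (c * r `^ al)%:E)%E.
Hypothesis b0 : 0 < b.
Hypothesis bal : b < al.
Hypothesis K0 : 0 < K.
Hypothesis MN : forall M k, M.+1%:R <= N M k.
Hypothesis mgc : forall M k, measurable_fun setT (fun p : RT * RT => gc M k p.1 p.2).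
Hypothesis mgs : forall M k, measurable_fun setT (fun p : RT * RT => gs M k p.1 p.2).
Hypothesis gc1 : forall M k x z, `|gc M k x z| <= 1.
Hypothesis gs1 : forall M k x z, `|gs M k x z| <= 1.
Hypothesis iF : forall q, leb.-integrable `[1, q] (EFin \o F).
Hypothesis iFw : forall q, leb.-integrable `[1, q] (EFin \o (fun z => F z ^+ 2 * z `^ sg)).
Variable S : R.
Hypothesis FwS : forall q, \int[leb]_(z in `[1, q]) (F z ^+ 2 * z `^ sg) <= S.
Hypothesis kerK : forall M k l q x y, x != y -> `|x - y| < 1 -> M.+1%:R <= q ->
  `|\int[leb]_(z in `[M.+1%:R, q])
     ((gc M k x z * gc M l y z + gs M k x z * gs M l y z) * z `^ (- sg))|
  <= K * `|x - y| `^ (- b).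

Let bad (x0 eps : R) (M : nat) : set RT :=
  \bigcup_k level_set (ball x0 (1 / 2)) (gc M) (N M) M.+1%:R F eps k.

(** In the weak-type bound [S] may be the integral of F^2 z^sg beyond [M]. A large [M] makes it, and
    with it the measure of [bad x0 eps M], as small as desired. *)
Lemma bad_null (x0 eps : R) : 0 < eps -> mu.-negligible (\bigcap_M bad x0 eps M).
Proof.
(* Radius 1 / 2 keeps distances inside the ball below 1, where the dyadic majorant is valid; the
   dimension condition makes the restricted measure finite. *)
move=> eps0; set B : set RT := ball x0 (1 / 2).
have mB : measurable B by exact: measurable_ball.
have moo : (mu B < +oo)%E by apply: le_lt_trans (hmu _ _) _; rewrite ?ltry//; lra.
pose nu : {finite_measure set RT -> \bar R} := mfrestr mB moo.
have nuB (x r : R) : 0 < r -> (nu (ball x r) <= (c * r `^ al)%:E)%E.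
  move=> r0; apply: le_trans (hmu x r0).
  have mb : measurable (ball x r : set RT) by exact: measurable_ball.
  rewrite /nu /= /mfrestr /mrestr; apply: le_measure; rewrite ?inE//.
  exact: measurableI.
have [C C0 hC] := riesz_energy c b0 bal (ltW K0).
have {}hC := hC nu nuB.
have Bd (x y : RT) : B x -> B y -> `|x - y| < 1.
  rewrite /B /ball /= => h1 h2.
  have -> : x - y = (x0 - y) - (x0 - x) by ring.
  by apply: le_lt_trans (ler_normB _ _) _; lra.
have G0 z : 0 <= F z ^+ 2 * z `^ sg by rewrite mulr_ge0 ?sqr_ge0 ?powR_ge0.
have iF' M q : leb.-integrable `[M.+1%:R, q] (EFin \o F).
  by apply: integrableS (iF q) => //; apply: subset_itvr; rewrite bnd_simp ler1n.
have iFw' M q : leb.-integrable `[M.+1%:R, q] (EFin \o (fun z => F z ^+ 2 * z `^ sg)).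
  by apply: integrableS (iFw q) => //; apply: subset_itvr; rewrite bnd_simp ler1n.
have mA M k : measurable (level_set B (gc M) (N M) M.+1%:R F eps k).
  exact: (measurable_level_set nu).
have mbad M : measurable (bad x0 eps M) by apply: bigcupT_measurable => k; exact: mA.
have mcap : measurable (\bigcap_M bad x0 eps M) by exact: bigcapT_measurable.
apply/negligibleP => //.
have capB : \bigcap_M bad x0 eps M `<=` B.
  by move=> x /(_ 0%N I)[k _ []].
transitivity (nu (\bigcap_M bad x0 eps M)).
  by rewrite /nu /= /mfrestr /mrestr setIidl.
have nufin A : measurable A -> nu A \is a fin_num by move=> mA'; exact: fin_num_measure.
suff : fine (nu (\bigcap_M bad x0 eps M)) <= 0.
  move=> h; have h0 : fine (nu (\bigcap_M bad x0 eps M)) = 0.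
    by apply/eqP; rewrite eq_le h fine_ge0.
  by rewrite -[LHS]fineK ?nufin// h0.
apply/ler_addgt0Pr => d d0; rewrite add0r.
(* The tail for which the weak-type bound reads eps^2 nu(E) <= eps^2 d. *)
have d'0 : 0 < d * eps ^+ 2 / C by rewrite divr_gt0// mulr_gt0// exprn_gt0.
have [M hM] := Rintegral_tail_small G0 iFw FwS d'0.
have M1 : 1 <= M.+1%:R :> R by rewrite ler1n.
have wt := @weak_type R nu B (gc M) (gs M) (N M) M.+1%:R sg F K b C
  (d * eps ^+ 2 / C) eps mB M1 (MN M) (mgc M) (mgs M)
  (gc1 M) (gs1 M) (iF' M) (iFw' M) hM.
have {}wt := wt (fun k l q x y Bx By xy => kerK k l xy (Bd x y Bx By)) Bd K0 b0 C0 eps0 hC.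
have le_d : (nu (bad x0 eps M) <= d%:E)%E.
  (* Continuity from below carries the bound from finite unions to the union over all [k]. *)
  pose E n := \big[setU/set0]_(k < n.+1) level_set B (gc M) (N M) M.+1%:R F eps k.
  have mE n : measurable (E n) by apply: bigsetU_measurable => k _; exact: mA.
  have EU : \bigcup_n E n = bad x0 eps M by rewrite bigcup_bigsetU_bigcup.
  have ndE : nondecreasing_seq E.
    by move=> i j ij; apply/subsetPset; apply: subset_bigsetU; rewrite ltnS.
  have cE := @nondecreasing_cvg_mu _ _ _ nu E mE (bigcupT_measurable _ mE) ndE.
  rewrite -EU -(cvg_lim _ cE)//; apply: lime_le; first by apply/cvg_ex; eexists; exact: cE.
  apply: nearW => n /=; rewrite -[leLHS]fineK ?nufin// lee_fin.
  have := wt n.+1; rewrite -/(E n) mulrCA divff ?gt_eqF// mulr1 mulrC.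
  by rewrite ler_pM2r// exprn_gt0.
rewrite -lee_fin fineK ?nufin//; apply: le_trans le_d.
by apply: le_measure; rewrite ?inE//; exact: bigcap_inf.
Qed.

Theorem ae_tail : {ae mu, forall x : R, forall eps, 0 < eps -> exists M, forall k,
  \int[leb]_(z in `[M.+1%:R, N M k]) (gc M k x z * F z) < eps}.
Proof.
(* Balls of radius 1 / 2 about the rationals cover the line and the thresholds 1 / (i + 1) reach
   below every [eps], so the exceptional set lies in a countable union of null sets. *)
pose x_ (j : nat) : R := if unpickle j is Some q then ratr q else 0.
apply: (@negligibleS _ _ _ _ (\bigcup_j \bigcup_i \bigcap_M bad (x_ j) i.+1%:R^-1 M)).
  move=> x /= /existsNP[eps /not_implyP[eps0 hx]].
  have [q hq] : exists q : rat, ball (ratr q : R) (1 / 2) x.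
    have : x - 1 / 2 < x + 1 / 2 by lra.
    move=> /rat_in_itvoo[q]; rewrite in_itv /= => /andP[q1 q2]; exists q.
    by rewrite /ball /= ltr_norml; apply/andP; split; lra.
  exists (pickle q) => //.
  have [n _ hn] := near_infty_natSinv_lt (PosNum eps0).
  exists n => // M _; have /forallNP/(_ M)/existsNP[k /negP] := hx.
  rewrite -leNgt => hk; exists k => //; split.
    by rewrite /x_ pickleK.
  by apply: le_trans hk; apply/ltW/(hn n (leqnn n)).
apply: negligible_bigcup => j; apply: negligible_bigcup => i.
by apply: bad_null; rewrite invr_gt0 ltr0n.
Qed.

End AeTail.

Section AeTailNorm.
Context {R : realType}.
Local Notation leb := (@lebesgue_measure R).
Local Notation RT := (measurableTypeR R).

Theorem ae_tail_norm (mu : {measure set RT -> \bar R})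
    (c al sg b K S : R) (F : R -> R) (gc gs : nat -> nat -> R -> R -> R) (N : nat -> nat -> R) :
  (forall x r : R, 0 < r -> (mu (ball x r) <= (c * r `^ al)%:E)%E) ->
  0 < b -> b < al -> 0 < K -> (forall M k, M.+1%:R <= N M k) ->
  (forall M k, measurable_fun setT (fun p : RT * RT => gc M k p.1 p.2)) ->
  (forall M k, measurable_fun setT (fun p : RT * RT => gs M k p.1 p.2)) ->
  (forall M k x z, `|gc M k x z| <= 1) -> (forall M k x z, `|gs M k x z| <= 1) ->
  (forall q, leb.-integrable `[1, q] (EFin \o F)) ->
  (forall q, leb.-integrable `[1, q] (EFin \o (fun z => F z ^+ 2 * z `^ sg))) ->
  (forall q, \int[leb]_(z in `[1, q]) (F z ^+ 2 * z `^ sg) <= S) ->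
  (forall M k l q x y, x != y -> `|x - y| < 1 -> M.+1%:R <= q ->
  `|\int[leb]_(z in `[M.+1%:R, q])
     ((gc M k x z * gc M l y z + gs M k x z * gs M l y z) * z `^ (- sg))|
  <= K * `|x - y| `^ (- b)) ->
  {ae mu, forall x : R, forall eps, 0 < eps -> exists M, forall k,
    `|\int[leb]_(z in `[M.+1%:R, N M k]) (gc M k x z * F z)| < eps}.
Proof.
move=> hmu b0 bal K0 MN mgc mgs gc1 gs1 iF iFw FwS ker.
(* Each parameter is listed twice: [k./2] is the parameter and the parity of [k] a sign, so the
   one-sided [ae_tail] yields both sides. In the kernel the two signs leave a factor of absolute
   value 1. *)
pose sgn (g : nat -> nat -> R -> R -> R) M k x z : R := (-1) ^+ odd k * g M k./2 x z.
have sgn1 (k : nat) (y : R) : `|(-1) ^+ odd k * y| = `|y|.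
  by rewrite normrM normrX normrN1 expr1n mul1r.
have msgn g : (forall M k, measurable_fun setT (fun p : RT * RT => g M k p.1 p.2)) ->
    forall M k, measurable_fun setT (fun p : RT * RT => sgn g M k p.1 p.2).
  by move=> mg M k; exact: measurable_funM.
have sgc1 M k x z : `|sgn gc M k x z| <= 1 by rewrite sgn1.
have sgs1 M k x z : `|sgn gs M k x z| <= 1 by rewrite sgn1.
have mx (g : nat -> nat -> R -> R -> R) (M k : nat) (x : R) (D : set (RT)) :
    (forall M k, measurable_fun setT
      (fun p : RT * RT => g M k p.1 p.2)) ->
    measurable_fun D (g M k x).
  move=> mg; apply: (@measurable_slice R _ (RT) _ (g M k) _ x); exact: mg.
have sker M k l q x y : x != y -> `|x - y| < 1 -> M.+1%:R <= q ->
  `|\int[leb]_(z in `[M.+1%:R, q])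
     ((sgn gc M k x z * sgn gc M l y z + sgn gs M k x z * sgn gs M l y z) * z `^ (- sg))|
  <= K * `|x - y| `^ (- b).
  move=> xy d1 Mq; apply: le_trans (ker M k./2 l./2 q x y xy d1 Mq).
  have M0 : 0 < M.+1%:R :> R by rewrite ltr0n.
  (* The factor 1 / 2 brings the sum of two products below 1 in absolute value, as
     [le_integrable_bounded] requires. *)
  pose u z : R := 2^-1 * (gc M k./2 x z * gc M l./2 y z + gs M k./2 x z * gs M l./2 y z).
  have iu : leb.-integrable `[M.+1%:R, q] (EFin \o (fun z => u z * (2 * z `^ (- sg)))).
    apply: le_integrable_bounded => //.
    - apply: (@integrable_EFinZl _ _ _ leb _ (measurable_itv _) 2).
      exact: integrable_powR.
    - by apply: measurable_funM => //; apply: measurable_funD; apply: measurable_funM; exact: mx.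
    - move=> z; rewrite /u normrM ger0_norm ?invr_ge0// ler_pdivrMl// mulr1.
      apply: le_trans (ler_normD _ _) _; rewrite !normrM.
      by apply: lerD; rewrite mulr_ile1.
  have uE z : u z * (2 * z `^ (- sg)) =
    (gc M k./2 x z * gc M l./2 y z + gs M k./2 x z * gs M l./2 y z) * z `^ (- sg).
    by rewrite /u; field.
  have sE z : (sgn gc M k x z * sgn gc M l y z + sgn gs M k x z * sgn gs M l y z) * z `^ (- sg) =
    (-1) ^+ (odd k (+) odd l) * (u z * (2 * z `^ (- sg))).
    by rewrite uE /sgn signr_addb; ring.
  under eq_Rintegral do rewrite sE.
  rewrite RintegralZl// normrM normrX normrN1 expr1n mul1r.
  by under eq_Rintegral do rewrite uE.
have H := @ae_tail R mu c al sg b K F (sgn gc) (sgn gs) (fun M k => N M k./2) hmu b0 bal K0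
  (fun M k => MN M _) (msgn _ mgc) (msgn _ mgs) sgc1 sgs1 iF iFw S FwS sker.
apply: (negligibleS _ H) => x.
apply: contra_not => hx eps eps0; have [M hM] := hx eps eps0; exists M => k.
have := hM k.*2; have := hM k.*2.+1.
have S1 z : sgn gc M k.*2.+1 x z * F z = - (gc M k x z * F z).
  by rewrite /sgn /= odd_double /= uphalf_double expr1 mulN1r mulNr.
have S0 z : sgn gc M k.*2 x z * F z = gc M k x z * F z.
  by rewrite /sgn odd_double doubleK expr0 mul1r.
under eq_Rintegral do rewrite S1.
under [X in _ -> X < _ -> _]eq_Rintegral do rewrite S0.
rewrite /= uphalf_double doubleK RintegralN_itv; last first.
  apply: le_integrable_bounded => //; last exact: mx.
  apply: integrableS (iF (N M k)) => //; apply: subset_itvr.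
  by rewrite bnd_simp ler1n.
by move=> h1 h2; rewrite ltr_norml h2 andbT ltrNl.
Qed.

End AeTailNorm.

(** * Kernels of the curve and of the averages *)

Section Families.
Context {R : realType}.
Local Notation leb := (@lebesgue_measure R).
Local Notation RT := (measurableTypeR R).

Lemma ler_dist_cos (x y : R) : `|cos x - cos y| <= `|x - y|.
Proof.
wlog xy : x y / x <= y.
  move=> h; have [xy|/ltW yx] := leP x y; first exact: h.
  by rewrite distrC (distrC x) h.
have cc : {within `[x, y], continuous (@cos R)}.
  by apply: continuous_subspaceT; exact: continuous_cos.
have [c _ E] := MVT_segment xy (fun z _ => is_derive_cos z) cc.
rewrite distrC E (distrC x) normrM ler_piMl// normrN.
exact: norm_sin_le1.
Qed.

Lemma ler_dist_sin (x y : R) : `|sin x - sin y| <= `|x - y|.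
Proof.
rewrite -!cosBpihalf; apply: le_trans (ler_dist_cos _ _) _.
by have -> : x - pi / 2 - (y - pi / 2) = x - y by ring.
Qed.

Lemma ler_norm_sin (x : R) : `|sin x| <= `|x|.
Proof. by have := ler_dist_sin x 0; rewrite sin0 !subr0. Qed.

Lemma sinc_le1 (x : R) : `|sin x / x| <= 1.
Proof.
(* Division by 0 gives 0, so the quotient is 0 at this point instead of its limit 1. *)
have [->|x0] := eqVneq x 0; first by rewrite invr0 mulr0 normr0.
by rewrite normrM normfV ler_pdivrMr ?normr_gt0// mul1r ler_norm_sin.
Qed.

Lemma measurable_cosT d (T : measurableType d) (f : T -> R) :
  measurable_fun setT f -> measurable_fun setT (fun x => cos (f x)).
Proof.
move=> mf; apply: (measurableT_comp _ mf).
by apply: continuous_measurable_fun; exact: continuous_cos.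
Qed.

Lemma measurable_sinT d (T : measurableType d) (f : T -> R) :
  measurable_fun setT f -> measurable_fun setT (fun x => sin (f x)).
Proof.
move=> mf; apply: (measurableT_comp _ mf).
by apply: continuous_measurable_fun; exact: continuous_sin.
Qed.

Lemma Rintegral_dist (D : set RT) (F g h : R -> R) (L : R) : measurable D ->
  leb.-integrable D (EFin \o F) ->
  measurable_fun D g -> measurable_fun D h ->
  (forall z, `|g z| <= 1) -> (forall z, `|h z| <= 1) ->
  (forall z, D z -> `|g z - h z| <= L) ->
  `|\int[leb]_(z in D) (g z * F z) - \int[leb]_(z in D) (h z * F z)| <=
  L * \int[leb]_(z in D) `|F z|.
Proof.
move=> mD iF mg mh g1 h1 gh.
have ig := le_integrable_bounded mD iF mg g1.
have ih := le_integrable_bounded mD iF mh h1.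
have inF := integrable_norm iF.
rewrite -RintegralB// -RintegralZl//.
have iB := @integrable_EFinB _ _ _ leb _ mD _ _ ig ih.
apply: le_trans (le_normr_Rintegral _ iB) _ => //.
apply: le_Rintegral => //.
- exact: (integrable_norm iB).
- exact: (@integrable_EFinZl _ _ _ leb _ mD _ _ inF).
- by move=> z Dz; rewrite -mulrBl normrM ler_wpM2r// gh.
Qed.

Lemma Rintegral_upper_continuous (u : R -> R) (N : R) :
  (forall q, leb.-integrable `[0, q] (EFin \o u)) -> 0 < N ->
  {for N, continuous (fun x : R => \int[leb]_(z in `[0, x]) u z)}.
Proof.
move=> iu N0; have N1 : 0 < N + 1 by lra.
have := parameterized_integral_continuous (ltW N1) (iu (N + 1)).
move=> /(continuous_within_itvP _ N1)[cu _ _].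
by apply: cu; rewrite in_itv /= N0 ltrDl ltr01.
Qed.

(** The integral is continuous in its upper limit, so an excess at [N] persists at a nearby rational
    distance from [a]. The absolute value makes every rational an admissible distance. *)
Lemma le_of_rat_upper (u : R -> R) (a e : R) : 0 < a ->
  (forall q, leb.-integrable `[0, q] (EFin \o u)) ->
  (forall q : rat, \int[leb]_(z in `[a, a + `|ratr q|]) u z <= e) ->
  forall N, a <= N -> \int[leb]_(z in `[a, N]) u z <= e.
Proof.
move=> a0 iu hq N aN; rewrite leNgt; apply/negP => h.
have N0 : 0 < N by rewrite (lt_le_trans a0).
have E (x : R) : a <= x -> \int[leb]_(z in `[a, x]) u z =
    \int[leb]_(z in `[0, x]) u z - \int[leb]_(z in `[0, a]) u z.
  by move=> ax; rewrite (Rintegral_itv_split (iu x) (ltW a0) ax); ring.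
have cN := Rintegral_upper_continuous iu N0.
have d0 : 0 < \int[leb]_(z in `[a, N]) u z - e by rewrite subr_gt0.
have /cvgrPdist_lt/(_ _ d0)[r /= r0 hr] := cN.
have : N - a < N - a + r by lra.
move=> /rat_in_itvoo[q]; rewrite in_itv /= => /andP[q1 q2].
have q0 : 0 <= ratr q :> R by lra.
have := hq q; rewrite (ger0_norm q0) E; last by lra.
have : ball_ Num.norm N r (a + ratr q).
  by rewrite /= ltr_norml; apply/andP; split; lra.
move=> /hr; rewrite (E N aN) ltr_norml => /andP[_]; lra.
Qed.

Section CurveKernel.
Variables (m kappa s be : R) (gamma : R -> R -> R) (C1 C2 : R).
Hypothesis m1 : 1 < m.
Hypothesis kappa0 : 0 < kappa.
Hypothesis s0 : 0 < s.
Hypothesis eta0 : 0 < 2 * s + be - 1.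
Hypothesis be0 : 0 < be.
Hypothesis be2 : be <= 1 / 2.
Hypothesis C10 : 0 < C1.
Hypothesis C20 : 0 < C2.
Hypothesis gammat : forall x t t', t \in `[-1, 1] -> t' \in `[-1, 1] ->
  `|gamma x t - gamma x t'| <= C1 * `|t - t'| `^ kappa.
Hypothesis gammax : forall t x x', t \in `[-1, 1] ->
  C2^-1 * `|x - x'| <= `|gamma x t - gamma x' t| <= C2 * `|x - x'|.

Definition curve_cst : R := ker_cst m (2 * s) be *
  ((2 * C2) `^ be + (2 * C1 * C2) `^ (be / (kappa * m))) + 1.

(** The two exponents come from the linear part and from the power part of the phase. For |x - y| <
    1 the larger one gives the larger bound and covers both. *)
Definition curve_exp : R := Num.max be (be / (kappa * m)).

Lemma ker_cst_ge0 : 0 <= ker_cst m (2 * s) be.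
Proof.
rewrite mulr_ge0//; first by rewrite addr_ge0// mulr_ge0// osc_cst_ge0.
by rewrite addr_ge0// divr_ge0// ltW// mulr_gt0.
Qed.

Lemma curve_cst_gt0 : 0 < curve_cst.
Proof.
by rewrite ltr_wpDl// mulr_ge0 ?ker_cst_ge0// addr_ge0// powR_ge0.
Qed.

(* Either [|x - y|] dominates [|t - t'| `^ kappa], and the linear part of the
   phase is large, or [|t - t'|] is at least of order [|x - y| `^ kappa^-1], and
   the part in [z `^ m] is. *)
Lemma curve_kernel (sg : bool) (t t' x y M N : R) : t \in `[-1, 1] -> t' \in `[-1, 1] ->
  x != y -> `|x - y| < 1 -> 1 <= M -> M <= N ->
  `|\int[leb]_(z in `[M, N]) (cos ((-1) ^+ sg * (gamma x t - gamma y t') * z +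
      (t - t') * z `^ m + 0) * z `^ (- (2 * s)))| <=
  curve_cst * `|x - y| `^ (- curve_exp).
Proof.
move=> t1 t'1 xy d1 M1 MN; set d := `|x - y| in d1 *.
have d0 : 0 < d by rewrite normr_gt0 subr_eq0.
have m0 : 0 < m := lt_trans ltr01 m1.
have km0 : 0 < kappa * m by rewrite mulr_gt0.
have s20 : 0 < 2 * s by rewrite mulr_gt0.
have hb Y := @kernel_bound R m (2 * s) be ((-1) ^+ sg * (gamma x t - gamma y t')) (t - t') 0 M N Y
  m1 M1 MN s20 eta0 (ltW be0) be2.
have dexp r : r <= curve_exp -> d `^ (- r) <= d `^ (- curve_exp).
  by move=> h; rewrite ger_powR ?d0 ?(ltW d1)// lerN2.
have K0 := ker_cst_ge0.
have P1 : 0 <= (2 * C2) `^ be by exact: powR_ge0.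
have P2 : 0 <= (2 * C1 * C2) `^ (be / (kappa * m)) by exact: powR_ge0.
have dp r : 0 <= d `^ r by exact: powR_ge0.
have nE : `|(-1) ^+ sg * (gamma x t - gamma y t')| = `|gamma x t - gamma y t'|.
  by rewrite normrM normrX normrN1 expr1n mul1r.
have [h|h] := leP (C1 * `|t - t'| `^ kappa) (d / (2 * C2)).
  (* The lower Lipschitz bound d / C2 loses at most half to the motion in time, so |gamma x t -
     gamma y t'| is at least d / (2 C2), the inverse of this [Y]. *)
  have Y0 : 0 < 2 * C2 / d by rewrite divr_gt0// mulr_gt0.
  apply: le_trans (hb _ Y0 _) _.
    left; rewrite nE mulrAC ler_pdivlMr// mul1r.
    have /andP[g1 _] := gammax x y t1.
    have g2 := gammat y t1 t'1.
    have g3 : `|gamma x t - gamma y t| <= `|gamma x t - gamma y t'| + `|gamma y t - gamma y t'|.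
      have -> : gamma x t - gamma y t = (gamma x t - gamma y t') - (gamma y t - gamma y t') by ring.
      exact: ler_normB.
    have -> : d = 2 * C2 * (d / C2 - d / (2 * C2)) by field; rewrite gt_eqF.
    rewrite ler_wpM2l ?mulr_ge0 ?(ltW C20)//.
    by move: g1; rewrite -/d mulrC; lra.
  rewrite powRM ?mulr_ge0 ?(ltW C20) ?invr_ge0 ?(ltW d0)//.
  have -> : d^-1 `^ be = d `^ (- be).
    by rewrite -(powR_inv1 (ltW d0)) -powRrM mulN1r.
  apply: (@le_trans _ _ (ker_cst m (2 * s) be * (2 * C2) `^ be * d `^ (- curve_exp))).
    rewrite mulrA; apply: ler_wpM2l; first exact: mulr_ge0.
    by apply: dexp; rewrite le_max lexx.
  rewrite ler_wpM2r// /curve_cst mulrDr -addrA lerDl addr_ge0// mulr_ge0//.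
(* [Y] solves Y^m (d / (2 C1 C2))^(1 / kappa) = 1, where the base is a lower bound for |t -
   t'|^kappa. *)
pose Y : R := (d / (2 * C1 * C2)) `^ (- (kappa * m)^-1).
have dC0 : 0 < d / (2 * C1 * C2) by rewrite divr_gt0// !mulr_gt0.
have Y0 : 0 < Y by rewrite powR_gt0.
apply: le_trans (hb _ Y0 _) _.
  right; rewrite /Y -powRrM.
  have -> : - (kappa * m)^-1 * m = - kappa^-1 by field; rewrite !gt_eqF.
  rewrite powRN mulrC ler_pdivlMr ?powR_gt0// mul1r.
  have h' : d / (2 * C1 * C2) <= `|t - t'| `^ kappa.
    have -> : d / (2 * C1 * C2) = d / (2 * C2) / C1 by field; rewrite !gt_eqF.
    by rewrite ler_pdivrMr// [leRHS]mulrC; exact: ltW.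
  apply: (@le_trans _ _ ((`|t - t'| `^ kappa) `^ kappa^-1)).
    by rewrite ge0_ler_powR ?nnegrE ?invr_ge0 ?powR_ge0 ?(ltW kappa0) ?(ltW dC0).
  by rewrite -powRrM mulfV ?gt_eqF// powRr1.
have -> : Y `^ be = (2 * C1 * C2) `^ (be / (kappa * m)) * d `^ (- (be / (kappa * m))).
  have C12 : 0 < 2 * C1 * C2 by rewrite !mulr_gt0.
  have iC12 : 0 <= (2 * C1 * C2)^-1 by rewrite invr_ge0 ltW.
  rewrite /Y -powRrM (_ : _ * be = - (be / (kappa * m))); last first.
    by rewrite mulNr mulrC.
  rewrite (powRM _ (ltW d0) iC12) [RHS]mulrC; congr (_ * _).
  by rewrite -(powR_inv1 (ltW C12)) -powRrM mulrNN mul1r.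
apply: (@le_trans _ _ (ker_cst m (2 * s) be * (2 * C1 * C2) `^ (be / (kappa * m)) *
    d `^ (- curve_exp))).
  rewrite mulrA; apply: ler_wpM2l; first exact: mulr_ge0.
  by apply: dexp; rewrite le_max lexx orbT.
rewrite ler_wpM2r// /curve_cst mulrDr -addrA addrCA lerDl addr_ge0// mulr_ge0//.
Qed.

(** The estimate [sinc_kernel] is applied once for each radius, whence 12 * 12 = 144; the summand 1
    makes the constant positive. *)
Lemma average_kernel (r r' x y M N : R) : 0 < r -> 0 < r' ->
  x != y -> 1 <= M -> M <= N ->
  `|\int[leb]_(z in `[M, N]) (cos ((x - y) * z) *
      (sin (r * z) / (r * z) * (sin (r' * z) / (r' * z) * z `^ (- (2 * s)))))| <=
  (144 * ker_cst m (2 * s) be + 1) * `|x - y| `^ (- be).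
Proof.
move=> r0 r'0 xy M1 MN; have M0 : 0 < M by lra.
have s20 : 0 < 2 * s by rewrite mulr_gt0.
have cp : {within `[M, N], continuous (fun z : R => z `^ (- (2 * s)))}.
  apply: derivable_within_continuous => z; rewrite in_itv /= => /andP[Mz _].
  have h := is_derive1_powR (- (2 * s)) (lt_le_trans M0 Mz).
  exact: (@ex_derive _ _ _ _ _ _ _ h).
have cs : {within `[M, N], continuous (fun z : R => sin (r' * z) / (r' * z))}.
  apply: derivable_within_continuous => z; rewrite in_itv /= => /andP[Mz _].
  have z0 := lt_le_trans M0 Mz.
  have h1 : is_derive z 1 (fun z : R => r' * z) r'.
    by apply: (is_derive_eq (is_deriveZ r' (is_derive_id z 1))); rewrite /GRing.scale /= mulr1.
  have h2 := is_derive1_comp (is_derive_sin (r' * z)) h1.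
  have rz : r' * z != 0 by rewrite mulf_neq0// gt_eqF.
  have h := is_deriveM h2 (is_deriveV rz h1).
  exact: (@ex_derive _ _ _ _ _ _ _ h).
have K0 := ker_cst_ge0.
have hb (w : R) : w != 0 ->
  `|\int[leb]_(z in `[M, N]) (cos (w * z) * z `^ (- (2 * s)))| <=
    ker_cst m (2 * s) be * `|w| `^ (- be).
  move=> w0; have w1 : 0 < `|w|^-1 by rewrite invr_gt0 normr_gt0.
  have -> : `|w| `^ (- be) = `|w|^-1 `^ be.
    by rewrite -(powR_inv1 (normr_ge0 w)) -powRrM mulN1r.
  have := @kernel_bound R m (2 * s) be w 0 0 M N _ m1 M1 MN s20 eta0 (ltW be0) be2 w1.
  under eq_Rintegral => z _ do rewrite mul0r !addr0.
  by apply; left; rewrite mulVf// normr_eq0.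
have h12 : 0 <= 12 * ker_cst m (2 * s) be by rewrite mulr_ge0.
have h1 (w : R) : w != 0 ->
    `|\int[leb]_(z in `[M, N]) (cos (w * z) *
      (sin (r' * z) / (r' * z) * z `^ (- (2 * s))))| <=
    12 * ker_cst m (2 * s) be * `|w| `^ (- be).
  by move=> w0; apply: sinc_kernel.
have xy0 : x - y != 0 by rewrite subr_eq0.
have c2 : {within `[M, N], continuous (fun z : R => sin (r' * z) / (r' * z) * z `^ (- (2 * s)))}.
  by move=> z; apply: cvgM; [exact: cs|exact: cp].
apply: le_trans (sinc_kernel M0 c2 be0 be2 h12 h1 xy0 r0) _.
rewrite ler_wpM2r ?powR_ge0//.
have -> : 12 * (12 * ker_cst m (2 * s) be) = 144 * ker_cst m (2 * s) be by ring.
by rewrite lerDl.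
Qed.

End CurveKernel.

End Families.

Lemma measurable_invr (R : realType) : measurable_fun setT (@GRing.inv R).
Proof.
have -> : @GRing.inv R = (fun x => x * (x ^+ 2) `^ (-1)).
  apply/funext => x; rewrite powR_inv1 ?sqr_ge0//.
  have [->|x0] := eqVneq x 0; first by rewrite invr0 mul0r.
  by field.
apply: measurable_funM => //.
exact: (measurableT_comp (measurable_powR _) (exprn_measurable 2)).
Qed.

Lemma measurable_sinc (R : realType) (r : R) :
  measurable_fun setT (fun z : measurableTypeR R => sin (r * z) / (r * z)).
Proof.
apply: measurable_funM; first by apply: measurable_sinT; exact: measurable_funM.
by apply: (measurableT_comp (@measurable_invr R)); exact: measurable_funM.
Qed.

Lemma average_arith (R : realDomainType) (r y vr vy i eps : R) :
  r * vr - y * vy <= - (r - y) * i -> (y - r) * (i + eps + 1) < r * (vr - eps) ->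
  y * vy < y * eps -> 0 < y - r -> False.
Proof. by move=> h1 h2 h3 h4; lra. Qed.

(** * Tails at almost every point, uniformly in all parameters *)

Section AeFamilies.
Context {R : realType}.
Local Notation leb := (@lebesgue_measure R).
Local Notation RT := (measurableTypeR R).
Variables (mu : {measure set RT -> \bar R}) (c al : R).
Variables (m kappa s be : R) (gamma : R -> R -> R) (C1 C2 : R) (F : R -> R) (S : R).
Hypothesis hmu : forall x r : R, 0 < r -> (mu (ball x r) <= (c * r `^ al)%:E)%E.
Hypothesis m1 : 1 < m.
Hypothesis kappa0 : 0 < kappa.
Hypothesis kappa1 : kappa <= 1.
Hypothesis s0 : 0 < s.
Hypothesis eta0 : 0 < 2 * s + be - 1.
Hypothesis be0 : 0 < be.
Hypothesis be2 : be <= 1 / 2.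
Hypothesis beal : be < al.
Hypothesis bekal : be / (kappa * m) < al.
Hypothesis C10 : 0 < C1.
Hypothesis C20 : 0 < C2.
Hypothesis gammat : forall x t t', t \in `[-1, 1] -> t' \in `[-1, 1] ->
  `|gamma x t - gamma x t'| <= C1 * `|t - t'| `^ kappa.
Hypothesis gammax : forall t x x', t \in `[-1, 1] ->
  C2^-1 * `|x - x'| <= `|gamma x t - gamma x' t| <= C2 * `|x - x'|.
Hypothesis iF : forall q, leb.-integrable `[0, q] (EFin \o F).
Hypothesis iFw : forall q,
  leb.-integrable `[1, q] (EFin \o (fun z => F z ^+ 2 * z `^ (2 * s))).
Hypothesis FwS : forall q, \int[leb]_(z in `[1, q]) (F z ^+ 2 * z `^ (2 * s)) <= S.

(** One rational stands for the time or the radius, the other for the upper limit of integration. *)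
Definition rats (k : nat) : rat * rat := odflt (0, 0) (unpickle k).

Lemma ratsK p : rats (pickle p) = p.
Proof. by rewrite /rats pickleK. Qed.

(** Projection onto [-1, 1], which does not increase the distance to a point of that interval; the
    clipped rationals are therefore dense in it and every index gives an admissible time. *)
Definition clip (p : rat) : R :=
  if ratr p < -1 :> R then -1 else if 1 < ratr p :> R then 1 else ratr p.

Lemma clip_in p : clip p \in `[-1, 1].
Proof.
rewrite in_itv /= /clip; case: ltP => h1; last case: ltP => h2;
  by apply/andP; split; lra.
Qed.

Lemma clip_near (t d : R) : t \in `[-1, 1] -> 0 < d -> exists p, `|t - clip p| < d.
Proof.
rewrite in_itv /= => /andP[t1 t2] d0.
have : t - d < t + d by lra.
move=> /rat_in_itvoo[p]; rewrite in_itv /= => /andP[p1 p2]; exists p.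
rewrite /clip ltr_norml; move: (ratr p : R) p1 p2 => y p1 p2.
by case: (ltP y (-1)) => h1; last case: (ltP 1 y) => h2; apply/andP; split; lra.
Qed.

Lemma continuous_gamma t : t \in `[-1, 1] -> continuous (gamma ^~ t).
Proof.
move=> t1 x; apply/cvgrPdist_lt => e e0; exists (C2^-1 * e) => /=.
  by rewrite mulr_gt0// invr_gt0.
move=> y /= xy; have /andP[_ h] := gammax x y t1.
by apply: le_lt_trans h _; rewrite -ltr_pdivlMl.
Qed.

Lemma measurable_phase (sg : bool) (t ph : R) : t \in `[-1, 1] ->
  measurable_fun setT (fun p : RT * RT =>
    (-1) ^+ sg * gamma p.1 t * p.2 + t * p.2 `^ m + ph).
Proof.
move=> t1.
have mg : measurable_fun setT (fun p : RT * RT => gamma p.1 t).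
  apply: (measurableT_comp (f := gamma ^~ t)) => //.
  by apply: continuous_measurable_fun; exact: continuous_gamma.
apply: measurable_funD => //; apply: measurable_funD.
  by apply: measurable_funM => //; exact: measurable_funM.
apply: measurable_funM => //.
exact: (measurableT_comp (measurable_powR m)).
Qed.

(** For frequencies up to [b] the phase changes by at most C1 |t - t'|^kappa b + |t - t'| b^m, and
    the cosine is 1-Lipschitz. *)
Lemma time_modulus (sg : bool) (ph x a b t : R) : 0 <= a -> a <= b -> 0 < b -> t \in `[-1, 1] ->
  forall e, 0 < e -> exists2 d, 0 < d & forall t', t' \in `[-1, 1] -> `|t - t'| < d ->
  `|\int[leb]_(z in `[a, b]) (cos ((-1) ^+ sg * gamma x t * z + t * z `^ m + ph) * F z) -
    \int[leb]_(z in `[a, b]) (cos ((-1) ^+ sg * gamma x t' * z + t' * z `^ m + ph) * F z)|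
  < e.
Proof.
move=> a0 ab b0 t1 e e0.
pose I := \int[leb]_(z in `[a, b]) `|F z|.
have I0 : 0 <= I by apply: Rintegral_ge0 => z _.
pose A : R := (C1 * b + b `^ m) * I.
have L0 : 0 <= C1 * b + b `^ m by rewrite addr_ge0 ?powR_ge0// mulr_ge0 ?ltW.
have A0 : 0 <= A by rewrite mulr_ge0.
have A1 : 0 < A + 1 by rewrite ltr_wpDl.
(* Distances at most 1 give |t - t'| <= |t - t'|^kappa, because kappa <= 1, so one modulus serves
   both parts of the phase. *)
exists (Num.min 1 ((e / (A + 1)) `^ kappa^-1)).
  by rewrite lt_min ltr01 powR_gt0// divr_gt0.
move=> t' t'1; rewrite lt_min => /andP[d1 d2].
pose T : R := `|t - t'| `^ kappa.
have T0 : 0 <= T by rewrite powR_ge0.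
have TT : `|t - t'| <= T.
  rewrite /T; have [->|tt] := eqVneq `|t - t'| 0; first by rewrite powR_ge0.
  by rewrite ger1_powR// lt_neqAle eq_sym tt normr_ge0 ltW.
have Te : T < e / (A + 1).
  have -> : e / (A + 1) = ((e / (A + 1)) `^ kappa^-1) `^ kappa.
    by rewrite -powRrM mulVf ?gt_eqF// powRr1// divr_ge0 ?ltW.
  by rewrite gt0_ltr_powR ?nnegrE ?powR_ge0.
have iFab : leb.-integrable `[a, b] (EFin \o F).
  by apply: integrableS (iF b) => //; apply: subset_itvr; rewrite bnd_simp.
apply: (@le_lt_trans _ _ (T * (C1 * b + b `^ m) * I)).
  apply: Rintegral_dist => //.
  - apply: (@measurable_slice R _ RT _ (fun x z =>
      cos ((-1) ^+ sg * gamma x t * z + t * z `^ m + ph)) _ x).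
    by apply: measurable_cosT; exact: measurable_phase.
  - apply: (@measurable_slice R _ RT _ (fun x z =>
      cos ((-1) ^+ sg * gamma x t' * z + t' * z `^ m + ph)) _ x).
    by apply: measurable_cosT; exact: measurable_phase.
  - by move=> z; rewrite ler_norml cos_geN1 cos_le1.
  - by move=> z; rewrite ler_norml cos_geN1 cos_le1.
  move=> z; rewrite /= in_itv /= => /andP[az zb].
  have z0 : 0 <= z by rewrite (le_trans a0).
  apply: le_trans (ler_dist_cos _ _) _.
  have -> : (-1) ^+ sg * gamma x t * z + t * z `^ m + ph -
      ((-1) ^+ sg * gamma x t' * z + t' * z `^ m + ph) =
    (-1) ^+ sg * (gamma x t - gamma x t') * z + (t - t') * z `^ m by ring.
  apply: le_trans (ler_normD _ _) _.
  rewrite !normrM normrX normrN1 expr1n mul1r (ger0_norm z0) (ger0_norm (powR_ge0 _ _)).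
  rewrite mulrDr lerD//.
    rewrite mulrA ler_pM//; first by rewrite mulrC; exact: gammat.
  rewrite ler_pM ?powR_ge0//.
  by rewrite ge0_ler_powR ?nnegrE ?(ltW b0)// (le_trans ler01 (ltW m1)).
have : T * (A + 1) < e by rewrite -ltr_pdivlMr.
have -> : T * (C1 * b + b `^ m) * I = T * A by rewrite /A; ring.
by rewrite mulrDr mulr1; lra.
Qed.

Lemma max_of_rat (sg : bool) (ph x eps : R) (M : nat) :
  (forall p q : rat, \int[leb]_(z in `[M.+1%:R, M.+1%:R + `|ratr q|])
    (cos ((-1) ^+ sg * gamma x (clip p) * z + clip p * z `^ m + ph) * F z) < eps) ->
  forall N t, M.+1%:R <= N -> t \in `[-1, 1] ->
    \int[leb]_(z in `[M.+1%:R, N])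
      (cos ((-1) ^+ sg * gamma x t * z + t * z `^ m + ph) * F z) <= eps.
Proof.
move=> hM N t MN t1.
have M0 : 0 < M.+1%:R :> R by rewrite ltr0n.
have iu q : leb.-integrable `[0, q] (EFin \o (fun z =>
    cos ((-1) ^+ sg * gamma x t * z + t * z `^ m + ph) * F z)).
  apply: le_integrable_bounded => //.
    apply: (@measurable_slice R _ RT _ (fun x z =>
      cos ((-1) ^+ sg * gamma x t * z + t * z `^ m + ph)) _ x).
    by apply: measurable_cosT; exact: measurable_phase.
  by move=> z; rewrite ler_norml cos_geN1 cos_le1.
apply: (le_of_rat_upper M0 iu) => // q.
rewrite leNgt; apply/negP => h.
set I := (X in eps < X) in h.
have e0 : 0 < I - eps by rewrite subr_gt0.
have [||d d0 hd] := @time_modulus sg ph x M.+1%:R (M.+1%:R + `|ratr q|) t (ltW M0) _ _ t1 _ e0.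
- by rewrite lerDl.
- by rewrite ltr_wpDr.
have [p hp] := clip_near t1 d0.
have := hM p q; have := hd _ (clip_in p) hp.
rewrite -/I ltr_norml => /andP[_] h1 h2.
by lra.
Qed.

(** Multiplied by [r], the integral has the kernel sin (r z) / z, which is 1-Lipschitz in [r]
    uniformly in [z]. An excess at [r] therefore persists at a slightly larger rational radius. *)
Lemma average_of_rat (ph x eps : R) (M : nat) : 0 < eps ->
  (forall p q : rat, 0 < ratr p :> R -> \int[leb]_(z in `[M.+1%:R, M.+1%:R + `|ratr q|])
    (cos (x * z + ph) * (sin (ratr p * z) / (ratr p * z)) * F z) < eps) ->
  forall N r, M.+1%:R <= N -> 0 < r ->
    \int[leb]_(z in `[M.+1%:R, N])
      (cos (x * z + ph) * (sin (r * z) / (r * z)) * F z) <= eps.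
Proof.
move=> eps0 hM N r MN rr.
have msinc := @measurable_sinc R.
have g1 (a b : R) : `|a| <= 1 -> `|b| <= 1 -> `|a * b| <= 1.
  by move=> a1 b1; rewrite normrM mulr_ile1.
have cos1 (y : R) : `|cos y| <= 1 by exact: norm_cos_le1.
have M0 : 0 < M.+1%:R :> R by rewrite ltr0n.
have mgr (r' : R) : measurable_fun setT (fun z : RT => cos (x * z + ph) * (sin (r' * z) / (r' * z))).
  apply: measurable_funM => //; apply: measurable_cosT; exact: measurable_funD.
have gr1 (r' : R) (z : R) : `|cos (x * z + ph) * (sin (r' * z) / (r' * z))| <= 1.
  by apply: g1 => //; exact: sinc_le1.
have icr (r' a' b' : R) : leb.-integrable `[a', b'] (EFin \o F) ->
    leb.-integrable `[a', b'] (EFin \o (fun z =>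
    cos (x * z + ph) * (sin (r' * z) / (r' * z)) * F z)).
  move=> h; apply: (le_integrable_bounded (measurable_itv _) h _ (gr1 r')).
  exact: measurable_funTS (mgr r').
have iu q := icr r _ _ (iF q).
apply: (le_of_rat_upper M0 iu) => // q.
pose a : R := M.+1%:R; pose b : R := M.+1%:R + `|ratr q|.
pose V (r' : R) : R := \int[leb]_(z in `[a, b]) (cos (x * z + ph) * (sin (r' * z) / (r' * z)) * F z).
rewrite -/b -/a -/(V r) leNgt; apply/negP => h.
have iFab : leb.-integrable `[a, b] (EFin \o F).
  by apply: integrableS (iF b) => //; apply: subset_itvr; rewrite bnd_simp /a ler0n.
pose I := \int[leb]_(z in `[a, b]) `|F z|.
have I0 : 0 <= I by apply: Rintegral_ge0 => z _.
have lip r' : 0 < r' -> `|r * V r - r' * V r'| <= `|r - r'| * I.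
  move=> r'0.
  have iV (r'' : R) := icr r'' _ _ iFab.
  rewrite /V -[r * _]RintegralZl// -[r' * _]RintegralZl//.
  have i1 := @integrable_EFinZl _ _ _ leb `[a, b]%classic (measurable_itv _) r _ (iV r).
  have i2 := @integrable_EFinZl _ _ _ leb `[a, b]%classic (measurable_itv _) r' _ (iV r').
  rewrite -RintegralB//.
  have iB := @integrable_EFinB _ _ _ leb `[a, b]%classic (measurable_itv _) _ _ i1 i2.
  apply: le_trans (le_normr_Rintegral _ iB) _ => //.
  have inF := integrable_norm iFab.
  have <- : \int[leb]_(z in `[a, b]) (`|r - r'| * `|F z|) = `|r - r'| * I.
    by rewrite RintegralZl//; exact: inF.
  apply: le_Rintegral => //.
  - exact: (integrable_norm iB).
  - exact: (@integrable_EFinZl _ _ _ leb _ (measurable_itv _) _ _ inF).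
  move=> z; rewrite /= in_itv /= => /andP[az _].
  have z0 : 0 < z by rewrite (lt_le_trans _ az).
  have -> : r * (cos (x * z + ph) * (sin (r * z) / (r * z)) * F z) -
    r' * (cos (x * z + ph) * (sin (r' * z) / (r' * z)) * F z) =
    cos (x * z + ph) * ((sin (r * z) - sin (r' * z)) / z) * F z.
    by field; rewrite !gt_eqF.
  rewrite normrM ler_wpM2r// normrM -[leRHS]mul1r ler_pM//.
  rewrite normrM normfV (gtr0_norm z0) ler_pdivrMr//.
  apply: le_trans (ler_dist_sin _ _) _.
  by rewrite -mulrBl normrM (gtr0_norm z0).
have e0 : 0 < r * (V r - eps) by rewrite mulr_gt0// subr_gt0.
have B0 : 0 < I + eps + 1 by rewrite ltr_wpDl// addr_ge0// ltW.
(* For a radius [y] in ]r, r + d[ the Lipschitz loss (y - r) I and the change (y - r) eps of the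
   threshold together fit into the excess r (V r - eps). *)
pose d := r * (V r - eps) / (I + eps + 1).
have d0 : 0 < d by rewrite divr_gt0.
have : r < r + d by rewrite ltrDl.
move=> /rat_in_itvoo[p]; rewrite in_itv /= => /andP[p1 p2].
have p0 : 0 < ratr p :> R by lra.
have := hM p q p0; rewrite -/a -/b -/(V (ratr p)) => hV.
have h1 := le_trans (ler_norm _) (lip _ p0); rewrite ltr0_norm ?subr_lt0// in h1.
move: (ratr p : R) p0 p1 p2 hV h1 => y y0 y1 y2 hV h1.
have h2 : (y - r) * (I + eps + 1) < r * (V r - eps).
  by rewrite -ltr_pdivlMr// -/d ltrBlDl.
have h3 : y * V y < y * eps by rewrite ltr_pM2l.
have h4 : 0 < y - r by rewrite subr_gt0.
exact: (average_arith h1 h2 h3 h4).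
Qed.

Theorem ae_max (sg : bool) (ph : R) :
  {ae mu, forall x : R, forall eps, 0 < eps -> exists M : nat, forall N t,
    M.+1%:R <= N -> t \in `[-1, 1] ->
    `|\int[leb]_(z in `[M.+1%:R, N])
      (cos ((-1) ^+ sg * gamma x t * z + t * z `^ m + ph) * F z)| <= eps}.
Proof.
pose gc (M k : nat) (x z : R) : R :=
  cos ((-1) ^+ sg * gamma x (clip (rats k).1) * z + clip (rats k).1 * z `^ m + ph).
pose gs (M k : nat) (x z : R) : R :=
  sin ((-1) ^+ sg * gamma x (clip (rats k).1) * z + clip (rats k).1 * z `^ m + ph).
pose N_ (M k : nat) : R := M.+1%:R + `|ratr (rats k).2|.
have ce : curve_exp m kappa be < al by rewrite /curve_exp gt_max beal bekal.
have ce0 : 0 < curve_exp m kappa be by rewrite /curve_exp lt_max be0.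
have K0 : 0 < curve_cst m kappa s be C1 C2 by exact: curve_cst_gt0.
have NM M k : M.+1%:R <= N_ M k by rewrite lerDl.
have mgc M k : measurable_fun setT (fun p : RT * RT => gc M k p.1 p.2).
  by apply: measurable_cosT; apply: measurable_phase; exact: clip_in.
have mgs M k : measurable_fun setT (fun p : RT * RT => gs M k p.1 p.2).
  by apply: measurable_sinT; apply: measurable_phase; exact: clip_in.
have gc1 M k x z : `|gc M k x z| <= 1 by exact: norm_cos_le1.
have gs1 M k x z : `|gs M k x z| <= 1 by exact: norm_sin_le1.
have iF1 q : leb.-integrable `[1, q] (EFin \o F).
  by apply: integrableS (iF q) => //; apply: subset_itvr; rewrite bnd_simp ler01.
have ker M k l q x y : x != y -> `|x - y| < 1 -> M.+1%:R <= q ->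
  `|\int[leb]_(z in `[M.+1%:R, q])
     ((gc M k x z * gc M l y z + gs M k x z * gs M l y z) * z `^ (- (2 * s)))|
  <= curve_cst m kappa s be C1 C2 * `|x - y| `^ (- curve_exp m kappa be).
  move=> xy d1 Mq; have M1 : 1 <= M.+1%:R :> R by rewrite ler1n.
  under eq_Rintegral => z _.
    rewrite /gc /gs -cosB (_ : _ - _ = (-1) ^+ sg * (gamma x (clip (rats k).1) -
      gamma y (clip (rats l).1)) * z +
      (clip (rats k).1 - clip (rats l).1) * z `^ m + 0); last by ring.
    over.
  by apply: curve_kernel => //; exact: clip_in.
have H := ae_tail_norm hmu ce0 ce K0 NM mgc mgs gc1 gs1 iF1 iFw FwS ker.
apply: (negligibleS _ H) => x; apply: contra_not => hx eps eps0.
have [M hM] := hx eps eps0; exists M => N t MN t1.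
have iG (t' q : R) : t' \in `[-1, 1] -> leb.-integrable `[M.+1%:R, q] (EFin \o (fun z =>
    cos ((-1) ^+ sg * gamma x t' * z + t' * z `^ m + ph) * F z)).
  move=> t'1; apply: le_integrable_bounded => //.
  - apply: integrableS (iF q) => //; apply: subset_itvr.
    by rewrite bnd_simp ler0n.
  - apply: (@measurable_slice R _ RT _ (fun x z =>
      cos ((-1) ^+ sg * gamma x t' * z + t' * z `^ m + ph)) _ x).
    by apply: measurable_cosT; exact: measurable_phase.
  - by move=> z; rewrite ler_norml cos_geN1 cos_le1.
have hM' p q : `|\int[leb]_(z in `[M.+1%:R, M.+1%:R + `|ratr q|])
    (cos ((-1) ^+ sg * gamma x (clip p) * z + clip p * z `^ m + ph) * F z)| < eps.
  by have := hM (pickle (p, q)); rewrite /gc /N_ ratsK.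
rewrite ler_norml; apply/andP; split; last first.
  by apply: max_of_rat => // p q; apply: le_lt_trans (ler_norm _) (hM' p q).
rewrite lerNl -RintegralN_itv; last exact: iG.
(* The lower bound is the upper bound for the phase [ph + pi]. *)
have piE t' z : - (cos ((-1) ^+ sg * gamma x t' * z + t' * z `^ m + ph) * F z) =
    cos ((-1) ^+ sg * gamma x t' * z + t' * z `^ m + (ph + pi)) * F z.
  by rewrite addrA cosDpi mulNr.
under eq_Rintegral do rewrite piE.
apply: max_of_rat => // p q; under eq_Rintegral do rewrite -piE.
rewrite RintegralN_itv; last by apply: iG; exact: clip_in.
by rewrite ltrNl; have := hM' p q; rewrite ltr_norml => /andP[].
Qed.

Theorem ae_average (ph : R) :
  {ae mu, forall x : R, forall eps, 0 < eps -> exists M : nat, forall N r,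
    M.+1%:R <= N -> 0 < r ->
    `|\int[leb]_(z in `[M.+1%:R, N])
      (cos (x * z + ph) * (sin (r * z) / (r * z)) * F z)| <= eps}.
Proof.
(* Radii have to be positive for every index: rationals enter by their absolute values, and 0 is
   replaced by 1. *)
pose r_ (k : nat) : R := if (rats k).1 == 0 then 1 else `|ratr (rats k).1|.
have r0 k : 0 < r_ k.
  by rewrite /r_; case: eqVneq => // h; rewrite normr_gt0 fmorph_eq0.
pose gc (M k : nat) (x z : R) : R := cos (x * z + ph) * (sin (r_ k * z) / (r_ k * z)).
pose gs (M k : nat) (x z : R) : R := sin (x * z + ph) * (sin (r_ k * z) / (r_ k * z)).
pose N_ (M k : nat) : R := M.+1%:R + `|ratr (rats k).2|.
have NM M k : M.+1%:R <= N_ M k by rewrite lerDl.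
have msinc := @measurable_sinc R.
have mxz : measurable_fun setT (fun p : RT * RT => p.1 * p.2 + ph).
  by apply: measurable_funD => //; exact: measurable_funM.
have mgc M k : measurable_fun setT (fun p : RT * RT => gc M k p.1 p.2).
  apply: measurable_funM; first exact: measurable_cosT.
  exact: (measurableT_comp (msinc (r_ k))).
have mgs M k : measurable_fun setT (fun p : RT * RT => gs M k p.1 p.2).
  apply: measurable_funM; first exact: measurable_sinT.
  exact: (measurableT_comp (msinc (r_ k))).
have g1 (a b : R) : `|a| <= 1 -> `|b| <= 1 -> `|a * b| <= 1.
  by move=> a1 b1; rewrite normrM mulr_ile1.
have cos1 (y : R) : `|cos y| <= 1 by exact: norm_cos_le1.
have sin1 (y : R) : `|sin y| <= 1 by exact: norm_sin_le1.
have gc1 M k x z : `|gc M k x z| <= 1 by apply: g1 => //; exact: sinc_le1.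
have gs1 M k x z : `|gs M k x z| <= 1 by apply: g1 => //; exact: sinc_le1.
have iF1 q : leb.-integrable `[1, q] (EFin \o F).
  by apply: integrableS (iF q) => //; apply: subset_itvr; rewrite bnd_simp ler01.
have K0 : 0 < 144 * ker_cst m (2 * s) be + 1.
  by rewrite ltr_wpDl// mulr_ge0//; exact: ker_cst_ge0.
have ker M k l q x y : x != y -> `|x - y| < 1 -> M.+1%:R <= q ->
  `|\int[leb]_(z in `[M.+1%:R, q])
     ((gc M k x z * gc M l y z + gs M k x z * gs M l y z) * z `^ (- (2 * s)))|
  <= (144 * ker_cst m (2 * s) be + 1) * `|x - y| `^ (- be).
  move=> xy d1 Mq; have M1 : 1 <= M.+1%:R :> R by rewrite ler1n.
  under eq_Rintegral => z _.
    rewrite (_ : _ * z `^ _ = cos ((x - y) * z) * (sin (r_ k * z) / (r_ k * z) *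
      (sin (r_ l * z) / (r_ l * z) * z `^ (- (2 * s))))); last first.
      have -> : (x - y) * z = (x * z + ph) - (y * z + ph) by ring.
      by rewrite cosB /gc /gs; ring.
    over.
  exact: average_kernel.
have H := ae_tail_norm hmu be0 beal K0 NM mgc mgs gc1 gs1 iF1 iFw FwS ker.
apply: (negligibleS _ H) => x; apply: contra_not => hx eps eps0.
have [M hM] := hx eps eps0; exists M => N r MN rr.
have iG (r' q : R) : leb.-integrable `[M.+1%:R, q] (EFin \o (fun z =>
    cos (x * z + ph) * (sin (r' * z) / (r' * z)) * F z)).
  apply: le_integrable_bounded => //.
  - apply: integrableS (iF q) => //; apply: subset_itvr.
    by rewrite bnd_simp ler0n.
  - apply: measurable_funTS; apply: measurable_funM; last exact: msinc.
    by apply: measurable_cosT; exact: measurable_funD.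
  - by move=> z; apply: g1 => //; exact: sinc_le1.
have hM' (p q : rat) : 0 < ratr p :> R -> `|\int[leb]_(z in `[M.+1%:R, M.+1%:R + `|ratr q|])
    (cos (x * z + ph) * (sin (ratr p * z) / (ratr p * z)) * F z)| < eps.
  move=> p0; have := hM (pickle (p, q)).
  rewrite /gc /N_ /r_ ratsK /= ifF; last first.
    by apply/negbTE; apply: contraTneq p0 => ->; rewrite raddf0 ltxx.
  by rewrite (gtr0_norm p0).
rewrite ler_norml; apply/andP; split; last first.
  by apply: average_of_rat => // p q p0; apply: le_lt_trans (ler_norm _) (hM' p q p0).
rewrite lerNl -RintegralN_itv; last exact: iG.
have piE r' z : - (cos (x * z + ph) * (sin (r' * z) / (r' * z)) * F z) =
    cos (x * z + (ph + pi)) * (sin (r' * z) / (r' * z)) * F z.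
  by rewrite addrA cosDpi !mulNr.
under eq_Rintegral do rewrite piE.
apply: average_of_rat => // p q p0; under eq_Rintegral do rewrite -piE.
rewrite RintegralN_itv; last exact: iG.
by rewrite ltrNl; have := hM' p q p0; rewrite ltr_norml => /andP[].
Qed.

End AeFamilies.

(** * Fourier inversion on intervals *)

Section AbelDirichlet.
Context {R : realType}.
Local Notation leb := (@lebesgue_measure R).
Local Notation RT := (measurableTypeR R).

Lemma Rintegral_primitive (u D : R -> R) a b : a <= b ->
  (forall x : R, is_derive x 1 D (u x)) -> continuous u ->
  \int[leb]_(x in `[a, b]) u x = D b - D a.
Proof.
move=> ab dD cu.
have cu' : {within `[a, b], continuous u} by exact: continuous_subspaceT.
have cD : {within `[a, b], continuous D}.
  by apply: continuous_subspaceT => x; exact: is_derive_continuous (dD x).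
apply/eqP; rewrite eq_le; apply/andP; split.
  by apply: (@le_Rintegral_primitive R u D u _ a b).
rewrite -lerN2 -RintegralN_itv; last exact: continuous_itv_integrable.
apply: (@le_Rintegral_primitive R (fun x => - u x) (- D) (fun x => - u x)) => //.
- by move=> x; apply: cvgN; exact: cu'.
- by move=> x; apply: cvgN; exact: cD.
- by rewrite /= opprB -[(- D) b]/(- D b) -[(- D) a]/(- D a); lra.
Qed.

Lemma is_derive_cos_lin (w x : R) : is_derive x 1 (fun x => cos (w * x)) (- w * sin (w * x)).
Proof.
have h1 : is_derive x 1 (fun x => w * x) w.
  by apply: (is_derive_eq (is_deriveZ w (is_derive_id x 1))); rewrite /GRing.scale /= mulr1.
apply: (is_derive_eq (is_derive1_comp (is_derive_cos (w * x)) h1)).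
by ring.
Qed.

Lemma is_derive_sin_lin (w x : R) : is_derive x 1 (fun x => sin (w * x)) (w * cos (w * x)).
Proof.
have h1 : is_derive x 1 (fun x => w * x) w.
  by apply: (is_derive_eq (is_deriveZ w (is_derive_id x 1))); rewrite /GRing.scale /= mulr1.
apply: (is_derive_eq (is_derive1_comp (is_derive_sin (w * x)) h1)).
by ring.
Qed.

Lemma is_derive_expR_lin (d x : R) : is_derive x 1 (fun x => expR (- d * x)) (- d * expR (- d * x)).
Proof.
have h1 : is_derive x 1 (fun x => - d * x) (- d).
  by apply: (is_derive_eq (is_deriveZ (- d) (is_derive_id x 1))); rewrite /GRing.scale /= mulr1.
apply: (is_derive_eq (is_derive1_comp (is_derive_expR (- d * x)) h1)).
by ring.
Qed.

Lemma Rintegral_cos_expR (d w N : R) : 0 < d -> 0 <= N ->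
  \int[leb]_(x in `[0, N]) (cos (w * x) * expR (- d * x)) =
  (d + expR (- d * N) * (w * sin (w * N) - d * cos (w * N))) / (d ^+ 2 + w ^+ 2).
Proof.
move=> d0 N0.
have P0 : 0 < d ^+ 2 + w ^+ 2 by rewrite ltr_wpDr ?sqr_ge0// exprn_gt0.
pose D (x : R) : R := (d ^+ 2 + w ^+ 2)^-1 *
  (expR (- d * x) * (w * sin (w * x) - d * cos (w * x))).
have dD (x : R) : is_derive x 1 D (cos (w * x) * expR (- d * x)).
  apply: (is_derive_eq (is_deriveZ (d ^+ 2 + w ^+ 2)^-1
    (is_deriveM (is_derive_expR_lin d x) (is_deriveB (is_deriveZ w (is_derive_sin_lin w x))
     (is_deriveZ d (is_derive_cos_lin w x)))))).
  rewrite -[LHS]/((d ^+ 2 + w ^+ 2)^-1 * (expR (- d * x) *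
     (w * (w * cos (w * x)) - d * (- w * sin (w * x))) +
     (w * sin (w * x) - d * cos (w * x)) * (- d * expR (- d * x)))).
  by field; rewrite gt_eqF.
rewrite (Rintegral_primitive N0 dD).
  by rewrite /D !mulr0 sin0 cos0 expR0; field; rewrite gt_eqF.
move=> x; apply: is_derive_continuous
  (is_deriveM (is_derive_cos_lin w x) (is_derive_expR_lin d x)).
Qed.

(* The Dirichlet integral of [sin (w x) / x], Abel regularized and truncated. *)
Definition abel (d N w : R) : R :=
  \int[leb]_(x in `]0, N]) (sin (w * x) * (expR (- d * x) / x)).

Lemma measurable_expR_lin (d : R) : measurable_fun setT (fun x : RT => expR (- d * x)).
Proof. by apply: measurableT_comp => //; exact: measurable_funM. Qed.

Lemma integrable_expR_itv (d N : R) :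
  leb.-integrable `]0, N] (EFin \o (fun x => expR (- d * x))).
Proof.
apply: integrableS (@continuous_itv_integrable _ _ 0 N _) => //.
  by apply: subset_itvr; rewrite bnd_simp.
apply: continuous_subspaceT => x.
exact: is_derive_continuous (is_derive_expR_lin d x).
Qed.

Lemma integrable_abel (d N w : R) :
  leb.-integrable `]0, N] (EFin \o (fun x => sin (w * x) * (expR (- d * x) / x))).
Proof.
have i1 := @integrable_EFinZl _ _ _ leb _ (measurable_itv _) `|w| _ (integrable_expR_itv d N).
apply: (le_integrable _ _ _ i1) => //.
  apply/measurable_EFinP; apply: measurable_funTS; apply: measurable_funM.
    by apply: measurable_sinT; exact: measurable_funM.
  apply: measurable_funM; first exact: measurable_expR_lin.
  exact: measurable_invr.
move=> x /=; rewrite in_itv /= => /andP[x0 _].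
rewrite lee_fin mulrA mulrAC normrM [leRHS]normrM normr_id ler_wpM2r//.
by rewrite normrM normfV ler_pdivrMr ?normr_gt0 ?gt_eqF// -normrM ler_norm_sin.
Qed.

Lemma is_derive_abel (d N w : R) : 0 < d -> 0 <= N ->
  is_derive w 1 (abel d N)
  ((d + expR (- d * N) * (w * sin (w * N) - d * cos (w * N))) / (d ^+ 2 + w ^+ 2)).
Proof.
move=> d0 N0; rewrite -Rintegral_cos_expR//.
have xh (x : R) : x \in `]0, N] -> x * (expR (- d * x) / x) = expR (- d * x).
  by rewrite in_itv /= => /andP[x0 _]; field; rewrite gt_eqF.
have -> : \int[leb]_(x in `[0, N]) (cos (w * x) * expR (- d * x)) =
   \int[leb]_(x in `]0, N]) (cos (w * x) * (x * (expR (- d * x) / x))).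
  rewrite -Rintegral_itv_obnd_cbnd.
    by apply: eq_Rintegral => x; rewrite inE => /xh ->.
  apply: le_integrable_bounded => //; first exact: integrable_expR_itv.
    by apply: measurable_funTS; apply: measurable_cosT; exact: measurable_funM.
  by move=> x; rewrite ler_norml cos_geN1 cos_le1.
apply: is_derive_sin_Rintegral => //; first by move=> w'; exact: integrable_abel.
apply: eq_integrable (integrable_expR_itv d N) => //.
by move=> x; rewrite inE => /xh /= ->.
Qed.

(** The main part d / (d^2 + w^2) of the derivative of [abel] is that of atan (w / d). The rest
    comes from cutting the integral at [N] and is at most 2 exp (- d N) / d, and both functions
    vanish at w = 0. *)
Lemma abel_atan (d N w : R) : 0 < d -> 0 <= N ->
  `|abel d N w - atan (w / d)| <= 2 * expR (- d * N) / d * `|w|.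
Proof.
move=> d0 N0.
pose D (w : R) : R := abel d N w - atan (d^-1 * w).
pose D' (w : R) : R := expR (- d * N) * (w * sin (w * N) - d * cos (w * N)) / (d ^+ 2 + w ^+ 2).
have P0 z : 0 < d ^+ 2 + z ^+ 2 by rewrite ltr_wpDr ?sqr_ge0// exprn_gt0.
have dD (z : R) : is_derive z 1 D (D' z).
  have h1 : is_derive z 1 (fun x => d^-1 * x) d^-1.
    by apply: (is_derive_eq (is_deriveZ d^-1 (is_derive_id z 1))); rewrite /GRing.scale /= mulr1.
  have h2 := is_derive1_comp (is_derive1_atan (d^-1 * z)) h1.
  apply: (is_derive_eq (is_deriveB (is_derive_abel z d0 N0) h2)).
  by rewrite /D'; field; rewrite (gt_eqF d0) (gt_eqF (P0 z)).
have D'b z : `|D' z| <= 2 * expR (- d * N) / d.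
  rewrite /D' normrM normfV (gtr0_norm (P0 z)) normrM (gtr0_norm (expR_gt0 _)).
  rewrite ler_pdivrMr//.
  have -> : 2 * expR (- d * N) / d * (d ^+ 2 + z ^+ 2) =
    expR (- d * N) * (2 * (d ^+ 2 + z ^+ 2) / d) by ring.
  rewrite ler_pM2l ?expR_gt0// ler_pdivlMr//.
  apply: (@le_trans _ _ ((`|z| + d) * d)).
    rewrite ler_wpM2r ?(ltW d0)//; apply: le_trans (ler_normB _ _) _.
    rewrite !normrM (gtr0_norm d0) lerD// ler_piMr ?(ltW d0)//.
      exact: norm_sin_le1.
    exact: norm_cos_le1.
  rewrite -(real_normK (num_real z)); move: `|z| => y.
  have := sqr_ge0 (y - d); have := sqr_ge0 y; have := sqr_ge0 d.
  have -> : (y - d) ^+ 2 = y ^+ 2 - 2 * (y * d) + d ^+ 2 by ring.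
  have -> : (y + d) * d = y * d + d ^+ 2 by ring.
  lra.
have D0 : D 0 = 0.
  rewrite /D mulr0 atan0 subr0 /abel.
  under eq_Rintegral do rewrite mul0r sin0 mul0r.
  by rewrite Rintegral_cst// mul0r.
have cD a b : {within `[a, b], continuous D}.
  by apply: continuous_subspaceT => x; exact: is_derive_continuous (dD x).
rewrite (mulrC w) -/(D w).
have [w0|/ltW w0] := leP 0 w.
  have [z _] := MVT_segment w0 (fun z _ => dD z) (cD _ _).
  by rewrite D0 !subr0 => ->; rewrite normrM ler_wpM2r.
have [z _] := MVT_segment w0 (fun z _ => dD z) (cD _ _).
rewrite D0 !sub0r => /eqP; rewrite eqr_oppLR => /eqP ->.
by rewrite normrN normrM normrN ler_wpM2r.
Qed.

Lemma expR_ge_sqr (k : R) : 0 <= k -> k ^+ 2 <= expR (2 * k).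
Proof.
move=> k0; rewrite expRM_natl lerXn2r ?nnegrE ?expR_ge0//.
by apply: le_trans (expR_ge1Dx k); lra.
Qed.

(** The cut-off is tied to the damping by d N = 2 k. With d = 1 / k the error is 2 k exp (- 2 k)
    |w|, and exp (2 k) >= k^2 turns it into 2 |w| / k. *)
Lemma abel_atan_nat (k w : R) : 0 < k ->
  `|abel k^-1 (2 * k ^+ 2) w - atan (w * k)| <= 2 * `|w| / k.
Proof.
move=> k0; have := @abel_atan k^-1 (2 * k ^+ 2) w.
rewrite invrK invr_gt0 => /(_ k0 _)/le_trans; apply.
  by rewrite mulr_ge0// sqr_ge0.
have -> : - k^-1 * (2 * k ^+ 2) = - (2 * k) by field; rewrite gt_eqF.
rewrite expRN -!mulrA ler_pM2l// mulrA mulrC ler_wpM2l//.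
rewrite -(ler_pM2r k0) mulVf ?gt_eqF// -mulrA -expr2 mulrC ler_pdivrMr ?expR_gt0//.
by rewrite mul1r; apply: expR_ge_sqr; exact: ltW.
Qed.

End AbelDirichlet.

Section Integration.
Context {R : realType}.
Local Notation leb := (@lebesgue_measure R).
Local Notation RT := (measurableTypeR R).

Lemma cvg_Rintegral_dominated (D : set RT) (f_ : nat -> R -> R) (f g : R -> R) :
  measurable D -> (forall n, measurable_fun D (f_ n)) -> measurable_fun D f ->
  leb.-negligible [set x | D x /\ ~ (f_ ^~ x @ \oo --> f x)] ->
  leb.-integrable D (EFin \o g) -> (forall n x, D x -> `|f_ n x| <= g x) ->
  (\int[leb]_(x in D) f_ n x) @[n --> \oo] --> \int[leb]_(x in D) f x.
Proof.
move=> mD mf_ mf ff ig fg.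
have [] := @dominated_convergence _ _ _ leb D mD (fun n => EFin \o f_ n) (EFin \o f)
  (EFin \o g) _ _ _ ig _.
- by move=> n; exact/measurable_EFinP.
- exact/measurable_EFinP.
- apply: (negligibleS _ ff) => x /= /not_implyP[Dx h]; split => //.
  by apply: contra_not h => h; apply: cvg_EFin => //; exact: nearW.
- by apply: aeW => x n Dx; rewrite lee_fin fg.
move=> iff _ h; rewrite /Rintegral; apply: fine_cvg.
by rewrite fineK ?integrable_fin_num.
Qed.

Lemma Rintegral_Fubini2 (D E : set RT) (a b : R -> R) (g : R -> R -> R) :
  measurable D -> measurable E ->
  leb.-integrable D (EFin \o a) -> leb.-integrable E (EFin \o b) ->
  measurable_fun setT (fun p : RT * RT => g p.1 p.2) ->
  (forall x y, `|g x y| <= 1) ->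
  \int[leb]_(x in D) ((\int[leb]_(y in E) (g x y * b y)) * a x) =
  \int[leb]_(y in E) ((\int[leb]_(x in D) (g x y * a x)) * b y).
Proof.
move=> mD mE ia ib mg g1.
have gD h (A : set RT) : measurable A -> leb.-integrable A (EFin \o h) ->
    leb.-integrable setT (EFin \o (h \_ A)).
  by move=> mA ih; move: ih; rewrite integrable_mkcond// restrict_EFin.
have mr h (A : set RT) : measurable A -> leb.-integrable A (EFin \o h) ->
    measurable_fun setT (h \_ A : RT -> R).
  by move=> mA ih; have /integrableP[/measurable_EFinP] := gD h A mA ih.
pose f (p : RT * RT) : \bar R := (g p.1 p.2 * (b \_ E) p.2 * (a \_ D) p.1)%:E.
have mf : measurable_fun setT f.
  apply/measurable_EFinP; apply: measurable_funM.
    by apply: measurable_funM => //; apply: measurableT_comp => //; exact: mr.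
  by apply: measurableT_comp => //; exact: mr.
have mgx x : measurable_fun setT (g x).
  exact: (measurableT_comp mg (measurable_pair1 x)).
have mgy y : measurable_fun setT (g ^~ y).
  exact: (measurableT_comp mg (measurable_pair2 y)).
have igb x : leb.-integrable E (EFin \o (fun y => g x y * b y)).
  by apply: le_integrable_bounded => //; exact: measurable_funTS.
have iga y : leb.-integrable D (EFin \o (fun x => g x y * a x)).
  by apply: le_integrable_bounded => //; exact: measurable_funTS.
have Cfin : (\int[leb]_y `|(b \_ E) y|%:E < +oo)%E.
  by have /integrableP[] := gD b E mE ib.
have intf : (leb \x leb)%E.-integrable setT f.
  apply/integrable12ltyP => //.
  apply: (@le_lt_trans _ _ (\int[leb]_(x in setT)
    (fine (\int[leb]_y `|(b \_ E) y|%:E)%E * `|(a \_ D) x|)%:E)%E).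
    apply: ge0_le_integral => //.
    - by move=> x _; exact: integral_ge0.
    - apply: (measurable_fun_fubini_tonelli_F (abse \o f)) => //=.
      exact: measurableT_comp.
    - by apply/measurable_EFinP; apply: measurable_funM => //;
        apply: measurableT_comp => //; exact: mr.
    - move=> x _; rewrite EFinM fineK ?ge0_fin_numE ?integral_ge0// muleC.
      rewrite -ge0_integralZl_EFin//; last first.
        by apply/measurable_EFinP; apply: measurableT_comp => //; exact: mr.
      apply: ge0_le_integral => //.
      + apply: measurableT_comp => //.
        exact: (measurableT_comp mf (measurable_pair1 x)).
      + apply/measurable_EFinP; apply: measurable_funM => //.
        by apply: measurableT_comp => //; exact: mr.
      + move=> y _; rewrite /f /= lee_fin normrM mulrC ler_wpM2l// normrM ler_piMl//.
  under eq_integral do rewrite EFinM.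
  rewrite ge0_integralZl_EFin ?fine_ge0 ?integral_ge0//; last first.
    by apply/measurable_EFinP; apply: measurableT_comp => //; exact: mr.
  rewrite fineK ?ge0_fin_numE ?integral_ge0// lte_mul_pinfty ?ge0_fin_numE ?integral_ge0//.
  by have /integrableP[] := gD a D mD ia.
have FE x : fubini_F leb f x = ((\int[leb]_(y in E) (g x y * b y)) * (a \_ D) x)%:E.
  rewrite /fubini_F /f /=.
  under eq_integral do rewrite mulrC EFinM.
  transitivity (((a \_ D) x)%:E * \int[leb]_y (g x y * (b \_ E) y)%:E)%E.
    apply: integralZl => //; apply: (@le_integrable_bounded R setT (b \_ E) (g x)) => //.
    exact: gD.
  rewrite mulrC EFinM; congr (_ * _)%E; rewrite fineK ?integrable_fin_num//; last exact: igb.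
  rewrite [RHS]integral_mkcond; apply: eq_integral => y _.
  by rewrite !patchE; case: ifPn; rewrite ?mulr0.
have GE y : fubini_G leb f y = ((\int[leb]_(x in D) (g x y * a x)) * (b \_ E) y)%:E.
  rewrite /fubini_G /f /=.
  under eq_integral do rewrite mulrAC mulrC EFinM.
  transitivity (((b \_ E) y)%:E * \int[leb]_x (g x y * (a \_ D) x)%:E)%E.
    apply: integralZl => //; apply: (@le_integrable_bounded R setT (a \_ D) (g ^~ y)) => //.
    exact: gD.
  rewrite mulrC EFinM; congr (_ * _)%E; rewrite fineK ?integrable_fin_num//; last exact: iga.
  rewrite [RHS]integral_mkcond; apply: eq_integral => x _.
  by rewrite !patchE; case: ifPn; rewrite ?mulr0.
have Fu := Fubini intf; rewrite /Rintegral; congr fine.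
transitivity (\int[leb]_x fubini_F leb f x)%E.
  rewrite [LHS]integral_mkcond; apply: eq_integral => x _.
  by rewrite FE !patchE; case: ifPn; rewrite ?mulr0.
rewrite [LHS]Fu [RHS]integral_mkcond; apply: eq_integral => y _.
by rewrite [LHS]GE !patchE; case: ifPn; rewrite ?mulr0.
Qed.

End Integration.

Section AbelLimit.
Context {R : realType}.
Local Notation leb := (@lebesgue_measure R).
Local Notation RT := (measurableTypeR R).

Definition abel_ (n : nat) : R -> R := abel n.+1%:R^-1 (2 * n.+1%:R ^+ 2).

Lemma abel_bound n (w : R) : `|abel_ n w| <= pi / 2 + 2 * `|w|.
Proof.
have := @abel_atan_nat R n.+1%:R w (ltr0Sn _ _); rewrite -/(abel_ n w) => h.
have -> : abel_ n w = atan (w * n.+1%:R) + (abel_ n w - atan (w * n.+1%:R)) by ring.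
apply: le_trans (ler_normD _ _) _; apply: lerD.
  by rewrite ler_norml (ltW (atan_gtNpi2 _)) (ltW (atan_ltpi2 _)).
apply: le_trans h _; rewrite ler_pdivrMr// ler_peMr ?mulr_ge0//.
by rewrite ler1n.
Qed.

Lemma abel_cvg_gt0 (w : R) : 0 < w -> abel_ ^~ w @ \oo --> pi / 2.
Proof.
move=> w0.
have h1 : (w * (n.+1%:R : R)) @[n --> \oo] --> +oo.
  have hn : (n.+1%:R : R) @[n --> \oo] --> +oo.
    by rewrite (cvg_shiftS (fun n => n%:R : R)); exact: cvgr_idn.
  exact: (cvg_comp _ _ hn (gt0_cvgMry w0 cvg_id)).
have h2 : (atan (w * (n.+1%:R : R))) @[n --> \oo] --> pi / 2.
  exact: cvg_comp h1 (@cvgy_atan R).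
have h3 : (2 * `|w| / (n.+1%:R : R)) @[n --> \oo] --> 0.
  rewrite -[X in _ --> X](mulr0 (2 * `|w|)); apply: cvgMr.
  exact: cvg_harmonic.
have h4 : (abel_ n w - atan (w * n.+1%:R)) @[n --> \oo] --> 0.
  apply/cvgr0Pnorm_lt => e e0; move/cvgr0Pnorm_lt : h3.
  by move=> /(_ _ e0); apply: filterS => n; apply: le_lt_trans;
    rewrite [leRHS]ger0_norm ?divr_ge0 ?mulr_ge0//; exact: abel_atan_nat.
rewrite -[X in _ --> X]add0r.
have -> : abel_ ^~ w = (fun n => abel_ n w - atan (w * n.+1%:R) + atan (w * n.+1%:R)).
  by apply/funext => n; rewrite subrK.
exact: cvgD.
Qed.

Lemma abelN n (w : R) : abel_ n (- w) = - abel_ n w.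
Proof.
rewrite /abel_ /abel -[RHS]mulN1r -RintegralZl//; last exact: integrable_abel.
by apply: eq_Rintegral => x _; rewrite mulNr sinN mulN1r mulNr.
Qed.

Lemma abel_cvg_lt0 (w : R) : w < 0 -> abel_ ^~ w @ \oo --> - (pi / 2).
Proof.
rewrite -oppr_gt0 => /abel_cvg_gt0 h.
have -> : abel_ ^~ w = (fun n => - abel_ n (- w)).
  by apply/funext => n; rewrite abelN opprK.
exact: cvgN.
Qed.

Lemma measurable_abel n : measurable_fun setT (abel_ n : RT -> R).
Proof.
apply: continuous_measurable_fun => w; apply: is_derive_continuous.
by apply: is_derive_abel; rewrite ?invr_gt0// mulr_ge0// sqr_ge0.
Qed.

(** The sum tends to pi inside the ball, where both arguments are positive, and to 0 beyond its end
    points, where their signs differ; the end points are a null set. On [-A, A] [abel_bound]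
    provides the dominating function. *)
Lemma abel_window (phi : R -> R) (A x0 r : R) : 0 < r ->
  leb.-integrable `[- A, A] (EFin \o phi) -> ball x0 r `<=` `[- A, A] ->
  (\int[leb]_(x in `[- A, A]) ((abel_ n (r + (x - x0)) + abel_ n (r - (x - x0))) * phi x))
    @[n --> \oo] --> pi * \int[leb]_(x in ball x0 r) phi x.
Proof.
move=> r0 iphi bA.
have mphi : measurable_fun `[- A, A] (phi : RT -> R).
  by have /integrableP[/measurable_EFinP] := iphi.
have mb : measurable (ball x0 r : set RT) by exact: measurable_ball.
have ibphi : leb.-integrable (ball x0 r) (EFin \o phi) by exact: integrableS iphi.
have -> : pi * \int[leb]_(x in ball x0 r) phi x =
    \int[leb]_(x in `[- A, A]) (pi * (phi \_ (ball x0 r)) x).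
  rewrite RintegralZl//; first by rewrite -Rintegral_mkcondr setIidr.
  rewrite -restrict_EFin; apply: (@integrableS _ _ _ _ setT) => //.
  by rewrite -integrable_mkcond.
have mlin (a b : R) : measurable_fun setT (fun x : RT => a + b * (x - x0)).
  by apply: measurable_funD => //; apply: measurable_funM => //; exact: measurable_funB.
pose B : R := 2 * (pi / 2 + 2 * (r + `|A| + `|x0|)).
have iB := @integrable_EFinZl _ _ _ leb _ (measurable_itv `[- A, A]) B _ (integrable_norm iphi).
apply: (cvg_Rintegral_dominated _ _ _ _ iB) => //.
- move=> n; apply: measurable_funM => //; apply: measurable_funTS; apply: measurable_funD.
    apply: measurableT_comp; first exact: measurable_abel.
    by have := mlin r 1; under eq_fun do rewrite mul1r.
  apply: measurableT_comp; first exact: measurable_abel.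
  by have := mlin r (-1); under eq_fun do rewrite mulN1r.
- apply: measurable_funM => //; apply/(measurable_restrict phi) => //.
  by apply: measurable_funS mphi => //; exact: subIsetr.
- have H : leb.-negligible ([set x0 - r; x0 + r] : set RT).
    exists [set x0 - r; x0 + r]; split => //; first exact: measurableU.
    by apply: countable_lebesgue_measure0; apply: finite_set_countable.
  apply: (negligibleS _ H).
    move=> x /= [xA]; have [xb|xb] := pselect (ball x0 r x).
      move: (xb); rewrite ball_itv /= in_itv /= => /andP[x1 x2] h; exfalso; apply: h.
      rewrite patchE mem_set//=; last by rewrite in_itv /= x1.
      have -> : pi * phi x = (pi / 2 + pi / 2) * phi x by rewrite -splitr.
      apply: cvgMl; apply: cvgD; apply: abel_cvg_gt0; lra.
    move=> h; apply: contrapT => hx; apply: h.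
    rewrite patchE memNset// mulr0.
    suff -> : 0 = 0 * phi x :> R.
      apply: cvgMl; move: xb; rewrite ball_itv /= in_itv /= => /negP.
      rewrite negb_and -!leNgt => /orP[x1|x1].
        have {}x1 : x < x0 - r.
          by rewrite lt_neqAle x1 andbT; apply/eqP => E; apply: hx; left.
        rewrite -(addNr (pi / 2)); apply: cvgD.
          by apply: abel_cvg_lt0; lra.
        by apply: abel_cvg_gt0; lra.
      have {}x1 : x0 + r < x.
        by rewrite lt_neqAle x1 andbT; apply/eqP => E; apply: hx; right.
      rewrite -(addrN (pi / 2)); apply: cvgD.
        by apply: abel_cvg_gt0; lra.
      by apply: abel_cvg_lt0; lra.
    by rewrite mul0r.
- move=> n x; rewrite /= in_itv /= => /andP[xA1 xA2].
  rewrite normrM ler_wpM2r//; apply: le_trans (ler_normD _ _) _.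
  rewrite /B mulr_natl mulr2n.
  have xA : `|x| <= `|A|.
    by rewrite ler_norml (le_trans xA2 (ler_norm _)) andbT (le_trans _ xA1)// lerN2 ler_norm.
  have k1 : `|r + (x - x0)| <= r + `|A| + `|x0|.
    rewrite addrA; apply: le_trans (ler_normB _ _) _; rewrite lerD2r.
    by apply: le_trans (ler_normD _ _) _; rewrite (gtr0_norm r0) lerD2l.
  have k2 : `|r - (x - x0)| <= r + `|A| + `|x0|.
    rewrite opprB addrCA addrC -addrA; apply: le_trans (ler_normD _ _) _.
    rewrite -addrA (gtr0_norm r0) lerD2l -normrN opprD opprK.
    by apply: le_trans (ler_normB _ _) _; rewrite lerD2r.
  by apply: lerD; apply: le_trans (abel_bound _ _) _; rewrite lerD2l ler_pM2l.
Qed.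

End AbelLimit.

Section Inversion.
Context {R : realType}.
Local Notation leb := (@lebesgue_measure R).
Local Notation RT := (measurableTypeR R).

(** The integral is Lipschitz in [xi], with constant |A| times the integral of |phi|. *)
Lemma measurable_Rintegral_slice (h phi : R -> R) (A : R) :
  (forall y, `|h y| <= 1) -> (forall y z, `|h y - h z| <= `|y - z|) ->
  measurable_fun setT (h : RT -> R) -> leb.-integrable `[- A, A] (EFin \o phi) ->
  measurable_fun setT (fun xi : RT => \int[leb]_(x in `[- A, A]) (h (x * xi) * phi x)).
Proof.
move=> h1 hl mh iphi.
pose I := \int[leb]_(x in `[- A, A]) `|phi x|.
have I0 : 0 <= I by apply: Rintegral_ge0 => z _.
have B0 : 0 < `|A| * I + 1 by rewrite ltr_wpDl// mulr_ge0.
apply: continuous_measurable_fun => xi; apply/cvgrPdist_lt => e e0.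
exists (e / (`|A| * I + 1)); first by rewrite /= divr_gt0.
move=> xi' /= d; have {d} : `|xi - xi'| * (`|A| * I + 1) < e by rewrite -ltr_pdivlMr.
apply: le_lt_trans.
apply: (@le_trans _ _ (`|A| * `|xi - xi'| * I)); last first.
  by rewrite mulrDr mulr1 -mulrA mulrCA lerDl.
have mhx (z : R) : measurable_fun `[- A, A] (fun x : RT => h (x * z)).
  apply: measurable_funTS; apply: (measurableT_comp mh).
  exact: measurable_funM.
apply: (@Rintegral_dist _ _ _ (fun x => h (x * xi)) (fun x => h (x * xi'))) => //;
  [exact: mhx|exact: mhx|move=> x].
rewrite /= in_itv /= => /andP[xA1 xA2].
apply: le_trans (hl _ _) _; rewrite -mulrBr normrM ler_wpM2r//.
by rewrite ler_norml (le_trans xA2 (ler_norm _)) andbT (le_trans _ xA1)// lerN2 ler_norm.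
Qed.

Lemma measurable_cos_Rintegral (phi : R -> R) (A : R) :
  leb.-integrable `[- A, A] (EFin \o phi) ->
  measurable_fun setT (fun xi : RT => \int[leb]_(x in `[- A, A]) (cos (x * xi) * phi x)).
Proof.
apply: measurable_Rintegral_slice; last exact: measurable_cosT.
- by move=> y; rewrite ler_norml cos_geN1 cos_le1.
- exact: ler_dist_cos.
Qed.

Lemma measurable_sin_Rintegral (phi : R -> R) (A : R) :
  leb.-integrable `[- A, A] (EFin \o phi) ->
  measurable_fun setT (fun xi : RT => \int[leb]_(x in `[- A, A]) (sin (x * xi) * phi x)).
Proof.
apply: measurable_Rintegral_slice; last exact: measurable_sinT.
- by move=> y; rewrite ler_norml sin_geN1 sin_le1.
- exact: ler_dist_sin.
Qed.

Lemma integrable_sinc_sqr (r : R) :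
  leb.-integrable `]0, +oo[ (EFin \o (fun xi => (sin (r * xi) / xi) ^+ 2)).
Proof.
have i0 : leb.-integrable `]0, +oo[ (EFin \o (fun xi => (r ^+ 2 + 1) * (oneDsqr xi)^-1)).
  apply: (@integrable_EFinZl _ _ _ leb _ (measurable_itv `]0, +oo[)).
  have i1 : leb.-integrable `[0, +oo[ (EFin \o (fun xi => (oneDsqr xi)^-1)).
    apply/integrableP; split.
      apply/measurable_EFinP; apply: measurable_funTS.
      apply: (measurableT_comp (@measurable_invr R)); apply: measurable_funD => //.
    under eq_integral do rewrite /= ger0_norm ?invr_ge0 ?addr_ge0 ?sqr_ge0//.
    by rewrite integral0y_oneDsqr ltry.
  apply: integrableS i1 => //.
  by apply: subset_itvr; rewrite bnd_simp.
apply: (le_integrable _ _ _ i0) => //.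
  apply/measurable_EFinP; apply: measurable_funTS; apply: measurable_funX.
  apply: measurable_funM; last exact: measurable_invr.
  by apply: measurable_sinT; exact: measurable_funM.
move=> x; rewrite /= in_itv /= andbT => x0; rewrite lee_fin.
rewrite ger0_norm ?sqr_ge0// ger0_norm; last first.
  by rewrite mulr_ge0 ?addr_ge0 ?sqr_ge0// invr_ge0 addr_ge0 ?sqr_ge0.
rewrite ler_pdivlMr ?ltr_pwDl ?sqr_ge0// /oneDsqr mulrDr mulr1 lerD//.
  rewrite -[leLHS](ger0_norm (sqr_ge0 _)) -[leRHS](ger0_norm (sqr_ge0 _)) !normrX.
  rewrite lerXn2r ?nnegrE// normrM normfV ler_pdivrMr ?normr_gt0 ?gt_eqF//.
  by rewrite -normrM ler_norm_sin.
rewrite -exprMn divfK ?gt_eqF// -(expr1n _ 2).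
Qed.

Variables (phi E O : R -> R) (x0 r : R).
Hypothesis r0 : 0 < r.
Hypothesis iphi : forall A, leb.-integrable `[- A, A] (EFin \o phi).
Hypothesis mE : measurable_fun setT (E : RT -> R).
Hypothesis mO : measurable_fun setT (O : RT -> R).
Hypothesis iE : leb.-integrable `]0, +oo[ (EFin \o (fun xi => E xi ^+ 2)).
Hypothesis iO : leb.-integrable `]0, +oo[ (EFin \o (fun xi => O xi ^+ 2)).

(** [Ecos] and [Osin] are what [E] and [O] become when [phi] is cut to [-A, A]; the sign of [Osin]
    is that of exp (- i x xi). *)
Definition Ecos (A xi : R) : R := 2 * \int[leb]_(x in `[- A, A]) (cos (x * xi) * phi x).
Definition Osin (A xi : R) : R := - (2 * \int[leb]_(x in `[- A, A]) (sin (x * xi) * phi x)).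

Hypothesis approx : forall e A0, 0 < e -> exists2 A, A0 <= A & forall N,
  [/\ leb.-integrable `]0, N] (EFin \o (fun xi => (E xi - Ecos A xi) ^+ 2)),
      leb.-integrable `]0, N] (EFin \o (fun xi => (O xi - Osin A xi) ^+ 2)),
      \int[leb]_(xi in `]0, N]) ((E xi - Ecos A xi) ^+ 2) <= e &
      \int[leb]_(xi in `]0, N]) ((O xi - Osin A xi) ^+ 2) <= e].

(* Here [E xi = Re F xi + Re F (- xi)] and [O xi = Im F xi - Im F (- xi)], so that
   [2 * window E O] pairs the Fourier transform of [phi = Re f] with that of the
   indicator of [ball x0 r]. *)
Definition window (E O : R -> R) (xi : R) : R :=
  (E xi * cos (x0 * xi) - O xi * sin (x0 * xi)) * (sin (r * xi) / xi).

Let msin (w : R) : measurable_fun setT (fun x : RT => sin (w * x)).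
Proof. by apply: measurable_sinT; exact: measurable_funM. Qed.

Let mcos (w : R) : measurable_fun setT (fun x : RT => cos (w * x)).
Proof. by apply: measurable_cosT; exact: measurable_funM. Qed.

Lemma measurable_window (E' O' : R -> R) : measurable_fun setT (E' : RT -> R) ->
  measurable_fun setT (O' : RT -> R) -> measurable_fun setT (window E' O' : RT -> R).
Proof.
move=> mE' mO'; apply: measurable_funM.
  by apply: measurable_funB; apply: measurable_funM.
by apply: measurable_funM => //; exact: measurable_invr.
Qed.

(** Cauchy-Schwarz with a free parameter: [l] is later taken large, which makes the fixed integral
    of the squared kernel negligible, and then the L^2 error small compared with 1 / l. *)
Lemma window_bound (l a b xi : R) (E' O' : R -> R) : 0 < l ->
  `|E' xi| <= a -> `|O' xi| <= b ->
  `|window E' O' xi| <= l / 2 * (a ^+ 2 + b ^+ 2) + l^-1 * (sin (r * xi) / xi) ^+ 2.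
Proof.
move=> l0 Ea Ob; rewrite /window normrM.
set t := `|sin (r * xi) / xi|.
have -> : (sin (r * xi) / xi) ^+ 2 = t ^+ 2 by rewrite /t -normrX ger0_norm ?sqr_ge0.
have h : `|E' xi * cos (x0 * xi) - O' xi * sin (x0 * xi)| <= a + b.
  apply: le_trans (ler_normB _ _) _; rewrite !normrM; apply: lerD.
    by apply: le_trans Ea; rewrite ler_piMr// ler_norml cos_geN1 cos_le1.
  by apply: le_trans Ob; rewrite ler_piMr// ler_norml sin_geN1 sin_le1.
apply: le_trans (ler_wpM2r (normr_ge0 _) h) _; rewrite -/t.
rewrite -subr_ge0.
have -> : l / 2 * (a ^+ 2 + b ^+ 2) + l^-1 * t ^+ 2 - (a + b) * t =
  (2 * l)^-1 * ((l * a - t) ^+ 2 + (l * b - t) ^+ 2).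
  by field; rewrite gt_eqF.
by rewrite mulr_ge0 ?addr_ge0 ?sqr_ge0// invr_ge0 mulr_ge0// ltW.
Qed.

Lemma integrable_window : leb.-integrable `]0, +oo[ (EFin \o window E O).
Proof.
have i1 := @integrable_EFinD _ _ _ leb _ (measurable_itv `]0, +oo[) _ _ iE iO.
have i2 := @integrable_EFinZl _ _ _ leb _ (measurable_itv `]0, +oo[) (1 / 2) _ i1.
have i3 := @integrable_EFinZl _ _ _ leb _ (measurable_itv `]0, +oo[) 1^-1 _ (integrable_sinc_sqr r).
have i4 := @integrable_EFinD _ _ _ leb _ (measurable_itv `]0, +oo[) _ _ i2 i3.
apply: (le_integrable _ _ _ i4) => //.
  by apply/measurable_EFinP; apply: measurable_funTS; exact: measurable_window.
move=> x _; rewrite lee_fin; apply: le_trans (ler_norm _).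
rewrite -(real_normK (num_real (E x))) -(real_normK (num_real (O x))).
exact: window_bound.
Qed.

Let N_ (n : nat) : R := 2 * n.+1%:R ^+ 2.

Let N_ge (n : nat) : n.+1%:R <= N_ n.
Proof.
rewrite /N_ expr2 mulrA ler_peMl// -natrM ler1n.
by [].
Qed.

Lemma window_Abel_cvg :
  (\int[leb]_(xi in `]0, N_ n]) (expR (- n.+1%:R^-1 * xi) * window E O xi)) @[n --> \oo] -->
  \int[leb]_(xi in `]0, +oo[) window E O xi.
Proof.
have mW := measurable_window mE mO.
pose u n (xi : RT) : R := expR (- n.+1%:R^-1 * xi) * window E O xi.
have -> : (fun n => \int[leb]_(xi in `]0, N_ n]) (expR (- n.+1%:R^-1 * xi) * window E O xi)) =
  (fun n => \int[leb]_(xi in `]0, +oo[) ((u n \_ `]0, N_ n]) xi)).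
  apply/funext => n; rewrite -Rintegral_mkcondr setIidr//.
  by apply: subset_itvl; rewrite bnd_simp.
have mf n : measurable_fun setT (u n).
  by apply: measurable_funM => //; exact: measurable_expR_lin.
apply: (cvg_Rintegral_dominated _ _ _ _ (integrable_norm integrable_window)) => //.
- move=> n; apply/(measurable_restrict (u n)) => //.
  exact: measurable_funTS.
- exact: measurable_funTS.
- rewrite [X in leb.-negligible X](_ : _ = set0); first exact: negligible_set0.
  rewrite -subset0 => xi /= []; rewrite in_itv /= andbT => xi0; apply.
  rewrite -[X in _ --> X]mul1r.
  apply: (@cvg_trans _ ((fun n : nat => u n xi) @ \oo)).
    apply: near_eq_cvg; near=> n; rewrite patchE mem_set//= in_itv /= xi0 /=.
    apply: le_trans (N_ge n); apply: le_trans (_ : n%:R <= _); last by rewrite ler_nat.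
    by near: n; exact: nbhs_infty_ger.
  have h : (- (n.+1%:R : R)^-1 * xi) @[n --> \oo] --> (0 : R).
    rewrite -[X in _ --> X](mul0r xi); apply: cvgMl.
    by rewrite -[X in _ --> X]oppr0; apply: cvgN; exact: cvg_harmonic.
  by apply: cvgMl; rewrite -[X in _ --> X]expR0; apply: continuous_cvg h; exact: continuous_expR.
- move=> n xi; rewrite /= in_itv /= andbT => xi0; rewrite patchE; case: ifPn; rewrite ?normr0//.
  move=> _; rewrite normrM ler_piMl// ger0_norm ?expR_ge0// -expR0 ler_expR.
  by rewrite mulNr oppr_le0 mulr_ge0// ltW.
Unshelve. all: by end_near. Qed.

(** After Fubini, 2 cos u sin v = sin (v + u) + sin (v - u) with u = (x - x0) xi and v = r xi
    produces the two values of [abel_]. *)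
Lemma window_Abel_Fubini (A : R) n :
  \int[leb]_(xi in `]0, N_ n]) (expR (- n.+1%:R^-1 * xi) * window (Ecos A) (Osin A) xi) =
  \int[leb]_(x in `[- A, A]) ((abel_ n (r + (x - x0)) + abel_ n (r - (x - x0))) * phi x).
Proof.
pose d : R := n.+1%:R^-1.
pose a (xi : R) : R := sin (r * xi) * (expR (- d * xi) / xi).
pose g (xi x : R) : R := cos ((x - x0) * xi).
have ia : leb.-integrable `]0, N_ n] (EFin \o a) by exact: integrable_abel.
have mg : measurable_fun setT (fun p : RT * RT => g p.1 p.2).
  apply: measurable_cosT; apply: measurable_funM => //; exact: measurable_funB.
have g1 x y : `|g x y| <= 1 by exact: norm_cos_le1.
have i2phi := @integrable_EFinZl _ _ _ leb _ (measurable_itv `[- A, A]) 2 _ (iphi A).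
have Fu := @Rintegral_Fubini2 R `]0, N_ n] `[- A, A] a (fun x => 2 * phi x) g
  (measurable_itv _) (measurable_itv _) ia i2phi mg g1.
have ic (h : R -> R) : measurable_fun setT (h : RT -> R) -> (forall x, `|h x| <= 1) ->
  leb.-integrable `[- A, A] (EFin \o (fun x => h x * phi x)).
  by move=> mh h1; apply: le_integrable_bounded => //; exact: measurable_funTS.
have cos1 (y : R) : `|cos y| <= 1 by exact: norm_cos_le1.
have sin1 (y : R) : `|sin y| <= 1 by exact: norm_sin_le1.
transitivity (\int[leb]_(xi in `]0, N_ n])
    ((\int[leb]_(x in `[- A, A]) (g xi x * (2 * phi x))) * a xi)).
  apply: eq_Rintegral => xi _; rewrite /window /Ecos /Osin /a.
  have mx : measurable_fun setT (fun x : RT => x * xi) by exact: measurable_funM.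
  have icx := ic (fun x => cos (x * xi)) (measurable_cosT mx) (fun x => cos1 _).
  have isx := ic (fun x => sin (x * xi)) (measurable_sinT mx) (fun x => sin1 _).
  have -> : \int[leb]_(x in `[- A, A]) (g xi x * (2 * phi x)) =
      \int[leb]_(x in `[- A, A]) (2 * cos (x0 * xi) * (cos (x * xi) * phi x) +
        2 * sin (x0 * xi) * (sin (x * xi) * phi x)).
    by apply: eq_Rintegral => x _; rewrite /g mulrBl cosB; ring.
  rewrite RintegralD//; last 2 first.
  - exact: (@integrable_EFinZl _ _ _ leb _ (measurable_itv `[- A, A]) _ _ icx).
  - exact: (@integrable_EFinZl _ _ _ leb _ (measurable_itv `[- A, A]) _ _ isx).
  by rewrite !RintegralZl//; ring.
rewrite Fu; apply: eq_Rintegral => x _; rewrite mulrA; congr (_ * _).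
rewrite /abel_ /abel -RintegralD//; try exact: integrable_abel.
rewrite mulrC -RintegralZl//; last first.
  by apply: le_integrable_bounded => //; apply: measurable_funTS; exact: mcos.
apply: eq_Rintegral => xi _; rewrite /a /g [(r + _) * _]mulrDl [(r - _) * _]mulrBl sinD sinB /d.
by ring.
Qed.

(** The bound depends neither on the damping [d] nor on the cut-off [N], so it survives the limit in
    which both are removed. *)
Lemma window_error (l e A N d : R) : 0 < l -> 0 <= d ->
  leb.-integrable `]0, N] (EFin \o (fun xi => (E xi - Ecos A xi) ^+ 2)) ->
  leb.-integrable `]0, N] (EFin \o (fun xi => (O xi - Osin A xi) ^+ 2)) ->
  \int[leb]_(xi in `]0, N]) ((E xi - Ecos A xi) ^+ 2) <= e ->
  \int[leb]_(xi in `]0, N]) ((O xi - Osin A xi) ^+ 2) <= e ->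
  `|\int[leb]_(xi in `]0, N]) (expR (- d * xi) * window E O xi) -
    \int[leb]_(xi in `]0, N]) (expR (- d * xi) * window (Ecos A) (Osin A) xi)| <=
  l * e + l^-1 * \int[leb]_(xi in `]0, +oo[) (sin (r * xi) / xi) ^+ 2.
Proof.
move=> l0 d0 ie io ee oe.
have sub : `]0, N]%classic `<=` `]0, +oo[%classic.
  by apply: subset_itvl; rewrite bnd_simp.
have iS : leb.-integrable `]0, N] (EFin \o (fun xi => (sin (r * xi) / xi) ^+ 2)).
  by apply: integrableS (integrable_sinc_sqr r).
pose w xi := window (fun xi => E xi - Ecos A xi) (fun xi => O xi - Osin A xi) xi.
have mEA : measurable_fun setT (Ecos A : RT -> R).
  by apply: measurable_funM => //; exact: measurable_cos_Rintegral.
have mOA : measurable_fun setT (Osin A : RT -> R).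
  apply: measurableT_comp => //; apply: measurable_funM => //.
  exact: measurable_sin_Rintegral.
have mw : measurable_fun setT (w : RT -> R).
  by apply: measurable_window; exact: measurable_funB.
have i1 := @integrable_EFinD _ _ _ leb _ (measurable_itv `]0, N]) _ _ ie io.
have i2 := @integrable_EFinZl _ _ _ leb _ (measurable_itv `]0, N]) (l / 2) _ i1.
have i3 := @integrable_EFinZl _ _ _ leb _ (measurable_itv `]0, N]) l^-1 _ iS.
have i4 := @integrable_EFinD _ _ _ leb _ (measurable_itv `]0, N]) _ _ i2 i3.
have iw : leb.-integrable `]0, N] (EFin \o w).
  apply: (le_integrable _ _ _ i4) => //.
    by apply/measurable_EFinP; exact: measurable_funTS.
  move=> x _; rewrite lee_fin; apply: le_trans (ler_norm _).
  rewrite -[(E x - _) ^+ 2]real_normK ?num_real// -[(O x - _) ^+ 2]real_normK ?num_real//.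
  exact: window_bound.
have iW : leb.-integrable `]0, N] (EFin \o window E O) by exact: integrableS integrable_window.
have me : measurable_fun setT (fun xi : RT => expR (- d * xi)) by exact: measurable_expR_lin.
have iX (u : R -> R) : leb.-integrable `]0, N] (EFin \o u) ->
    leb.-integrable `]0, N] (EFin \o (fun xi => expR (- d * xi) * u xi)).
  move=> iu; have /integrableP[/measurable_EFinP mu _] := iu.
  apply: (le_integrable _ _ _ iu) => //.
    by apply/measurable_EFinP; apply: measurable_funM => //; exact: measurable_funTS.
  move=> x; rewrite /= in_itv /= => /andP[x0' _]; rewrite lee_fin normrM ler_piMl//.
  by rewrite ger0_norm ?expR_ge0// -expR0 ler_expR mulNr oppr_le0 mulr_ge0// ltW.
have wE xi : w xi = window E O xi - window (Ecos A) (Osin A) xi.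
  by rewrite /w /window; ring.
have iWA : leb.-integrable `]0, N] (EFin \o window (Ecos A) (Osin A)).
  have := @integrable_EFinB _ _ _ leb _ (measurable_itv `]0, N]) _ _ iW iw.
  apply: eq_integrable => // x _; congr EFin.
  by rewrite wE; ring.
rewrite -RintegralB//; try exact: iX.
have iXw := iX _ iw.
under eq_Rintegral do rewrite -mulrBr -wE.
apply: le_trans (le_normr_Rintegral _ iXw) _ => //.
apply: (@le_trans _ _ (\int[leb]_(xi in `]0, N]) (l / 2 *
   ((E xi - Ecos A xi) ^+ 2 + (O xi - Osin A xi) ^+ 2) +
   l^-1 * (sin (r * xi) / xi) ^+ 2))).
  apply: le_Rintegral => //; first exact: (integrable_norm iXw).
  move=> x; rewrite /= in_itv /= => /andP[x0' _].
  rewrite normrM (ger0_norm (expR_ge0 _)).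
  apply: (@le_trans _ _ (`|w x|)).
    by rewrite ler_piMl// -expR0 ler_expR mulNr oppr_le0 mulr_ge0// ltW.
  rewrite -[(E x - _) ^+ 2]real_normK ?num_real// -[(O x - _) ^+ 2]real_normK ?num_real//.
  exact: window_bound.
rewrite (RintegralD _ i2 i3)// (RintegralZl _ _ i1)// (RintegralZl _ _ iS)//.
rewrite (RintegralD _ ie io)//; apply: lerD.
  have -> : l * e = l / 2 * (e + e) by field.
  by rewrite ler_wpM2l ?lerD// divr_ge0// ltW.
rewrite ler_wpM2l ?invr_ge0 ?(ltW l0)//.
rewrite -lee_fin /Rintegral !fineK ?integrable_fin_num//; last exact: integrable_sinc_sqr.
apply: ge0_subset_integral => //.
- by have /integrableP[] := integrable_sinc_sqr r.
- by move=> x _; rewrite lee_fin sqr_ge0.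
Qed.

Lemma Rintegral_window :
  \int[leb]_(xi in `]0, +oo[) window E O xi = pi * \int[leb]_(x in ball x0 r) phi x.
Proof.
set L := LHS; set P := RHS.
pose K := \int[leb]_(xi in `]0, +oo[) (sin (r * xi) / xi) ^+ 2.
have K0 : 0 <= K by apply: Rintegral_ge0 => x _; exact: sqr_ge0.
have key (e : R) : 0 < e -> `|L - P| <= e.
  (* This [l] makes the kernel term K / l at most e / 2, and the L^2 error e / (2 l) then makes the
     other term e / 2. The lower bound on [A] places the ball inside [-A, A]. *)
  move=> e0; pose l := 2 * (K + 1) / e.
  have l0 : 0 < l by rewrite divr_gt0// mulr_gt0// ltr_wpDl.
  have e1 : 0 < e / 2 / l by apply: divr_gt0 => //; exact: divr_gt0.
  have [A rA hA] := approx (`|x0| + r) e1.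
  have bA : ball x0 r `<=` `[- A, A]%classic.
    move=> x; rewrite /ball /= ltr_distlC => /andP[h1 h2]; rewrite in_itv /=.
    have := ler_norm x0; have := ler_norm (- x0); rewrite normrN.
    by move=> k1 k2; apply/andP; split; lra.
  have c1 := window_Abel_cvg.
  have c2 := abel_window r0 (iphi A) bA.
  pose u n := `|\int[leb]_(xi in `]0, N_ n]) (expR (- n.+1%:R^-1 * xi) * window E O xi) -
    \int[leb]_(x in `[- A, A]) ((abel_ n (r + (x - x0)) + abel_ n (r - (x - x0))) * phi x)|.
  have c3 : u n @[n --> \oo] --> `|L - P| by apply: cvg_norm; apply: cvgB.
  rewrite -(cvg_lim _ c3)//; apply: limr_le; first by apply/cvg_ex; exists `|L - P|.
  apply: nearW => n; rewrite /u -window_Abel_Fubini.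
  have [ie io ee oe] := hA (N_ n).
  have d0 : 0 <= n.+1%:R^-1 :> R by rewrite invr_ge0.
  apply: le_trans (window_error l0 d0 ie io ee oe) _.
  have -> : l * (e / 2 / l) = e / 2 by field; rewrite gt_eqF.
  rewrite -/K [leRHS](splitr e) lerD2l ler_pdivrMl// /l.
  have -> : 2 * (K + 1) / e * (e / 2) = K + 1 by field; rewrite gt_eqF.
  by rewrite lerDl.
apply/eqP; rewrite -subr_eq0 -normr_le0; apply/ler_addgt0Pr => e e0.
by rewrite add0r key.
Qed.

End Inversion.

(** * Reflection of the frequency, and square-integrable functions *)

Section Reflection.
Context {R : realType}.
Local Notation leb := (@lebesgue_measure R).
Local Notation RT := (measurableTypeR R).

Lemma integrable_opp (u : R -> R) (a b : R) : measurable_fun setT (u : RT -> R) ->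
  leb.-integrable `[a, b] (EFin \o u) ->
  leb.-integrable `[- b, - a] (EFin \o (fun x => u (- x))).
Proof.
move=> mu iu.
have mu' : measurable_fun setT ((fun x => u (- x)) : RT -> R) by exact: measurableT_comp.
apply/integrableP; split; first by apply/measurable_EFinP; exact: measurable_funTS.
have /integrableP[_] := iu; congr (_ < _)%E.
have -> : `[- b, - a]%classic = (-%R : _ -> RT) @^-1` `[a, b].
  by rewrite opp_preimage_itvbndbnd.
transitivity (\int[pushforward leb (-%R : _ -> RT)]_(x in `[a, b]) `|(EFin \o u) x|)%E.
  by apply: eq_measure_integral => A mA _; apply/esym; exact: lebesgue_measureN.
rewrite ge0_integral_pushforward//.
by apply: measurableT_comp => //; apply/measurable_EFinP; exact: measurable_funTS.
Qed.

Lemma Rintegral_opp (u : R -> R) (a b : R) : measurable_fun setT (u : RT -> R) ->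
  leb.-integrable `[a, b] (EFin \o u) ->
  \int[leb]_(x in `[a, b]) u x = \int[leb]_(x in `[- b, - a]) u (- x).
Proof.
move=> mu iu; rewrite /Rintegral; congr fine.
have E : `[- b, - a]%classic = (-%R : _ -> RT) @^-1` `[a, b].
  by rewrite opp_preimage_itvbndbnd.
transitivity (\int[pushforward leb (-%R : _ -> RT)]_(x in `[a, b]) (EFin \o u) x)%E.
  by apply: eq_measure_integral => A mA _; apply/esym; exact: lebesgue_measureN.
rewrite integral_pushforward//; first by rewrite E.
  exact/measurable_EFinP.
by have := integrable_opp mu iu; rewrite E.
Qed.

Lemma Rintegral_sym (u : R -> R) (N : R) : 0 <= N -> measurable_fun setT (u : RT -> R) ->
  leb.-integrable `[- N, N] (EFin \o u) ->
  \int[leb]_(x in `[- N, N]) u x =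
  \int[leb]_(x in `[0, N]) u x + \int[leb]_(x in `[0, N]) u (- x).
Proof.
move=> N0 mu iu; rewrite (@Rintegral_itv_split _ u (- N) 0 N iu) ?oppr_le0//.
rewrite addrC; congr (_ + _); rewrite Rintegral_opp ?opprK ?oppr0//.
by apply: integrableS iu => //; apply: subset_itvl; rewrite bnd_simp.
Qed.

Lemma integrable_opp_setT (u : R -> R) : measurable_fun setT (u : RT -> R) ->
  leb.-integrable setT (EFin \o u) -> leb.-integrable setT (EFin \o (fun x => u (- x))).
Proof.
move=> mu iu.
have mu' : measurable_fun setT ((fun x => u (- x)) : RT -> R) by exact: measurableT_comp.
apply/integrableP; split; first by apply/measurable_EFinP.
have /integrableP[_] := iu; congr (_ < _)%E.
transitivity (\int[pushforward leb (-%R : _ -> RT)]_(x in setT) `|(EFin \o u) x|)%E.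
  by apply: eq_measure_integral => A mA _; apply/esym; exact: lebesgue_measureN.
rewrite ge0_integral_pushforward//.
by apply: measurableT_comp => //; apply/measurable_EFinP.
Qed.

Lemma Rintegral_opp_setT (u : R -> R) : measurable_fun setT (u : RT -> R) ->
  leb.-integrable setT (EFin \o u) ->
  \int[leb]_(x in setT) u (- x) = \int[leb]_(x in setT) u x.
Proof.
move=> mu iu; rewrite /Rintegral; congr fine; apply/esym.
transitivity (\int[pushforward leb (-%R : _ -> RT)]_(x in setT) (EFin \o u) x)%E.
  by apply: eq_measure_integral => A mA _; apply/esym; exact: lebesgue_measureN.
rewrite integral_pushforward//; first exact/measurable_EFinP.
exact: integrable_opp_setT.
Qed.

Lemma le_Rintegral_setT (u : R -> R) (D : set RT) : measurable D -> (forall x, 0 <= u x) ->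
  leb.-integrable setT (EFin \o u) ->
  \int[leb]_(x in D) u x <= \int[leb]_(x in setT) u x.
Proof.
move=> mD u0 iu; have iD : leb.-integrable D (EFin \o u) by exact: integrableS iu.
rewrite -lee_fin /Rintegral !fineK ?integrable_fin_num//.
apply: ge0_subset_integral => //; first by have /integrableP[] := iu.
by move=> x _; rewrite lee_fin.
Qed.

(** The square of a sum is at most twice the sum of the squares, and both squares have integral at
    most [e] over the line, one of them by reflection: hence the 4. *)
Lemma fold_sqr (v : R -> R) (sg : bool) (D : set RT) (e : R) : measurable D ->
  measurable_fun setT (v : RT -> R) ->
  leb.-integrable setT (EFin \o (fun x => v x ^+ 2)) ->
  \int[leb]_(x in setT) (v x ^+ 2) <= e ->
  leb.-integrable D (EFin \o (fun x => (v x + (-1) ^+ sg * v (- x)) ^+ 2)) /\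
  \int[leb]_(x in D) ((v x + (-1) ^+ sg * v (- x)) ^+ 2) <= 4 * e.
Proof.
move=> mD mv iv ve.
have mv2 : measurable_fun setT ((fun x => v x ^+ 2) : RT -> R) by exact: measurable_funX.
have mvo : measurable_fun setT ((fun x => v (- x)) : RT -> R) by exact: measurableT_comp.
have ivo := integrable_opp_setT mv2 iv.
have i1 : leb.-integrable D (EFin \o (fun x => v x ^+ 2)) by exact: integrableS iv.
have i2 : leb.-integrable D (EFin \o (fun x => v (- x) ^+ 2)) by exact: integrableS ivo.
have i3 := @integrable_EFinD _ _ _ leb _ mD _ _ i1 i2.
have i4 := @integrable_EFinZl _ _ _ leb _ mD 2 _ i3.
have le x : (v x + (-1) ^+ sg * v (- x)) ^+ 2 <= 2 * (v x ^+ 2 + v (- x) ^+ 2).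
  have := sqr_ge0 (v x - (-1) ^+ sg * v (- x)).
  have : ((-1) ^+ sg * v (- x)) ^+ 2 = v (- x) ^+ 2 by case: sg; rewrite ?expr1 ?expr0; ring.
  move: (_ * v (- x)) => y <- h; rewrite -subr_ge0.
  by have -> : 2 * (v x ^+ 2 + y ^+ 2) - (v x + y) ^+ 2 = (v x - y) ^+ 2 by ring.
have i5 : leb.-integrable D (EFin \o (fun x => (v x + (-1) ^+ sg * v (- x)) ^+ 2)).
  apply: (le_integrable _ _ _ i4) => //.
    apply/measurable_EFinP; apply: measurable_funTS; apply: measurable_funX.
    by apply: measurable_funD => //; exact: measurable_funM.
  move=> x _; rewrite lee_fin ger0_norm ?sqr_ge0//; apply: le_trans (ler_norm _).
  exact: le.
split => //; apply: le_trans (le_Rintegral _ i5 i4 _) _ => //.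
rewrite (RintegralZl _ _ i3)// (RintegralD _ i1 i2)//.
have h1 := le_Rintegral_setT mD (fun x => sqr_ge0 (v x)) iv.
have h2 := le_Rintegral_setT mD (fun x => sqr_ge0 (v (- x))) ivo.
rewrite (Rintegral_opp_setT mv2 iv) in h2.
by lra.
Qed.

End Reflection.

Section L2.
Context {R : realType}.
Local Notation leb := (@lebesgue_measure R).
Local Notation RT := (measurableTypeR R).

Lemma L2norm_bound (f : R -> R[i]) (e : R) : 0 < e ->
  measurable_fun setT ((fun x => complex.Re (f x)) : RT -> R) ->
  measurable_fun setT ((fun x => complex.Im (f x)) : RT -> R) ->
  (L2norm f < e%:E)%E ->
  [/\ leb.-integrable setT (EFin \o (fun x => complex.Re (f x) ^+ 2)),
      leb.-integrable setT (EFin \o (fun x => complex.Im (f x) ^+ 2)),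
      \int[leb]_(x in setT) (complex.Re (f x) ^+ 2) <= e ^+ 2 &
      \int[leb]_(x in setT) (complex.Im (f x) ^+ 2) <= e ^+ 2].
Proof.
move=> e0 mRe mIm fe.
pose u x := complex.Re (f x) ^+ 2 + complex.Im (f x) ^+ 2.
have mu : measurable_fun setT (u : RT -> R).
  by apply: measurable_funD; exact: measurable_funX.
have u0 x : 0 <= u x by rewrite addr_ge0 ?sqr_ge0.
have Lu : (\int[leb]_x (u x)%:E <= (e ^+ 2)%:E)%E.
  rewrite leNgt; apply/negP => h; move: fe; rewrite ltNge => /negP; apply.
  rewrite /L2norm unlock /=.
  under eq_integral => x _.
    rewrite /= powR_mulrn// real_normK ?num_real//.
    rewrite (_ : Normc.normc (f x) ^+ 2 = u x); last first.
      by rewrite /u; case: (f x) => a b /=; rewrite sqr_sqrtr// addr_ge0 ?sqr_ge0.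
    over.
  have -> : e%:E = ((e ^+ 2)%:E `^ 2^-1)%E.
    by rewrite poweR_EFin -powR_mulrn ?(ltW e0)// -powRrM divff// powRr1// ltW.
  apply: gt0_ler_poweR => //; last exact: ltW.
    by rewrite in_itv /= leey lee_fin sqr_ge0.
  by rewrite in_itv /= leey integral_ge0// => x _; rewrite lee_fin.
have iu : leb.-integrable setT (EFin \o u).
  apply/integrableP; split; first exact/measurable_EFinP.
  under eq_integral do rewrite /= ger0_norm//.
  exact: le_lt_trans Lu (ltry _).
have Ru : \int[leb]_(x in setT) u x <= e ^+ 2.
  by rewrite -lee_fin /Rintegral fineK// integrable_fin_num.
have H (v : R -> R) : measurable_fun setT (v : RT -> R) -> (forall x, v x ^+ 2 <= u x) ->
    leb.-integrable setT (EFin \o (fun x => v x ^+ 2)) /\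
    \int[leb]_(x in setT) (v x ^+ 2) <= e ^+ 2.
  move=> mv vu.
  have iv : leb.-integrable setT (EFin \o (fun x => v x ^+ 2)).
    apply: (le_integrable _ _ _ iu) => //.
      by apply/measurable_EFinP; exact: measurable_funX.
    by move=> x _; rewrite lee_fin !ger0_norm ?sqr_ge0.
  by split => //; apply: le_trans Ru; apply: le_Rintegral.
have [|i1 r1] := H _ mRe; first by move=> x; rewrite lerDl sqr_ge0.
have [|i2 r2] := H _ mIm; first by move=> x; rewrite lerDr sqr_ge0.
by split.
Qed.

Lemma integrable_of_sqr (v : R -> R) (a b : R) : measurable_fun setT (v : RT -> R) ->
  leb.-integrable setT (EFin \o (fun x => v x ^+ 2)) -> leb.-integrable `[a, b] (EFin \o v).
Proof.
move=> mv iv.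
have i1 : leb.-integrable `[a, b] (EFin \o (fun x => v x ^+ 2)) by exact: integrableS iv.
have i2 : leb.-integrable `[a, b] (EFin \o (fun=> 1 : R)).
  by apply: continuous_itv_integrable; apply: continuous_subspaceT => x; exact: cvg_cst.
have i3 := @integrable_EFinD _ _ _ leb _ (measurable_itv `[a, b]) _ _ i2 i1.
apply: (le_integrable _ _ _ i3) => //; first by apply/measurable_EFinP; exact: measurable_funTS.
move=> x _; rewrite lee_fin; apply: le_trans (ler_norm _) => /=.
rewrite -(real_normK (num_real (v x))); move: `|v x| => y.
by have := sqr_ge0 (y - 1); have := sqr_ge0 y; rewrite sqrrB1; lra.
Qed.

End L2.

(** * Uniform limits at a good point *)

Section UniformLimits.
Context {R : realType}.
Local Notation leb := (@lebesgue_measure R).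
Local Notation RT := (measurableTypeR R).

Lemma uniform_limit (u : R -> R -> R) (B : set R) :
  (forall e : R, 0 < e -> exists M, forall p N, B p -> M <= N -> `|u p M - u p N| <= e) ->
  exists V : R -> R, (forall p, B p -> u p N @[N --> +oo] --> V p) /\
    forall e : R, 0 < e -> exists M, forall p N, B p -> M <= N -> `|V p - u p N| <= e.
Proof.
move=> hu.
have cv p : B p -> cvg (u p N @[N --> +oo]).
  move=> Bp; apply: cauchy_cvg; apply: cauchy_exP => e e0.
  have [M hM] := hu (e / 2) (divr_gt0 e0 (ltr0Sn _ _)).
  exists (u p M).
  have H : \forall N \near +oo, ball (u p M) e (u p N); last exact: H.
  near=> N; apply: (@le_lt_trans _ _ (e / 2)); last by lra.
  apply: hM => //; near: N; exact: nbhs_pinfty_ge.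
exists (fun p => lim (u p N @[N --> +oo])); split=> // e e0.
have [M hM] := hu (e / 2) (divr_gt0 e0 (ltr0Sn _ _)).
exists M => p N Bp MN.
have cN : `|u p N' - u p N| @[N' --> +oo] --> `|lim (u p N @[N --> +oo]) - u p N|.
  by apply: cvg_norm; apply: cvgB; [exact: cv|exact: cvg_cst].
rewrite -(cvg_lim _ cN)//; apply: limr_le; first by apply/cvg_ex; eexists; exact: cN.
near=> N'.
have -> : u p N' - u p N = (u p M - u p N) - (u p M - u p N') by ring.
apply: le_trans (ler_normB _ _) _; rewrite [leRHS]splitr; apply: lerD; apply: hM => //.
Unshelve. all: by end_near. Qed.

(** Interchange of limits by the three-term estimate at one large [N]. *)
Lemma uniform_limit_cvg (u : R -> R -> R) (B : set R) (V u0 : R -> R) (V0 : R)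
    (Phi : set_system R) : Filter Phi ->
  (forall e : R, 0 < e -> exists M, forall p N, B p -> M <= N -> `|V p - u p N| <= e) ->
  (\forall p \near Phi, B p) -> u0 N @[N --> +oo] --> V0 ->
  (forall N, 0 < N -> u p N @[p --> Phi] --> u0 N) ->
  V p @[p --> Phi] --> V0.
Proof.
move=> FPhi hV PB hu0 hu; apply/cvgrPdist_le => e e0.
have e3 : 0 < e / 3 by rewrite divr_gt0.
have [M hM] := hV _ e3.
move/cvgrPdist_le : hu0 => /(_ _ e3) [M1 [_ hM1]].
(* [N] is positive, as the convergence at fixed [N] demands, and lies strictly beyond [M1], as
   neighbourhoods of infinity demand. *)
pose N := Num.max (Num.max M 1) (M1 + 1).
have N0 : 0 < N by rewrite !lt_max ltr01 orbT.
have MN : M <= N by rewrite !le_max lexx.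
have M1N : M1 < N by rewrite lt_max ltrDl ltr01 orbT.
move/cvgrPdist_le : (hu N N0) => /(_ _ e3) hN; near=> p.
have -> : V0 - V p = (V0 - u0 N) + (u0 N - u p N) - (V p - u p N) by ring.
apply: le_trans (ler_normB _ _) _.
have -> : e = e / 3 + e / 3 + e / 3 by field.
apply: lerD; last by apply: hM => //; near: p.
apply: le_trans (ler_normD _ _) _; apply: lerD; first exact: hM1.
by near: p.
Unshelve. all: by end_near. Qed.

Lemma tail_cauchy (k : R -> R -> R) (B : set R) (G : R -> R) :
  (forall p q, B p -> leb.-integrable `[0, q] (EFin \o (fun z => k p z * G z))) ->
  (forall e : R, 0 < e -> exists M : nat, forall N p, M.+1%:R <= N -> B p ->
    `|\int[leb]_(z in `[M.+1%:R, N]) (k p z * G z)| <= e) ->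
  forall e : R, 0 < e -> exists M, forall p N, B p -> M <= N ->
    `|\int[leb]_(z in `[0, M]) (k p z * G z) - \int[leb]_(z in `[0, N]) (k p z * G z)| <= e.
Proof.
move=> ik h e e0; have [M hM] := h e e0.
exists M.+1%:R => p N Bp MN; rewrite (Rintegral_itv_split (ik p N Bp) _ MN)//.
by rewrite opprD addrA subrr add0r normrN; exact: hM.
Qed.

(** For y > 0 the mean value theorem writes sin y / y as cos c with 0 < c < y. *)
Lemma sinc_dist (y : R) : y != 0 -> `|sin y / y - 1| <= `|y|.
Proof.
wlog y0 : y / 0 < y.
  move=> h yn; have [y0|y0|y0] := ltgtP 0 y; first exact: h.
    have := h (- y); rewrite oppr_gt0 oppr_eq0 sinN invrN mulrNN normrN.
    by move=> /(_ y0 yn).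
  by rewrite -y0 eqxx in yn.
move=> _; have cs : {within `[0, y], continuous (@sin R)}.
  by apply: continuous_subspaceT; exact: continuous_sin.
have [c] := MVT y0 (fun z _ => is_derive_sin z) cs.
rewrite in_itv /= => /andP[c0 cy]; rewrite sin0 !subr0 => ->.
rewrite mulfK ?gt_eqF// -[X in _ - X]cos0; apply: le_trans (ler_dist_cos _ _) _.
by rewrite subr0 !gtr0_norm// ltW.
Qed.

Lemma avg_limit (x ph : R) (G : R -> R) (V0 : R) :
  (forall q, leb.-integrable `[0, q] (EFin \o G)) ->
  (forall e : R, 0 < e -> exists M : nat, forall N r, M.+1%:R <= N -> 0 < r ->
    `|\int[leb]_(z in `[M.+1%:R, N]) (cos (x * z + ph) * (sin (r * z) / (r * z)) * G z)| <= e) ->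
  \int[leb]_(z in `[0, N]) (cos (x * z + ph) * G z) @[N --> +oo] --> V0 ->
  exists V : R -> R, (forall r, 0 < r ->
    \int[leb]_(z in `[0, N]) (cos (x * z + ph) * (sin (r * z) / (r * z)) * G z)
      @[N --> +oo] --> V r) /\ V r @[r --> 0^'+] --> V0.
Proof.
move=> iG tail hV0.
pose k (r z : R) : R := cos (x * z + ph) * (sin (r * z) / (r * z)).
have mc : measurable_fun setT (fun z : RT => cos (x * z + ph)).
  by apply: measurable_cosT; apply: measurable_funD => //; exact: measurable_funM.
have mk r : measurable_fun setT (k r : RT -> R).
  by apply: measurable_funM => //; exact: measurable_sinc.
have c1 z : `|cos (x * z + ph)| <= 1 by exact: norm_cos_le1.
have k1 r z : `|k r z| <= 1 by rewrite normrM mulr_ile1//; exact: sinc_le1.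
have ik r q : 0 < r -> leb.-integrable `[0, q] (EFin \o (fun z => k r z * G z)).
  move=> _; apply: (le_integrable_bounded (measurable_itv _) (iG q) _ (k1 r)).
  exact: measurable_funTS (mk r).
have [V [hV1 hV2]] := @uniform_limit _ [set r : R | 0 < r] (tail_cauchy ik tail).
exists V; split=> //; apply: (uniform_limit_cvg _ hV2 _ hV0).
  exact: nbhs_right_gt.
move=> N N0; apply/cvgrPdist_le => e e0.
pose I := \int[leb]_(z in `]0, N]) `|G z|.
have I0 : 0 <= I by apply: Rintegral_ge0 => z _.
have NI : 0 < N * I + 1 by rewrite ltr_wpDl// mulr_ge0// ltW.
have iG' : leb.-integrable `]0, N] (EFin \o G).
  by apply: integrableS (iG N) => //; apply: subset_itvr; rewrite bnd_simp.
near=> r; have r0 : 0 < r by near: r; exact: nbhs_right_gt.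
have re : r * (N * I + 1) < e.
  by rewrite -ltr_pdivlMr//; near: r; apply: nbhs_right_lt; exact: divr_gt0.
have ic : leb.-integrable `[0, N] (EFin \o (fun z => cos (x * z + ph) * G z)).
  apply: (le_integrable_bounded (measurable_itv _) (iG N) _ c1).
  exact: measurable_funTS mc.
(* The point 0 is removed: there the quotient has the value 0 and is not close to 1. *)
rewrite -!Rintegral_itv_obnd_cbnd; last 2 first.
- by apply: integrableS (ik r N r0) => //; apply: subset_itvr; rewrite bnd_simp.
- by apply: integrableS ic => //; apply: subset_itvr; rewrite bnd_simp.
apply: le_trans (_ : r * N * I <= e); last first.
  by apply: le_trans (ltW re); rewrite mulrDr mulr1 mulrA lerDl ltW.
apply: (@Rintegral_dist _ _ _ (fun z => cos (x * z + ph)) (k r)) => //.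
- exact: measurable_funTS.
- exact: measurable_funTS.
move=> z; rewrite /= in_itv /= => /andP[z0 zN].
have -> : cos (x * z + ph) - k r z = - (cos (x * z + ph) * (sin (r * z) / (r * z) - 1)).
  by rewrite /k; ring.
rewrite normrN normrM; apply: le_trans (ler_piMl _ (c1 z)) _ => //.
apply: le_trans (sinc_dist _) _; first by rewrite mulf_neq0// gt_eqF.
by rewrite normrM !gtr0_norm// ler_pM2l.
Unshelve. all: by end_near. Qed.

Lemma osc_limit (m kappa C1 C2 ph x : R) (sg : bool) (gamma : R -> R -> R) (G : R -> R) :
  1 < m -> 0 < kappa -> kappa <= 1 -> 0 < C1 -> 0 < C2 ->
  (forall x t t', t \in `[-1, 1] -> t' \in `[-1, 1] ->
    `|gamma x t - gamma x t'| <= C1 * `|t - t'| `^ kappa) ->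
  (forall t x x', t \in `[-1, 1] ->
    C2^-1 * `|x - x'| <= `|gamma x t - gamma x' t| <= C2 * `|x - x'|) ->
  (forall q, leb.-integrable `[0, q] (EFin \o G)) ->
  (forall e : R, 0 < e -> exists M : nat, forall N t, M.+1%:R <= N -> t \in `[-1, 1] ->
    `|\int[leb]_(z in `[M.+1%:R, N])
      (cos ((-1) ^+ sg * gamma x t * z + t * z `^ m + ph) * G z)| <= e) ->
  exists V : R -> R, (forall t, t \in `[-1, 1] ->
    \int[leb]_(z in `[0, N]) (cos ((-1) ^+ sg * gamma x t * z + t * z `^ m + ph) * G z)
      @[N --> +oo] --> V t) /\ V t @[t --> 0^'] --> V 0.
Proof.
move=> m1 kappa0 kappa1 C10 C20 gammat gammax iG tail.
pose k (t z : R) : R := cos ((-1) ^+ sg * gamma x t * z + t * z `^ m + ph).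
have mk t : measurable_fun setT (k t : RT -> R).
  apply: measurable_cosT; apply: measurable_funD => //; apply: measurable_funD.
    exact: measurable_funM.
  by apply: measurable_funM => //; exact: measurable_powR.
have k1 t z : `|k t z| <= 1 by exact: norm_cos_le1.
have ik t q : t \in `[-1, 1] -> leb.-integrable `[0, q] (EFin \o (fun z => k t z * G z)).
  move=> _; apply: (le_integrable_bounded (measurable_itv _) (iG q) _ (k1 t)).
  exact: measurable_funTS (mk t).
have [V [hV1 hV2]] := @uniform_limit _ [set t : R | t \in `[-1, 1]] (tail_cauchy ik tail).
have i0 : (0 : R) \in `[-1, 1] by rewrite in_itv /=; apply/andP; split; lra.
have near1 : \forall t \near (0 : R)^', t \in `[(-1 : R), 1].
  by near do rewrite in_itv /= -ler_norml; exact: dnbhs0_le.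
exists V; split=> //; apply: (uniform_limit_cvg _ hV2 near1 (hV1 _ i0)).
move=> N N0; apply/cvgrPdist_le => e e0.
have [d d0 hd] := time_modulus m1 kappa0 kappa1 C10 C20 gammat gammax iG sg ph x
  (lexx 0) (ltW N0) N0 i0 e0.
near=> t; apply/ltW/hd; first by near: t; exact: near1.
by rewrite sub0r normrN; near: t; exact: dnbhs0_lt.
Unshelve. all: by end_near. Qed.

End UniformLimits.

Lemma cvgD4 (R : realType) (T : Type) (F : set_system T) (f1 f2 f3 f4 : T -> R)
    (a1 a2 a3 a4 : R) : Filter F ->
  f1 x @[x --> F] --> a1 -> f2 x @[x --> F] --> a2 ->
  f3 x @[x --> F] --> a3 -> f4 x @[x --> F] --> a4 ->
  f1 x + f2 x + (f3 x + f4 x) @[x --> F] --> a1 + a2 + (a3 + a4).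
Proof. by move=> FF h1 h2 h3 h4; apply: cvgD; apply: cvgD. Qed.

Section Components.
Context {R : realType}.
Local Notation leb := (@lebesgue_measure R).
Local Notation RT := (measurableTypeR R).
Variables (m kappa C1 C2 : R) (gamma : R -> R -> R).
Hypothesis m1 : 1 < m.
Hypothesis kappa0 : 0 < kappa.
Hypothesis kappa1 : kappa <= 1.
Hypothesis C10 : 0 < C1.
Hypothesis C20 : 0 < C2.
Hypothesis gamma0 : forall x, gamma x 0 = x.
Hypothesis gammat : forall x t t', t \in `[-1, 1] -> t' \in `[-1, 1] ->
  `|gamma x t - gamma x t'| <= C1 * `|t - t'| `^ kappa.
Hypothesis gammax : forall t x x', t \in `[-1, 1] ->
  C2^-1 * `|x - x'| <= `|gamma x t - gamma x' t| <= C2 * `|x - x'|.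

Definition osc_tail (sg : bool) (ph : R) (G : R -> R) (x : R) : Prop :=
  forall eps : R, 0 < eps -> exists M : nat, forall N t, M.+1%:R <= N -> t \in `[-1, 1] ->
    `|\int[leb]_(z in `[M.+1%:R, N])
      (cos ((-1) ^+ sg * gamma x t * z + t * z `^ m + ph) * G z)| <= eps.

Definition avg_tail (ph : R) (G : R -> R) (x : R) : Prop :=
  forall eps : R, 0 < eps -> exists M : nat, forall N r, M.+1%:R <= N -> 0 < r ->
    `|\int[leb]_(z in `[M.+1%:R, N])
      (cos (x * z + ph) * (sin (r * z) / (r * z)) * G z)| <= eps.

(** Changing the sign of the frequency turns x z + ph into - x z + ph, whose cosine is that of x z -
    ph; hence the sign on the phase of the averages. *)
Definition good (ph : R) (G : R -> R) (x : R) : Prop := forall sg : bool,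
  osc_tail sg ph G x /\ avg_tail ((-1) ^+ sg * ph) G x.

(** At t = 0 the phase is that of the averages, because [gamma x 0 = x], and as [r] tends to 0 the
    sinc factor tends to 1: both limits are the same [V 0]. *)
Lemma branch (sg : bool) (ph x : R) (G : R -> R) :
  (forall q, leb.-integrable `[0, q] (EFin \o G)) -> good ph G x ->
  exists V W : R -> R, [/\
    forall t, t \in `[-1, 1] ->
      \int[leb]_(z in `[0, N]) (cos ((-1) ^+ sg * gamma x t * z + t * z `^ m + ph) * G z)
      @[N --> +oo] --> V t,
    V t @[t --> 0^'] --> V 0,
    forall r, 0 < r ->
      \int[leb]_(z in `[0, N]) (cos ((-1) ^+ sg * x * z + ph) * (sin (r * z) / (r * z)) * G z)
      @[N --> +oo] --> W r &
    W r @[r --> 0^'+] --> V 0].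
Proof.
move=> iG /(_ sg)[go ga].
have [V [V1 V2]] := osc_limit m1 kappa0 kappa1 C10 C20 gammat gammax iG go.
have cE z : cos ((-1) ^+ sg * x * z + ph) = cos (x * z + (-1) ^+ sg * ph).
  case: sg {go ga V1 V2}; rewrite ?expr1 ?expr0 ?mul1r//.
  by rewrite -cosN; congr cos; ring.
have i0 : (0 : R) \in `[-1, 1] by rewrite in_itv /=; apply/andP; split; lra.
have hV0 : \int[leb]_(z in `[0, N]) (cos (x * z + (-1) ^+ sg * ph) * G z) @[N --> +oo] --> V 0.
  have -> : (fun N => \int[leb]_(z in `[0, N]) (cos (x * z + (-1) ^+ sg * ph) * G z)) =
      (fun N => \int[leb]_(z in `[0, N])
        (cos ((-1) ^+ sg * gamma x 0 * z + 0 * z `^ m + ph) * G z)).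
    apply/funext => N; apply: eq_Rintegral => z _.
    by rewrite gamma0 mul0r addr0 cE.
  exact: V1.
have [W [W1 W2]] := avg_limit iG ga hV0.
exists V, W; split=> // r r0; have := W1 r r0.
by under eq_fun do under eq_Rintegral do rewrite -cE.
Qed.

(** Folds negative frequencies onto positive ones. As |z|^m is even, reflection changes the sign of
    the linear part of the phase and keeps that of the power part. *)
Lemma trunc_split (G1 G2 : R -> R) (ph1 ph2 a t N : R) : 0 <= N ->
  measurable_fun setT (G1 : RT -> R) -> measurable_fun setT (G2 : RT -> R) ->
  (forall a b, leb.-integrable `[a, b] (EFin \o G1)) ->
  (forall a b, leb.-integrable `[a, b] (EFin \o G2)) ->
  \int[leb]_(z in `[- N, N]) (cos (a * z + t * `|z| `^ m + ph1) * G1 z +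
                              cos (a * z + t * `|z| `^ m + ph2) * G2 z) =
  \int[leb]_(z in `[0, N]) (cos ((-1) ^+ false * a * z + t * z `^ m + ph1) * G1 z) +
  \int[leb]_(z in `[0, N]) (cos ((-1) ^+ false * a * z + t * z `^ m + ph2) * G2 z) +
  (\int[leb]_(z in `[0, N]) (cos ((-1) ^+ true * a * z + t * z `^ m + ph1) * G1 (- z)) +
   \int[leb]_(z in `[0, N]) (cos ((-1) ^+ true * a * z + t * z `^ m + ph2) * G2 (- z))).
Proof.
move=> N0 mG1 mG2 iG1 iG2.
have mph (a' ph : R) : measurable_fun setT (fun z : RT => cos (a' * z + t * `|z| `^ m + ph)).
  apply: measurable_cosT; apply: measurable_funD => //; apply: measurable_funD.
    exact: measurable_funM.
  apply: measurable_funM => //; apply: (measurableT_comp (measurable_powR m)).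
  exact: normr_measurable.
have c1 (y : R) : `|cos y| <= 1 by exact: norm_cos_le1.
pose u ph (G : R -> R) z := cos (a * z + t * `|z| `^ m + ph) * G z.
have mu ph (G : R -> R) : measurable_fun setT (G : RT -> R) -> measurable_fun setT (u ph G : RT -> R).
  by move=> mG; apply: measurable_funM.
have iu ph (G : R -> R) : (forall a b, leb.-integrable `[a, b] (EFin \o G)) ->
    leb.-integrable `[- N, N] (EFin \o u ph G).
  move=> iG; apply: (le_integrable_bounded (measurable_itv _) (iG _ _) _ (fun z => c1 _)).
  exact: measurable_funTS (mph _ _).
have half ph (G : R -> R) : measurable_fun setT (G : RT -> R) ->
    (forall a b, leb.-integrable `[a, b] (EFin \o G)) ->
    \int[leb]_(z in `[- N, N]) u ph G z =
    \int[leb]_(z in `[0, N]) (cos ((-1) ^+ false * a * z + t * z `^ m + ph) * G z) +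
    \int[leb]_(z in `[0, N]) (cos ((-1) ^+ true * a * z + t * z `^ m + ph) * G (- z)).
  move=> mG iG; rewrite (Rintegral_sym N0 (mu ph G mG) (iu ph G iG)).
  have u1 (z : R) : z \in `[0, N]%classic ->
      u ph G z = cos ((-1) ^+ false * a * z + t * z `^ m + ph) * G z.
    by rewrite inE /= in_itv /= => /andP[z0 _]; rewrite /u ger0_norm// expr0 mul1r.
  have u2 (z : R) : z \in `[0, N]%classic ->
      u ph G (- z) = cos ((-1) ^+ true * a * z + t * z `^ m + ph) * G (- z).
    rewrite inE /= in_itv /= => /andP[z0 _].
    by rewrite /u normrN ger0_norm// expr1 mulrN !mulNr mul1r.
  under eq_Rintegral => z zN do rewrite (u1 z zN).
  by under [X in _ + X = _]eq_Rintegral => z zN do rewrite (u2 z zN).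
rewrite (RintegralD _ (iu ph1 G1 iG1) (iu ph2 G2 iG2))// !half//.
by rewrite addrACA.
Qed.

Lemma cvg_Rintegral_half (u : R -> R) : leb.-integrable `]0, +oo[ (EFin \o u) ->
  (\int[leb]_(z in `]0, n%:R]) u z) @[n --> \oo] --> \int[leb]_(z in `]0, +oo[) u z.
Proof.
move=> iu; have /integrableP[/measurable_EFinP mu _] := iu.
have -> : (fun n : nat => \int[leb]_(z in `]0, n%:R]) u z) =
  (fun n => \int[leb]_(z in `]0, +oo[) ((u \_ `]0, n%:R]) z)).
  apply/funext => n; rewrite -Rintegral_mkcondr setIidr//.
  by apply: subset_itvl; rewrite bnd_simp.
apply: (cvg_Rintegral_dominated _ _ _ _ (integrable_norm iu)) => //.
- move=> n; apply/(measurable_restrict u) => //.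
  by apply: measurable_funS mu => //; exact: subIsetl.
- rewrite [X in leb.-negligible X](_ : _ = set0); first exact: negligible_set0.
  rewrite -subset0 => z /= []; rewrite in_itv /= andbT => z0; apply.
  apply: (@cvg_trans _ ((fun n : nat => u z) @ \oo)); last exact: cvg_cst.
  apply: near_eq_cvg; near=> n; rewrite patchE mem_set//= in_itv /= z0 /=.
  by near: n; exact: nbhs_infty_ger.
- by move=> n z _; rewrite patchE /=; case: ifPn => // _; rewrite normr0.
Unshelve. all: by end_near. Qed.

(** Evolution and averages are sums of the same four branches, two functions times two signs of the
    frequency; the identity for [E] and [O] says so for the averages. Since each branch has a common
    limit at t = 0 and r = 0, so has the sum. *)
Lemma component (G1 G2 E O phi : R -> R) (ph1 ph2 x : R) :
  measurable_fun setT (G1 : RT -> R) -> measurable_fun setT (G2 : RT -> R) ->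
  (forall a b, leb.-integrable `[a, b] (EFin \o G1)) ->
  (forall a b, leb.-integrable `[a, b] (EFin \o G2)) ->
  good ph1 G1 x -> good ph2 G2 x ->
  good ph1 (fun z => G1 (- z)) x -> good ph2 (fun z => G2 (- z)) x ->
  (forall z, E z * cos (x * z) - O z * sin (x * z) =
    cos (x * z + ph1) * G1 z + cos (x * z + ph2) * G2 z +
    (cos (- (x * z) + ph1) * G1 (- z) + cos (- (x * z) + ph2) * G2 (- z))) ->
  (forall r, 0 < r -> leb.-integrable `]0, +oo[ (EFin \o window x r E O) /\
    \int[leb]_(xi in `]0, +oo[) window x r E O xi = pi * \int[leb]_(y in ball x r) phi y) ->
  exists V : R -> R, [/\
    forall t, t \in `[-1, 1] -> (2 * pi)^-1 *
      \int[leb]_(z in `[- N, N]) (cos (gamma x t * z + t * `|z| `^ m + ph1) * G1 z +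
                                  cos (gamma x t * z + t * `|z| `^ m + ph2) * G2 z)
      @[N --> +oo] --> V t,
    V t @[t --> 0^'] --> V 0 &
    (2 * r)^-1 * \int[leb]_(y in ball x r) phi y @[r --> 0^'+] --> V 0].
Proof.
move=> mG1 mG2 iG1 iG2 g1 g2 g1o g2o EO hw.
have iopp (G : R -> R) : measurable_fun setT (G : RT -> R) ->
    (forall a b, leb.-integrable `[a, b] (EFin \o G)) ->
    forall N, leb.-integrable `[0, N] (EFin \o (fun z => G (- z))).
  by move=> mG iG N; have := integrable_opp mG (iG (- N) (- 0)); rewrite !opprK.
have [V1 [W1 [A1 B1 D1 E1]]] := branch false (iG1 0) g1.
have [V2 [W2 [A2 B2 D2 E2]]] := branch false (iG2 0) g2.
have [V3 [W3 [A3 B3 D3 E3]]] := branch true (iopp _ mG1 iG1) g1o.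
have [V4 [W4 [A4 B4 D4 E4]]] := branch true (iopp _ mG2 iG2) g2o.
(* On ]0, n] the window integral is [r] times the sum of the four branches. In the limit [r] times
   the sum of the [W] equals pi times the integral of [phi] over the ball, and division by 2 pi r
   gives the mean. *)
have hW r : 0 < r -> (2 * pi)^-1 * (W1 r + W2 r + (W3 r + W4 r)) =
    (2 * r)^-1 * \int[leb]_(y in ball x r) phi y.
  move=> r0; have [iw wE] := hw r r0.
  have h := cvgD4 _ (D1 r r0) (D2 r r0) (D3 r r0) (D4 r r0).
  have hn : (n%:R : R) @[n --> \oo] --> +oo by exact: cvgr_idn.
  have {}h := cvg_comp _ _ hn (h _).
  have ic (sg : bool) ph (G : R -> R) N : (forall N, leb.-integrable `[0, N] (EFin \o G)) ->
    leb.-integrable `[0, N] (EFin \o (fun z =>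
      cos ((-1) ^+ sg * x * z + ph) * (sin (r * z) / (r * z)) * G z)).
    move=> iG; apply: le_integrable_bounded => //.
    - apply: measurable_funTS; apply: measurable_funM.
        apply: measurable_cosT; apply: measurable_funD => //.
      exact: measurable_sinc.
    - move=> z; rewrite normrM mulr_ile1//; last exact: sinc_le1.
      exact: norm_cos_le1.
  have i1 N := ic false ph1 G1 N (iG1 0).
  have i2 N := ic false ph2 G2 N (iG2 0).
  have i3 N := ic true ph1 _ N (iopp _ mG1 iG1).
  have i4 N := ic true ph2 _ N (iopp _ mG2 iG2).
  have i12 N := @integrable_EFinD _ _ _ leb _ (measurable_itv `[0, N]) _ _ (i1 N) (i2 N).
  have i34 N := @integrable_EFinD _ _ _ leb _ (measurable_itv `[0, N]) _ _ (i3 N) (i4 N).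
  have i0 N := @integrable_EFinD _ _ _ leb _ (measurable_itv `[0, N]) _ _ (i12 N) (i34 N).
  have sum N : \int[leb]_(z in `]0, N]) window x r E O z =
    r * (\int[leb]_(z in `[0, N]) (cos ((-1) ^+ false * x * z + ph1) * (sin (r * z) / (r * z)) * G1 z) +
    \int[leb]_(z in `[0, N]) (cos ((-1) ^+ false * x * z + ph2) * (sin (r * z) / (r * z)) * G2 z) +
    (\int[leb]_(z in `[0, N]) (cos ((-1) ^+ true * x * z + ph1) * (sin (r * z) / (r * z)) * G1 (- z)) +
     \int[leb]_(z in `[0, N]) (cos ((-1) ^+ true * x * z + ph2) * (sin (r * z) / (r * z)) * G2 (- z)))).
    rewrite -(RintegralD _ (i1 N) (i2 N))// -(RintegralD _ (i3 N) (i4 N))//.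
    rewrite -(RintegralD _ (i12 N) (i34 N))// -(RintegralZl _ _ (i0 N))//.
    have i5 := @integrable_EFinZl _ _ _ leb _ (measurable_itv `[0, N]) r _ (i0 N).
    rewrite -Rintegral_itv_obnd_cbnd; last first.
      by apply: integrableS i5 => //; apply: subset_itvr; rewrite bnd_simp.
    apply: eq_Rintegral => z; rewrite inE /= in_itv /= => /andP[z0 _].
    rewrite /window EO expr0 expr1 mul1r mulN1r mulNr.
    by field; rewrite !gt_eqF.
  have hw2 := cvg_Rintegral_half iw; rewrite wE in hw2.
  have {}h : \int[leb]_(z in `]0, n%:R]) window x r E O z @[n --> \oo] -->
    r * (W1 r + W2 r + (W3 r + W4 r)).
    under eq_fun do rewrite sum.
    by apply: cvgMr; exact: h.
  have W : r * (W1 r + W2 r + (W3 r + W4 r)) = pi * \int[leb]_(y in ball x r) phi y.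
    by rewrite -(cvg_lim _ h)// (cvg_lim _ hw2).
  have -> : \int[leb]_(y in ball x r) phi y = r * (W1 r + W2 r + (W3 r + W4 r)) / pi.
    by rewrite W mulrC mulKf// gt_eqF// pi_gt0.
  have pi0 : pi != 0 :> R by rewrite gt_eqF// pi_gt0.
  move: pi0; move: (pi : R) (W1 r + W2 r + _) => p T p0.
  by field; rewrite p0 gt_eqF.
exists (fun t => (2 * pi)^-1 * (V1 t + V2 t + (V3 t + V4 t))); split.
- move=> t t1; apply: cvgMr.
  have h := cvgD4 _ (A1 t t1) (A2 t t1) (A3 t t1) (A4 t t1).
  apply: cvg_trans (h _).
  apply: near_eq_cvg; near=> N.
  by rewrite trunc_split//; near: N; exact: nbhs_pinfty_ge.
- by apply: cvgMr; apply: cvgD; apply: cvgD.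
- apply: (@cvg_trans _ ((fun r => (2 * pi)^-1 * (W1 r + W2 r + (W3 r + W4 r))) @ 0^'+)).
    by apply: near_eq_cvg; near=> r; apply/hW; near: r; exact: nbhs_right_gt.
  by apply: cvgMr; apply: cvgD; apply: cvgD.
Unshelve. all: by end_near. Qed.

End Components.

Local Open Scope complex_scope.

(** * Complex functions and their Fourier transforms, by components *)

Section Complex.
Context {R : realType}.
Local Notation leb := (@lebesgue_measure R).
Local Notation RT := (measurableTypeR R).

Lemma ReZ (a : R) (z : R[i]) : complex.Re (a%:C * z) = a * complex.Re z.
Proof. by case: z => x y /=; rewrite mul0r subr0. Qed.

Lemma ImZ (a : R) (z : R[i]) : complex.Im (a%:C * z) = a * complex.Im z.
Proof. by case: z => x y /=; rewrite mul0r addr0. Qed.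

Lemma Re_expi (th : R) (z : R[i]) :
  complex.Re (expi th * z) = cos th * complex.Re z - sin th * complex.Im z.
Proof. by case: z. Qed.

Lemma Im_expi (th : R) (z : R[i]) :
  complex.Im (expi th * z) = sin th * complex.Re z + cos th * complex.Im z.
Proof. by case: z => x y /=; rewrite addrC. Qed.

Lemma ReB (y z : R[i]) : complex.Re (y - z) = complex.Re y - complex.Re z.
Proof. by case: y z => a b [c d]. Qed.

Lemma ImB (y z : R[i]) : complex.Im (y - z) = complex.Im y - complex.Im z.
Proof. by case: y z => a b [c d]. Qed.

Lemma cvg_complex (T : Type) (Phi : set_system T) (u : T -> R[i]) (a b : R) :
  Filter Phi -> complex.Re (u x) @[x --> Phi] --> a -> complex.Im (u x) @[x --> Phi] --> b ->
  (u x : R[i]^o) @[x --> Phi] --> (a +i* b : R[i]^o).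
Proof.
move=> FPhi ha hb; apply/cvgrPdist_lt => e.
case: e => e e'; rewrite ltcE /= => /andP[/eqP e'0 e0].
have e2 : 0 < e / 2 by rewrite divr_gt0.
move/cvgrPdist_lt : ha => /(_ _ e2) ha; move/cvgrPdist_lt : hb => /(_ _ e2) hb.
near=> x.
have hx : `|a - complex.Re (u x)| < e / 2 by near: x.
have hy : `|b - complex.Im (u x)| < e / 2 by near: x.
case: (u x) hx hy => c d /= hx hy.
rewrite ltcE /= e'0 eqxx /=.
apply: (@le_lt_trans _ _ (`|a - c| + `|b - d|)); last by lra.
rewrite -[leRHS]ger0_norm ?addr_ge0// -sqrtr_sqr ler_sqrt ?sqr_ge0//.
rewrite -(real_normK (num_real (a - c))) -(real_normK (num_real (b - d))).
by rewrite sqrrD addrAC lerDl mulrn_wge0// mulr_ge0.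
Unshelve. all: by end_near. Qed.

Lemma fourier_approx (f F : R -> R[i]) : is_fourier f F -> forall e A0 : R, 0 < e ->
  exists2 A, A0 <= A &
  [/\ leb.-integrable setT (EFin \o (fun xi => (
        \int[leb]_(x in `[- A, A]) (cos (x * xi) * complex.Re (f x)) +
        \int[leb]_(x in `[- A, A]) (sin (x * xi) * complex.Im (f x)) - complex.Re (F xi)) ^+ 2)),
      leb.-integrable setT (EFin \o (fun xi => (
        \int[leb]_(x in `[- A, A]) (cos (x * xi) * complex.Im (f x)) -
        \int[leb]_(x in `[- A, A]) (sin (x * xi) * complex.Re (f x)) - complex.Im (F xi)) ^+ 2)),
      \int[leb]_(xi in setT) ((
        \int[leb]_(x in `[- A, A]) (cos (x * xi) * complex.Re (f x)) +
        \int[leb]_(x in `[- A, A]) (sin (x * xi) * complex.Im (f x)) - complex.Re (F xi)) ^+ 2) <= e &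
      \int[leb]_(xi in setT) ((
        \int[leb]_(x in `[- A, A]) (cos (x * xi) * complex.Im (f x)) -
        \int[leb]_(x in `[- A, A]) (sin (x * xi) * complex.Re (f x)) - complex.Im (F xi)) ^+ 2) <= e].
Proof.
move=> [[mf1 mf2 fL2] [mF1 mF2 _] hlim] e A0 e0.
have L2fin : exists2 M, 0 < M & (L2norm f < M%:E)%E.
  have L0 : (0 <= L2norm f)%E by exact: Lnorm_ge0.
  exists (fine (L2norm f) + 1); first by rewrite ltr_wpDl// fine_ge0.
  have fin : L2norm f \is a fin_num by rewrite ge0_fin_numE.
  by rewrite EFinD fineK// lteDl// lte_fin ltr01.
have [M M0 fM] := L2fin; have [if1 if2 _ _] := L2norm_bound M0 mf1 mf2 fM.
have i1 a b := integrable_of_sqr a b mf1 if1.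
have i2 a b := integrable_of_sqr a b mf2 if2.
(* With d <= 1 and d <= e also d^2 <= e, and d^2 is what [L2norm_bound] returns. *)
pose d := Num.min 1 e.
have d0 : 0 < d by rewrite lt_min ltr01.
have de : d ^+ 2 <= e.
  rewrite expr2; apply: (@le_trans _ _ (d * 1)); first by rewrite ler_pM2l// ge_min lexx.
  by rewrite mulr1 ge_min lexx orbT.
pose U (A xi : R) : R[i] := cintegral `[- A, A] (fun x => expi (- (x * xi)) * f x) - F xi.
have : \forall A \near +oo, (L2norm (U A) < d%:E)%E.
  have := hlim [set y | (y < d%:E)%E]; apply.
  exact: open_ereal_lt_ereal.
move=> [A1 [_ hA1]]; exists (Num.max A0 (A1 + 1)); first by rewrite le_max lexx.
set A := Num.max _ _.
have {}hA1 : (L2norm (U A) < d%:E)%E.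
  by apply: hA1; rewrite lt_max ltrDl ltr01 orbT.
have c1 (y : R) : `|cos y| <= 1 by exact: norm_cos_le1.
have s1 (y : R) : `|sin y| <= 1 by exact: norm_sin_le1.
have mxl xi : measurable_fun `[- A, A] (fun x : RT => x * xi).
  by apply: measurable_funTS; exact: measurable_funM.
have ic (phi : R -> R) xi : leb.-integrable `[- A, A] (EFin \o phi) ->
    leb.-integrable `[- A, A] (EFin \o (fun x => cos (x * xi) * phi x)).
  move=> h; apply: (le_integrable_bounded (measurable_itv _) h _ (fun x => c1 (x * xi))).
  by apply: measurable_funTS; apply: measurable_cosT; exact: measurable_funM.
have is_ (phi : R -> R) xi : leb.-integrable `[- A, A] (EFin \o phi) ->
    leb.-integrable `[- A, A] (EFin \o (fun x => sin (x * xi) * phi x)).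
  move=> h; apply: (le_integrable_bounded (measurable_itv _) h _ (fun x => s1 (x * xi))).
  by apply: measurable_funTS; apply: measurable_sinT; exact: measurable_funM.
have ReE xi : complex.Re (U A xi) =
    \int[leb]_(x in `[- A, A]) (cos (x * xi) * complex.Re (f x)) +
    \int[leb]_(x in `[- A, A]) (sin (x * xi) * complex.Im (f x)) - complex.Re (F xi).
  rewrite ReB /=; congr (_ - _).
  under eq_Rintegral do rewrite Re_expi cosN sinN mulNr opprK.
  by rewrite (RintegralD _ (ic _ xi (i1 _ _)) (is_ _ xi (i2 _ _))).
have ImE xi : complex.Im (U A xi) =
    \int[leb]_(x in `[- A, A]) (cos (x * xi) * complex.Im (f x)) -
    \int[leb]_(x in `[- A, A]) (sin (x * xi) * complex.Re (f x)) - complex.Im (F xi).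
  rewrite ImB /=; congr (_ - _).
  under eq_Rintegral do rewrite Im_expi cosN sinN mulNr addrC.
  by rewrite (RintegralB _ (ic _ xi (i2 _ _)) (is_ _ xi (i1 _ _))).
have mRe : measurable_fun setT ((fun xi => complex.Re (U A xi)) : RT -> R).
  under eq_fun do rewrite ReE.
  apply: measurable_funB => //; apply: measurable_funD.
    exact: measurable_cos_Rintegral.
  exact: measurable_sin_Rintegral.
have mIm : measurable_fun setT ((fun xi => complex.Im (U A xi)) : RT -> R).
  under eq_fun do rewrite ImE.
  apply: measurable_funB => //; apply: measurable_funB.
    exact: measurable_cos_Rintegral.
  exact: measurable_sin_Rintegral.
have [] := L2norm_bound d0 mRe mIm hA1.
under [X in is_true (_ (EFin \o X)) -> _]eq_fun do rewrite ReE.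
under [X in _ -> is_true (_ (EFin \o X)) -> _]eq_fun do rewrite ImE.
under eq_Rintegral do rewrite ReE.
move=> h1 h2 h3; under eq_Rintegral do rewrite ImE.
move=> h4; split => //; [exact: le_trans de|exact: le_trans de].
Qed.

End Complex.

Section FourierPair.
Context {R : realType}.
Local Notation leb := (@lebesgue_measure R).
Local Notation RT := (measurableTypeR R).

Definition window_approx (phi E O : R -> R) (e A N : R) : Prop :=
  [/\ leb.-integrable `]0, N] (EFin \o (fun xi => (E xi - Ecos phi A xi) ^+ 2)),
      leb.-integrable `]0, N] (EFin \o (fun xi => (O xi - Osin phi A xi) ^+ 2)),
      \int[leb]_(xi in `]0, N]) ((E xi - Ecos phi A xi) ^+ 2) <= e &
      \int[leb]_(xi in `]0, N]) ((O xi - Osin phi A xi) ^+ 2) <= e].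

Lemma inL2_component (f : R -> R[i]) : inL2 f ->
  exists2 S : R, 0 <= S &
  [/\ leb.-integrable setT (EFin \o (fun x => complex.Re (f x) ^+ 2)),
      leb.-integrable setT (EFin \o (fun x => complex.Im (f x) ^+ 2)),
      \int[leb]_(x in setT) (complex.Re (f x) ^+ 2) <= S &
      \int[leb]_(x in setT) (complex.Im (f x) ^+ 2) <= S].
Proof.
move=> [m1 m2 fL2].
have L0 : (0 <= L2norm f)%E by exact: Lnorm_ge0.
have fin : L2norm f \is a fin_num by rewrite ge0_fin_numE.
have M0 : 0 < fine (L2norm f) + 1 by rewrite ltr_wpDl// fine_ge0.
exists ((fine (L2norm f) + 1) ^+ 2); first exact: sqr_ge0.
apply: L2norm_bound => //.
by rewrite EFinD fineK// lteDl// lte_fin ltr01.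
Qed.

Lemma Rintegral_cos_opp (phi : R -> R) (A xi : R) :
  \int[leb]_(x in `[- A, A]) (cos (x * - xi) * phi x) =
  \int[leb]_(x in `[- A, A]) (cos (x * xi) * phi x).
Proof. by apply: eq_Rintegral => x _; rewrite mulrN cosN. Qed.

Lemma Rintegral_sin_opp (phi : R -> R) (A xi : R) : leb.-integrable `[- A, A] (EFin \o phi) ->
  \int[leb]_(x in `[- A, A]) (sin (x * - xi) * phi x) =
  - \int[leb]_(x in `[- A, A]) (sin (x * xi) * phi x).
Proof.
move=> iphi; rewrite -RintegralN_itv; first last.
  apply: (le_integrable_bounded (measurable_itv _) iphi) => [|x].
    by apply: measurable_funTS; apply: measurable_sinT; exact: measurable_funM.
  exact: norm_sin_le1.
by apply: eq_Rintegral => x _; rewrite mulrN sinN mulNr.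
Qed.

(** [Im f] is the real part of - i f, whose transform is - i F: this replaces Re F by Im F and Im F
    by - Re F, hence the second pair. Up to sign the errors are those of [fourier_approx] added to
    or subtracted from their reflections, and [fold_sqr] costs the factor 4 prepared for by e /
    4. *)
Lemma fourier_window_approx (f F : R -> R[i]) : is_fourier f F -> forall e A0 : R, 0 < e ->
  exists2 A, A0 <= A & forall N,
    window_approx (fun x => complex.Re (f x))
      (fun xi => complex.Re (F xi) + complex.Re (F (- xi)))
      (fun xi => complex.Im (F xi) - complex.Im (F (- xi))) e A N /\
    window_approx (fun x => complex.Im (f x))
      (fun xi => complex.Im (F xi) + complex.Im (F (- xi)))
      (fun xi => complex.Re (F (- xi)) - complex.Re (F xi)) e A N.
Proof.
move=> fF e A0 e0; have e4 : 0 < e / 4 by rewrite divr_gt0.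
have [A hA [iv iw ve we]] := fourier_approx fF A0 e4.
exists A => // N; case: fF => fL2 [mF1 mF2 _] _.
have [mf1 mf2 _] := fL2; have [S _ [if1 if2 _ _]] := inL2_component fL2.
have i1 := integrable_of_sqr (- A) A mf1 if1.
have i2 := integrable_of_sqr (- A) A mf2 if2.
pose v' xi := \int[leb]_(x in `[- A, A]) (cos (x * xi) * complex.Re (f x)) +
        \int[leb]_(x in `[- A, A]) (sin (x * xi) * complex.Im (f x)) - complex.Re (F xi).
pose w' xi := \int[leb]_(x in `[- A, A]) (cos (x * xi) * complex.Im (f x)) -
        \int[leb]_(x in `[- A, A]) (sin (x * xi) * complex.Re (f x)) - complex.Im (F xi).
have mv : measurable_fun setT (v' : RT -> R).
  apply: measurable_funB => //; apply: measurable_funD.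
    exact: measurable_cos_Rintegral.
  exact: measurable_sin_Rintegral.
have mw : measurable_fun setT (w' : RT -> R).
  apply: measurable_funB => //; apply: measurable_funB.
    exact: measurable_cos_Rintegral.
  exact: measurable_sin_Rintegral.
have e44 : 4 * (e / 4) = e by field.
have sqrE (u1 u2 : R -> R) : u1 =1 u2 \/ u1 =1 (fun x => - u2 x) ->
  leb.-integrable `]0, N] (EFin \o (fun x => u2 x ^+ 2)) /\
  \int[leb]_(x in `]0, N]) (u2 x ^+ 2) <= 4 * (e / 4) ->
  leb.-integrable `]0, N] (EFin \o (fun x => u1 x ^+ 2)) /\
  \int[leb]_(x in `]0, N]) (u1 x ^+ 2) <= e.
  move=> h; rewrite e44.
  have -> // : (fun x => u1 x ^+ 2) = (fun x => u2 x ^+ 2).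
  by apply/funext => x; case: h => ->//; rewrite sqrrN.
split.
- have [] := sqrE (fun xi => complex.Re (F xi) + complex.Re (F (- xi)) -
      Ecos (fun x => complex.Re (f x)) A xi) _ _ (fold_sqr false (measurable_itv `]0, N]) mv iv ve).
    right=> xi; rewrite expr0 mul1r /v' /Ecos Rintegral_cos_opp Rintegral_sin_opp//.
    by ring.
  have [] := sqrE (fun xi => complex.Im (F xi) - complex.Im (F (- xi)) -
      Osin (fun x => complex.Re (f x)) A xi) _ _ (fold_sqr true (measurable_itv `]0, N]) mw iw we).
    right=> xi; rewrite expr1 mulN1r /w' /Osin Rintegral_cos_opp Rintegral_sin_opp//.
    by ring.
  by move=> h1 h2 h3 h4; split.
- have [] := sqrE (fun xi => complex.Im (F xi) + complex.Im (F (- xi)) -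
      Ecos (fun x => complex.Im (f x)) A xi) _ _ (fold_sqr false (measurable_itv `]0, N]) mw iw we).
    right=> xi; rewrite expr0 mul1r /w' /Ecos Rintegral_cos_opp Rintegral_sin_opp//.
    by ring.
  have [] := sqrE (fun xi => complex.Re (F (- xi)) - complex.Re (F xi) -
      Osin (fun x => complex.Im (f x)) A xi) _ _ (fold_sqr true (measurable_itv `]0, N]) mv iv ve).
    left=> xi; rewrite expr1 mulN1r /v' /Osin Rintegral_cos_opp Rintegral_sin_opp//.
    by ring.
  by move=> h1 h2 h3 h4; split.
Qed.

(** From z^(2 s) <= (1 + z^2)^s for z >= 1: the Sobolev norm controls the weighted integral in the
    form used by TT*. *)
Lemma halfline (G : R -> R) (s S : R) : measurable_fun setT (G : RT -> R) -> 0 < s ->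
  leb.-integrable setT (EFin \o (fun z => ((1 + z ^+ 2) `^ (s / 2) * G z) ^+ 2)) ->
  \int[leb]_(z in setT) (((1 + z ^+ 2) `^ (s / 2) * G z) ^+ 2) <= S ->
  (forall q, leb.-integrable `[1, q] (EFin \o (fun z => G z ^+ 2 * z `^ (2 * s)))) /\
  (forall q, \int[leb]_(z in `[1, q]) (G z ^+ 2 * z `^ (2 * s)) <= S).
Proof.
move=> mG s0 iG GS.
have le z : 1 <= z -> G z ^+ 2 * z `^ (2 * s) <= ((1 + z ^+ 2) `^ (s / 2) * G z) ^+ 2.
  move=> z1; have z0 : 0 <= z by rewrite (le_trans ler01).
  rewrite exprMn mulrC ler_wpM2r ?sqr_ge0//.
  have -> : ((1 + z ^+ 2) `^ (s / 2)) ^+ 2 = (1 + z ^+ 2) `^ s.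
    by rewrite -powR_mulrn ?powR_ge0// -powRrM divfK.
  have -> : z `^ (2 * s) = (z ^+ 2) `^ s by rewrite -powR_mulrn// -powRrM.
  by rewrite ge0_ler_powR ?nnegrE ?(ltW s0) ?addr_ge0 ?sqr_ge0// lerDr.
have i1 q : leb.-integrable `[1, q] (EFin \o (fun z => ((1 + z ^+ 2) `^ (s / 2) * G z) ^+ 2)).
  exact: integrableS iG.
have i2 q : leb.-integrable `[1, q] (EFin \o (fun z => G z ^+ 2 * z `^ (2 * s))).
  apply: (le_integrable _ _ _ (i1 q)) => //.
    apply/measurable_EFinP; apply: measurable_funTS; apply: measurable_funM.
      exact: measurable_funX.
    exact: measurable_powR.
  move=> z; rewrite /= in_itv /= => /andP[z1 _].
  by rewrite lee_fin !ger0_norm ?sqr_ge0 ?le// mulr_ge0 ?sqr_ge0 ?powR_ge0.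
split=> // q; apply: le_trans GS.
apply: le_trans (le_Rintegral_setT (measurable_itv `[1, q]) (fun z => sqr_ge0 _) iG).
by apply: le_Rintegral => // z; rewrite /= in_itv /= => /andP[z1 _]; exact: le.
Qed.

End FourierPair.

(** * Points at which all tails are uniformly small *)

Section AeGood.
Context {R : realType}.
Local Notation leb := (@lebesgue_measure R).
Local Notation RT := (measurableTypeR R).

(* The phases [k pi / 2] turn a cosine into the cosines and sines of both signs. *)
Lemma ae_good (mu : {measure set RT -> \bar R}) (c al m kappa s be : R)
    (gamma : R -> R -> R) (C1 C2 : R) (G : R -> R) (S : R) :
  (forall x r : R, 0 < r -> (mu (ball x r) <= (c * r `^ al)%:E)%E) ->
  1 < m -> 0 < kappa -> kappa <= 1 -> 0 < s -> 0 < 2 * s + be - 1 ->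
  0 < be -> be <= 1 / 2 -> be < al -> be / (kappa * m) < al -> 0 < C1 -> 0 < C2 ->
  (forall x t t', t \in `[-1, 1] -> t' \in `[-1, 1] ->
    `|gamma x t - gamma x t'| <= C1 * `|t - t'| `^ kappa) ->
  (forall t x x', t \in `[-1, 1] ->
    C2^-1 * `|x - x'| <= `|gamma x t - gamma x' t| <= C2 * `|x - x'|) ->
  measurable_fun setT (G : RT -> R) ->
  leb.-integrable setT (EFin \o (fun z => G z ^+ 2)) ->
  leb.-integrable setT (EFin \o (fun z => ((1 + z ^+ 2) `^ (s / 2) * G z) ^+ 2)) ->
  \int[leb]_(z in setT) (((1 + z ^+ 2) `^ (s / 2) * G z) ^+ 2) <= S ->
  {ae mu, forall x : R, forall k : nat, good m gamma (k%:R * (pi / 2)) G x}.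
Proof.
move=> hmu m1 k0 k1 s0 eta be0 be2 beal bekal C10 C20 gt gx mG iG iGs GsS.
have iG0 q : leb.-integrable `[0, q] (EFin \o G) by exact: integrable_of_sqr.
have [iGw GwS] := halfline mG s0 iGs GsS.
pose ph (k : nat) : R := k%:R * (pi / 2).
have hm sg k := ae_max hmu m1 k0 k1 s0 eta be0 be2 beal bekal C10 C20 gt gx iG0 iGw GwS sg (ph k).
have ha (sg : bool) k := ae_average hmu m1 s0 eta be0 be2 beal iG0 iGw GwS ((-1) ^+ sg * ph k).
have H := negligible_bigcup (fun k => negligibleU (negligibleU (hm true k) (hm false k))
  (negligibleU (ha true k) (ha false k))).
apply: (negligibleS _ H) => x /= /existsNP[k hk]; exists k => //=.
move: hk; rewrite /good => /existsNP[sg] /not_andP[h|h]; [left|right];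
  by case: sg h => h; [left|right].
Qed.

End AeGood.

Local Notation leb := lebesgue_measure.

Theorem theorem1 (R : realType) (m kappa alpha s : R)
    (mu : {measure set (measurableTypeR R) -> \bar R}) (gamma : R -> R -> R)
    (hm : 1 < m) (hkappa0 : 0 < kappa) (hkappa1 : kappa <= 1)
    (halpha0 : 0 < alpha) (halpha1 : alpha <= 1)
    (hmu : alpha_dimensional alpha mu) (hgamma : Gamma kappa gamma)
    (hs : Num.max (1 / 4)
            (Num.max ((1 - alpha) / 2) ((1 - m * alpha * kappa) / 2)) < s)
    (f : R -> R[i]) (hf : sobolev s f) :
  {ae mu, forall x : R, exists l : R[i],
    [/\ has_value f x l,
        \forall t \near 0^', evolution_defined m f t (gamma x t) &
        (evolution m f t (gamma x t) : R[i]^o) @[t --> 0^'] --> (l : R[i]^o)]}.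
Proof.
have [c hc] := hmu.
have [_ gamma0 [C1 C10 gt] [C2 C20 gx]] := hgamma.
move: hs; rewrite !gt_max => /andP[s4 /andP[sa sk]].
(* Any [be] strictly between max (0, 1 - 2 s) and min (1 / 2, alpha, alpha kappa m) will do; the
   midpoint is taken. The three bounds on [s] put 1 - 2 s below the three terms of the minimum: 1 /
   2 is the limit in van der Corput's estimate, and the other two express b < alpha for the two
   exponents of the kernel. *)
have [be [be0 be2 beal bekal eta]] : exists be : R, [/\ 0 < be, be <= 1 / 2, be < alpha,
    be / (kappa * m) < alpha & 0 < 2 * s + be - 1].
  have km : 0 < kappa * m by rewrite mulr_gt0// (lt_trans ltr01).
  have akm : 0 < alpha * (kappa * m) by rewrite mulr_gt0.
  have sk' : 1 - alpha * (kappa * m) < 2 * s.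
    have -> : alpha * (kappa * m) = m * alpha * kappa by ring.
    by lra.
  pose lo := Num.max 0 (1 - 2 * s).
  pose hi := Num.min (1 / 2) (Num.min alpha (alpha * (kappa * m))).
  have lohi : lo < hi.
    rewrite /lo /hi gt_max !lt_min; apply/andP; split; apply/andP; split;
      try (apply/andP; split); try lra; done.
  have lo0 : 0 <= lo by rewrite le_max lexx.
  have los : 1 - 2 * s <= lo by rewrite le_max lexx orbT.
  have hi2 : hi <= 1 / 2 by rewrite ge_min lexx.
  have hia : hi <= alpha by rewrite !ge_min lexx ?orbT.
  have hik : hi <= alpha * (kappa * m) by rewrite !ge_min lexx ?orbT.
  by exists ((lo + hi) / 2); split; rewrite ?ltr_pdivrMr//; lra.
have s0 : 0 < s by lra.
case: hf => fL2 [h [fF [hL2 gL2 _]]].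
set F := fourier f in fF gL2 *.
have FL2 : inL2 F by case: fF.
have [mf1 mf2 _] := fL2; have [mF1 mF2 _] := FL2.
have [Sf _ [if1 if2 _ _]] := inL2_component fL2.
have [SF _ [iF1 iF2 _ _]] := inL2_component FL2.
have [S _ [ig1 ig2 gS1 gS2]] := inL2_component gL2.
pose F1 z := complex.Re (F z); pose F2 z := complex.Im (F z).
pose w (G : R -> R) z := ((1 + z ^+ 2) `^ (s / 2) * G z) ^+ 2.
have g1E : (fun z => complex.Re (((1 + z ^+ 2) `^ (s / 2))%:C * F z) ^+ 2) = w F1.
  by apply/funext => z; rewrite ReZ.
have g2E : (fun z => complex.Im (((1 + z ^+ 2) `^ (s / 2))%:C * F z) ^+ 2) = w F2.
  by apply/funext => z; rewrite ImZ.
have {}ig1 : leb.-integrable setT (EFin \o w F1) by rewrite -g1E.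
have {}ig2 : leb.-integrable setT (EFin \o w F2) by rewrite -g2E.
have {}gS1 : \int[leb]_(z in setT) w F1 z <= S.
  by apply: le_trans gS1; rewrite -g1E.
have {}gS2 : \int[leb]_(z in setT) w F2 z <= S.
  by apply: le_trans gS2; rewrite -g2E.
have mw (G : R -> R) : measurable_fun setT (G : measurableTypeR R -> R) ->
    measurable_fun setT (w G : measurableTypeR R -> R).
  move=> mG; apply: measurable_funX; apply: measurable_funM => //.
  apply: (measurableT_comp (measurable_powR _)); apply: measurable_funD => //.
have wN G z : w (fun z => G (- z)) z = w G (- z) by rewrite /w sqrrN.
(* Negative frequencies enter through reflected functions, so the statement is wanted for four
   functions: both components of [F] and their reflections. *)
have aeg (G : R -> R) := @ae_good R mu c alpha m kappa s be gamma C1 C2 G S hc hm hkappa0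
  hkappa1 s0 eta be0 be2 beal bekal C10 C20 gt gx.
have aeo (G : R -> R) : measurable_fun setT (G : measurableTypeR R -> R) ->
    leb.-integrable setT (EFin \o (fun z => G z ^+ 2)) ->
    leb.-integrable setT (EFin \o w G) ->
    \int[leb]_(z in setT) w G z <= S ->
    {ae mu, forall x : R, forall k : nat, good m gamma (k%:R * (pi / 2)) (fun z => G (- z)) x}.
  move=> mG iG iw wS; apply: aeg.
  - exact: measurableT_comp.
  - by apply: (integrable_opp_setT _ iG); exact: measurable_funX.
  - have := integrable_opp_setT (mw _ mG) iw; apply: eq_integrable => // z _.
    by rewrite /= -wN.
  - apply: le_trans wS; rewrite -(Rintegral_opp_setT (mw _ mG) iw).
    by under [leRHS]eq_Rintegral do rewrite -wN.
have H := negligibleU (negligibleU (aeg F1 mF1 iF1 ig1 gS1) (aeg F2 mF2 iF2 ig2 gS2))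
  (negligibleU (aeo F1 mF1 iF1 ig1 gS1) (aeo F2 mF2 iF2 ig2 gS2)).
apply: (negligibleS _ H) => x /= hx; apply: contrapT => hn; apply: hx.
have G1 k : good m gamma (k%:R * (pi / 2)) F1 x.
  by apply: contrapT => h'; apply: hn; left; left => /(_ k).
have G2 k : good m gamma (k%:R * (pi / 2)) F2 x.
  by apply: contrapT => h'; apply: hn; left; right => /(_ k).
have G3 k : good m gamma (k%:R * (pi / 2)) (fun z => F1 (- z)) x.
  by apply: contrapT => h'; apply: hn; right; left => /(_ k).
have G4 k : good m gamma (k%:R * (pi / 2)) (fun z => F2 (- z)) x.
  by apply: contrapT => h'; apply: hn; right; right => /(_ k).
have iF1' a b := integrable_of_sqr a b mF1 iF1.
have iF2' a b := integrable_of_sqr a b mF2 iF2.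
(* Re (exp (i th) F) = cos th F1 - sin th F2 uses the phases of index 0 and 1, and Im (exp (i th) F)
   = sin th F1 + cos th F2 those of index 3 and 0. *)
have cos0 th : cos (th + 0%:R * (pi / 2)) = cos th :> R by rewrite mul0r addr0.
have cos1 th : cos (th + 1%:R * (pi / 2)) = - sin th :> R by rewrite mul1r cosDpihalf.
have cos3 th : cos (th + 3%:R * (pi / 2)) = sin th :> R.
  have -> : th + 3%:R * (pi / 2) = th + pi + pi / 2 by field.
  by rewrite cosDpihalf sinDpi opprK.
have i1 A := integrable_of_sqr (- A) A mf1 if1.
have i2 A := integrable_of_sqr (- A) A mf2 if2.
have ap := fourier_window_approx fF.
have mo (G : R -> R) : measurable_fun setT (G : measurableTypeR R -> R) ->
    measurable_fun setT ((fun z => G (- z)) : measurableTypeR R -> R).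
  by move=> mG; exact: measurableT_comp.
have isq (G : R -> R) (sg : bool) : measurable_fun setT (G : measurableTypeR R -> R) ->
    leb.-integrable setT (EFin \o (fun z => G z ^+ 2)) ->
    leb.-integrable `]0, +oo[
      (EFin \o (fun z => (G z + (-1) ^+ sg * G (- z)) ^+ 2)).
  by move=> mG iG; have [] := fold_sqr sg (measurable_itv `]0, +oo[) mG iG (lexx _).
have hw1 r : 0 < r -> leb.-integrable `]0, +oo[
     (EFin \o window x r (fun z => F1 z + F1 (- z)) (fun z => F2 z - F2 (- z))) /\
   \int[leb]_(z in `]0, +oo[)
     window x r (fun z => F1 z + F1 (- z)) (fun z => F2 z - F2 (- z)) z =
   pi * \int[leb]_(y in ball x r) complex.Re (f y).
  move=> r0.
  have mE := measurable_funD mF1 (mo _ mF1); have mO := measurable_funB mF2 (mo _ mF2).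
  have iE := isq _ false mF1 iF1; have iO := isq _ true mF2 iF2.
  have {}iE : leb.-integrable `]0, +oo[
      (EFin \o (fun z => (F1 z + F1 (- z)) ^+ 2)).
    by apply: eq_integrable iE => // z _; rewrite /= expr0 mul1r.
  have {}iO : leb.-integrable `]0, +oo[
      (EFin \o (fun z => (F2 z - F2 (- z)) ^+ 2)).
    by apply: eq_integrable iO => // z _; rewrite /= expr1 mulN1r.
  split; first exact: integrable_window.
  apply: (@Rintegral_window _ (fun y => complex.Re (f y)) (fun z => F1 z + F1 (- z))
    (fun z => F2 z - F2 (- z)) x r r0 i1 mE mO iE iO) => e A0 e0.
  have [A hA h2] := ap e A0 e0; exists A => // N.
  exact: (h2 N).1.
have hw2 r : 0 < r -> leb.-integrable `]0, +oo[
     (EFin \o window x r (fun z => F2 z + F2 (- z)) (fun z => F1 (- z) - F1 z)) /\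
   \int[leb]_(z in `]0, +oo[)
     window x r (fun z => F2 z + F2 (- z)) (fun z => F1 (- z) - F1 z) z =
   pi * \int[leb]_(y in ball x r) complex.Im (f y).
  move=> r0.
  have mE := measurable_funD mF2 (mo _ mF2); have mO := measurable_funB (mo _ mF1) mF1.
  have iE := isq _ false mF2 iF2; have iO := isq _ true mF1 iF1.
  have {}iE : leb.-integrable `]0, +oo[
      (EFin \o (fun z => (F2 z + F2 (- z)) ^+ 2)).
    by apply: eq_integrable iE => // z _; rewrite /= expr0 mul1r.
  have {}iO : leb.-integrable `]0, +oo[
      (EFin \o (fun z => (F1 (- z) - F1 z) ^+ 2)).
    by apply: eq_integrable iO => // z _; rewrite /= expr1 mulN1r -sqrrN opprB.
  split; first exact: integrable_window.
  apply: (@Rintegral_window _ (fun y => complex.Im (f y)) (fun z => F2 z + F2 (- z))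
    (fun z => F1 (- z) - F1 z) x r r0 i2 mE mO iE iO) => e A0 e0.
  have [A hA h2] := ap e A0 e0; exists A => // N.
  exact: (h2 N).2.
have [z|V1 [A1 B1 D1]] := component hm hkappa0 hkappa1 C10 C20 gamma0 gt gx mF1 mF2 iF1' iF2'
   (G1 0%N) (G2 1%N) (G3 0%N) (G4 1%N) _ hw1.
  by rewrite !cos0 !cos1 cosN sinN; ring.
have [z|V2 [A2 B2 D2]] := component hm hkappa0 hkappa1 C10 C20 gamma0 gt gx mF1 mF2 iF1' iF2'
   (G1 3%N) (G2 0%N) (G3 3%N) (G4 0%N) _ hw2.
  by rewrite !cos0 !cos3 cosN sinN; ring.
have near1 : \forall t \near (0 : R)^', t \in `[(-1 : R), 1].
  by near do rewrite in_itv /= -ler_norml; exact: dnbhs0_le.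
have tr t : t \in `[-1, 1] -> (evolution_trunc m f t (gamma x t) N : R[i]^o) @[N --> +oo] -->
    (V1 t +i* V2 t : R[i]^o).
  move=> t1; apply: cvg_complex.
    have := A1 t t1; under eq_fun do under eq_Rintegral do rewrite cos0 cos1 mulNr -Re_expi.
    by under [X in _ -> X @ _ --> _]eq_fun do rewrite ReZ.
  have := A2 t t1; under eq_fun do under eq_Rintegral do rewrite cos3 cos0 -Im_expi.
  by under [X in _ -> X @ _ --> _]eq_fun do rewrite ImZ.
have evE t : t \in `[-1, 1] -> evolution m f t (gamma x t) = V1 t +i* V2 t.
  by move=> t1; rewrite /evolution; exact: (cvg_lim (@norm_hausdorff _ _) (tr t t1)).
exists (V1 0 +i* V2 0); split.
- apply: cvg_complex.
    by under eq_fun do rewrite ReZ.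
  by under eq_fun do rewrite ImZ.
- near=> t; apply/cvg_ex; exists (V1 t +i* V2 t); apply: tr; near: t; exact: near1.
- apply: (@cvg_trans _ ((fun t => V1 t +i* V2 t : R[i]^o) @ 0^')).
    by apply: near_eq_cvg; near=> t; rewrite evE//; near: t; exact: near1.
  exact: cvg_complex.
Unshelve. all: by end_near. Qed.
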